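(* Let $n\geq 1$, let $\Omega\subset\mathbb{R}^n$ be an open set, and let $V:\mathbb{R}^n\to\mathbb{R}$ be bounded and continuous with $V(x)>0$ for all $x\in\Omega$ and $V(x)\geq 0$ for all $x\in\mathbb{R}^n$. Then there exists a constant $C>0$, independent of $t$ and of the initial data, such that the following holds. Let $(u_0,u_1)\in H^1(\mathbb{R}^n)\times L^2(\mathbb{R}^n)$ satisfy $\operatorname{supp}u_1\subset\Omega$ and \[ J_0^2:=\int_{\Omega}\frac{|u_1(x)|^2}{V(x)}\,dx<+\infty, \] and let $u\in C([0,\infty);H^1(\mathbb{R}^n))\cap C^1([0,\infty);L^2(\mathbb{R}^n))$ be the unique weak solution of \[ u_{tt}-\Delta u+V(x)u=0\quad (t>0,\ x\in\mathbb{R}^n),\qquad u(0,x)=u_0(x),\quad u_t(0,x)=u_1(x)\quad (x\in\mathbb{R}^n). \] Then \[ \|u(t,\cdot)\|\leq C(\|u_0\|+J_0)\qquad\text{for all } t\geq 0. \]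
   Context: All functions are real-valued. $\|\cdot\|$ denotes the norm of $L^2(\mathbb{R}^n)$, and $J_0\ge 0$ is the nonnegative square root of $J_0^2$. A weak solution is a function in the stated class satisfying the equation in the sense of distributions on $(0,\infty)\times\mathbb{R}^n$ and attaining the initial data; it is known that for every $(u_0,u_1)\in H^1(\mathbb{R}^n)\times L^2(\mathbb{R}^n)$ there is a unique one. *)

(* Defs.v *)
From HB Require Import structures.
From mathcomp Require Import all_boot all_order all_algebra.
From mathcomp Require Import all_classical all_reals all_analysis.
Import Order.TTheory GRing.Theory Num.Theory.
Import numFieldNormedType.Exports.

Set Implicit Arguments.
Unset Strict Implicit.
Unset Printing Implicit Defensive.

Local Open Scope classical_set_scope.
Local Open Scope ring_scope.

(* The sigma-algebra on [R^n] generated by the coordinates, i.e. the Borel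
   sets. *)
Section measurable_rV.
Context {R : realType} (n : nat).

Let coord (i : 'I_n) : 'rV[R]_n -> R := fun x => x 0 i.

Let rV_set0 : g_sigma_preimage coord set0.
Proof. exact: sigma_algebra0. Qed.

Let rV_setC A : g_sigma_preimage coord A -> g_sigma_preimage coord (~` A).
Proof. exact: sigma_algebraC. Qed.

Let rV_bigcup (F : _^nat) : (forall i, g_sigma_preimage coord (F i)) ->
  g_sigma_preimage coord (\bigcup_i (F i)).
Proof. exact: sigma_algebra_bigcup. Qed.

HB.instance Definition _ := @isMeasurable.Build
  (measure_tuple_display default_measure_display)
  'rV[R]_n (g_sigma_preimage coord) rV_set0 rV_setC rV_bigcup.
End measurable_rV.

Section lebesgue_rV.
Context {R : realType}.

Definition rV_cons n (p : measurableTypeR R * 'rV[R]_n) : 'rV[R]_n.+1 :=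
  \row_i (if unlift ord0 i is Some j then p.2 0 j else p.1).

Definition rV_uncons n (v : 'rV[R]_n.+1) : measurableTypeR R * 'rV[R]_n :=
  (v 0 ord0, \row_j v 0 (lift ord0 j)).

Lemma rV_consK n : cancel (@rV_cons n) (@rV_uncons n).
Proof.
move=> [x v]; rewrite /rV_uncons /rV_cons; congr pair.
  by rewrite mxE unlift_none.
by apply/rowP => j; rewrite !mxE liftK.
Qed.

Lemma measurable_coord n (i : 'I_n) :
  measurable_fun [set: 'rV[R]_n] (fun x : 'rV[R]_n => x 0 i).
Proof.
move=> _ Y mY; rewrite setTI; apply: sub_sigma_algebra => /=.
rewrite -bigcup_seq/=; exists i => /=; first by rewrite mem_index_enum.
by exists Y => //; rewrite setTI.
Qed.

Lemma measurable_fun_rV d (T : measurableType d) n (f : T -> 'rV[R]_n) :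
  (forall i, measurable_fun [set: T] (fun t => f t 0 i)) ->
  measurable_fun [set: T] f.
Proof.
move=> mf _ Y mY; rewrite setTI.
suff: g_sigma_preimage (fun (i : 'I_n) (x : 'rV[R]_n) => x 0 i) `<=`
    [set A | measurable (f @^-1` A)] by apply.
apply: smallest_sub.
  split => /=.
  - by rewrite preimage_set0.
  - by move=> A mA; rewrite setTD preimage_setC; exact: measurableC.
  - by move=> F mF; rewrite preimage_bigcup; exact: bigcupT_measurable.
rewrite -bigcup_seq => A [i _ [B mB <-]].
by rewrite /= setTI; move: (mf i measurableT B mB); rewrite setTI.
Qed.

Lemma measurable_rV_cons n : measurable_fun setT (@rV_cons n).
Proof.
apply: measurable_fun_rV => i; rewrite /rV_cons.
under eq_fun do rewrite mxE.
case: unliftP => [j _|_]; last exact: measurable_fst.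
exact: (measurableT_comp (@measurable_coord n j) measurable_snd).
Qed.

Lemma measurable_rV_uncons n : measurable_fun setT (@rV_uncons n).
Proof.
apply/measurable_fun_pair; first exact: measurable_coord.
apply: measurable_fun_rV => i.
by under eq_fun do rewrite mxE; exact: measurable_coord.
Qed.

Section cons.
Context n (m : {sigma_finite_measure set 'rV[R]_n -> \bar R}).

Definition lebesgue_rV_cons : set 'rV[R]_n.+1 -> \bar R :=
  pushforward (@lebesgue_measure R \x m)%E (@rV_cons n).

Let measurable_preim (A : set 'rV[R]_n.+1) :
  measurable A -> measurable (@rV_cons n @^-1` A).
Proof.
by move=> mA; rewrite -[X in measurable X]setTI; exact: measurable_rV_cons.
Qed.

Let cons0 : lebesgue_rV_cons set0 = 0%E.
Proof. by rewrite /lebesgue_rV_cons /pushforward preimage_set0 measure0. Qed.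

Let cons_ge0 A : (0 <= lebesgue_rV_cons A)%E.
Proof. exact: (measure_ge0 (@lebesgue_measure R \x m)%E). Qed.

Let cons_sigma_additive : semi_sigma_additive lebesgue_rV_cons.
Proof.
move=> F mF tF mUF; rewrite /lebesgue_rV_cons /pushforward preimage_bigcup.
have := @measure_semi_sigma_additive _ _ _ (@lebesgue_measure R \x m)%E
  (fun k => @rV_cons n @^-1` F k).
apply.
- by move=> k; exact: measurable_preim.
- apply/trivIsetP => /= i j _ _ ij; rewrite -preimage_setI.
  by move/trivIsetP : tF => /(_ _ _ _ _ ij) ->//; rewrite preimage_set0.
- by rewrite -preimage_bigcup; exact: measurable_preim.
Qed.

HB.instance Definition _ := isMeasure.Build _ _ _ lebesgue_rV_cons
  cons0 cons_ge0 cons_sigma_additive.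

Let cons_sigma_finite : sigma_finite setT lebesgue_rV_cons.
Proof.
have /sigma_finiteP[F [TF ndF Foo]] := sigma_finiteT (@lebesgue_measure R).
have /sigma_finiteP[G [TG ndG Goo]] := sigma_finiteT m.
exists (fun k => @rV_uncons n @^-1` (F k `*` G k)).
  rewrite -preimage_bigcup (_ : \bigcup_k _ = setT) ?preimage_setT//.
  rewrite -subTset => -[x v] _.
  have [i _ Fix] : (\bigcup_k F k) x by rewrite -TF.
  have [j _ Gjv] : (\bigcup_k G k) v by rewrite -TG.
  exists (maxn i j) => //; split.
    by move: x Fix; exact/subsetPset/ndF/leq_maxl.
  by move: v Gjv; exact/subsetPset/ndG/leq_maxr.
move=> k; have [mF Fk] := Foo k; have [mG Gk] := Goo k; split.
  rewrite -[X in measurable X]setTI.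
  by apply: measurable_rV_uncons => //; exact: measurableX.
rewrite /lebesgue_rV_cons /pushforward -comp_preimage.
rewrite (_ : _ \o _ = id) ?preimage_id; last first.
  by apply/funext => p /=; rewrite rV_consK.
by rewrite product_measure1E// lte_mul_pinfty// ge0_fin_numE.
Qed.

HB.instance Definition _ := Measure_isSigmaFinite.Build _ _ _ lebesgue_rV_cons
  cons_sigma_finite.

End cons.

(* [R^0] has one point, of measure [1]. *)
Fixpoint lebesgue_rV n : {sigma_finite_measure set 'rV[R]_n -> \bar R} :=
  match n with
  | 0 => \d_(0 : 'rV[R]_0)
  | k.+1 => lebesgue_rV_cons (lebesgue_rV k)
  end.

Lemma measurable_rV_box n (A : 'I_n -> set R) : (forall i, measurable (A i)) ->
  measurable [set x : 'rV[R]_n | forall i, A i (x 0 i)].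
Proof.
move=> mA; have -> : [set x : 'rV[R]_n | forall i, A i (x 0 i)] =
    \bigcap_(i in [set: 'I_n]) ((fun x : 'rV[R]_n => x 0 i) @^-1` A i).
  by apply/seteqP; split => x Ax; [move=> i _|move=> i]; exact: Ax.
apply: fin_bigcap_measurable => // i _.
by rewrite -[X in measurable X]setTI; exact: measurable_coord.
Qed.

Lemma lebesgue_rV_box n (A : 'I_n -> set R) : (forall i, measurable (A i)) ->
  lebesgue_rV n [set x | forall i, A i (x 0 i)] =
  (\prod_(i < n) lebesgue_measure (A i))%E.
Proof.
elim: n A => [|n IH] A mA.
  by rewrite big_ord0 /= diracE mem_set// => i; have := ltn_ord i.
rewrite big_ord_recl -IH//.
pose B : set 'rV[R]_n := [set x | forall i : 'I_n, A (lift ord0 i) (x 0 i)].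
have mB : measurable B.
  exact: (@measurable_rV_box n (fun i : 'I_n => A (lift ord0 i))).
transitivity ((@lebesgue_measure R \x lebesgue_rV n)%E (A ord0 `*` B)); last first.
  exact: (@product_measure1E _ _ _ _ _ (@lebesgue_measure R) _ _ _ (mA ord0) mB).
rewrite /= /lebesgue_rV_cons /pushforward; congr (_ _).
apply/seteqP; split => [[x v] /= Axv|[x v] /= [Ax Av] i].
  split; first by have := Axv ord0; rewrite mxE unlift_none.
  by move=> i; have := Axv (lift ord0 i); rewrite mxE liftK.
by rewrite mxE; case: unliftP => [j ->|->].
Qed.

End lebesgue_rV.

Section test_functions.
Context {R : realType} {W : normedModType R}.
Implicit Types (f : W -> R) (U : set W).

Fixpoint Ck (k : nat) f : Prop :=
  continuous f /\
  if k is j.+1 then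
    forall v : W, (forall x, derivable f x v) /\ Ck j (fun x => 'D_v f x)
  else True.

Definition supp f : set W := closure [set x | f x != 0].

(* Elements of [C_c^oo(U)], extended by zero outside [U]. *)
Definition test_fun U f : Prop :=
  [/\ forall k, Ck k f, compact (supp f) & supp f `<=` U].

End test_functions.

(* Elements of [L^2] and [H^1] are represented by Borel functions, and are
   meant up to almost everywhere equality. *)
Section function_spaces.
Context {R : realType} {n : nat}.
Local Notation E := 'rV[R]_n.
Local Notation mu := (@lebesgue_rV R n).
Implicit Types (f g : E -> R) (u : R -> E -> R) (i : 'I_n).

Definition L2 : {pred E -> R} := Lfun mu 2%:E.

Definition L2norm f : \bar R := 'N[mu]_2%:E [EFin \o f].

Definition basis_vec i : E := delta_mx 0 i.

Definition is_weak_deriv i f g : Prop :=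
  forall phi : E -> R, test_fun setT phi ->
  \int[mu]_x (f x * 'D_(basis_vec i) phi x) = - \int[mu]_x (g x * phi x).

Definition H1 f : Prop :=
  f \in L2 /\ forall i, exists2 g, g \in L2 & is_weak_deriv i f g.

(* Unique up to almost everywhere equality when it exists. *)
Definition weakD i f : E -> R :=
  xget (cst 0) [set g | g \in L2 /\ is_weak_deriv i f g].

Definition H1norm f : \bar R :=
  ((L2norm f ^+ 2 + \sum_(i < n) L2norm (weakD i f) ^+ 2) `^ 2^-1)%E.

(* Continuity of [u] on [[0, +oo[] for the norm [N]; the values of [u] at
   negative times are irrelevant. *)
Definition continuous_in_norm (N : (E -> R) -> \bar R) u : Prop :=
  forall s : R, 0 <= s ->
  N (u t \- u s) @[t --> within [set t | 0 <= t] (nbhs s)] --> 0%E.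

Definition C0_L2 u : Prop :=
  (forall t, 0 <= t -> u t \in L2) /\ continuous_in_norm L2norm u.

Definition C0_H1 u : Prop :=
  (forall t, 0 <= t -> H1 (u t)) /\ continuous_in_norm H1norm u.

(* [v] is the derivative of [u] on [[0, +oo[] in [L^2], one-sided at [0]. *)
Definition L2_derivative u (v : R -> E -> R) : Prop :=
  forall s : R, 0 <= s ->
  L2norm (fun x => (u t x - u s x) / (t - s) - v s x)
    @[t --> within [set t | 0 <= t] s^'] --> 0%E.

(* The complement of the largest open set on which [f] vanishes almost
   everywhere. *)
Definition ess_supp f : set E :=
  [set x | forall U, open_nbhs x U ->
    ~ mu.-negligible (U `&` [set y | f y != 0])].

End function_spaces.

Section wave_equation.
Context {R : realType} {n : nat}.
Local Notation E := 'rV[R]_n.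
Local Notation mu := (@lebesgue_rV R n).
Implicit Types (V : E -> R) (phi : R * E -> R).

Definition dt phi : R * E -> R := fun z => 'D_((1, 0) : R * E) phi z.

Definition dx (i : 'I_n) phi : R * E -> R :=
  fun z => 'D_((0, basis_vec i) : R * E) phi z.

Definition wave_op V phi : R * E -> R :=
  fun z => dt (dt phi) z - \sum_(i < n) dx i (dx i phi) z + V z.2 * phi z.

(* [u_tt - Delta u + V u = 0] in the sense of distributions on
   [(0, +oo) * R^n]; [wave_op V] is its own transpose. For [u] in
   [C([0, +oo); L^2)], the distribution [u] acts by the iterated integral, whose
   inner integral is continuous in [t]. *)
Definition distr_solution V (u : R -> E -> R) : Prop :=
  forall phi, test_fun [set z : R * E | 0 < z.1] phi ->
  \int[lebesgue_measure]_(t in `]0, +oo[)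
    (\int[mu]_x (u t x * wave_op V phi (t, x))) = 0.

Definition weak_solution V (u0 u1 : E -> R) (u : R -> E -> R) : Prop :=
  [/\ C0_H1 u,
      exists ut, [/\ C0_L2 ut, L2_derivative u ut & ut 0 = u1 %[ae mu]],
      u 0 = u0 %[ae mu] &
      distr_solution V u].

Definition J0sq (Omega : set E) V (u1 : E -> R) : \bar R :=
  (\int[mu]_(x in Omega) (`|u1 x| ^+ 2 / V x)%:E)%E.

Definition J0 (Omega : set E) V (u1 : E -> R) : \bar R :=
  (J0sq Omega V u1 `^ 2^-1)%E.

End wave_equation.

(* Main.v *)
(* Let W(t) = int_0^t u(s) ds, an integral in L^2. Integrating the equation once
   in time gives u_t - Delta W + V W = u_1 weakly, and pairing this with u = W_t
   shows that ||u||^2 + ||grad W||^2 + (V W, W) - 2 (u_1, W) is constant, equal to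
   ||u_0||^2. As u_1 vanishes almost everywhere off Omega, on which
   2 u_1 W - V W^2 <= u_1^2 / V, it follows that ||u||^2 <= ||u_0||^2 + J_0^2, so
   that C = 1 works.
   The solution satisfies the equation only against test functions; pairing with
   u is justified by testing with rho_m(. - y) for a mollifier rho_m, multiplying
   by u(y) and integrating in y. *)

Require Import Defs.
From mathcomp Require Import all_boot all_order all_algebra.
From mathcomp Require Import all_classical all_reals all_analysis.
From mathcomp Require Import measurable_realfun.
From mathcomp Require Import ring lra.
Set Implicit Arguments.
Unset Strict Implicit.
Unset Printing Implicit Defensive.
Import Order.TTheory GRing.Theory Num.Theory.
Import numFieldNormedType.Exports.
Local Open Scope classical_set_scope.
Local Open Scope ring_scope.

(** * Square integrable functions *)

(** The energy sits one time derivative below the usual one: [u] itself is the velocity of [W], so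
    its norm is controlled, and [W(0) = 0] removes the gradient and the potential from the initial
    value. Calculus in time is reduced to real functions [dotp (w t) (z t)]. The curve [W] is a
    limit of Riemann sums, identified by its pairings with a fixed [Z]; norm bounds come back by
    choosing for [Z] the very difference to be estimated. The gradient of [W] is built in the same
    way, as primitives [G i] of the weak derivatives of [u], and only then recognized as weak
    derivatives of [W]; its derivative in time is thus known from the start. The obstacle in time is
    that [ut] is merely continuous, so the integrated equation cannot be obtained by
    differentiating. Testing with products [eta(t) psi(x)] shows instead that local averages of the
    conserved quantity at two instants agree, and continuity removes the averaging. The final
    constant comes from [a^2 + b^2 <= (a + b)^2] for nonnegative [a] and [b]. *)

Section square_integrable.
Context d {T : measurableType d} {R : realType}.
Variable mu : {measure set T -> \bar R}.
Implicit Types f g h : T -> R.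

Local Notation SL2 := (Lfun mu 2%:E).

(** The real integral gives a default value when the product is not integrable, so the pairing is
    bilinear only within L^2; hence the membership hypotheses below. *)
Definition L2dot f g : R := \int[mu]_x (f x * g x).
Definition L2nrm f : R := Num.sqrt (L2dot f f).
Local Notation dotp := L2dot.
Local Notation nrm2 := L2nrm.

Lemma Lfun2P f : f \in SL2 <->
  measurable_fun setT f /\ mu.-integrable setT (EFin \o (fun x => f x ^+ 2)).
Proof.
split=> [fL|[mf intf]].
  split; last exact: Lfun2_integrable_sqr.
  by move: fL; rewrite inE => /andP[/[!inE]].
rewrite inE; apply/andP; split; rewrite inE//= /finite_norm unlock.
rewrite poweR_lty//.
have /integrableP[_] := intf.
apply: le_lt_trans; rewrite le_eqVlt; apply/orP; left; apply/eqP.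
apply: eq_integral => x _ /=.
by rewrite powR_mulrn// -normrX.
Qed.

Lemma Lfun2_measurable f : f \in SL2 -> measurable_fun setT f.
Proof. by move/Lfun2P => []. Qed.

Lemma Lfun2_integrableM f g : f \in SL2 -> g \in SL2 ->
  mu.-integrable setT (EFin \o (fun x => f x * g x)).
Proof. by move=> fL gL; apply/Lfun1_integrable; exact: Lfun2_mul_Lfun1. Qed.

Lemma le_Lfun2 f g : measurable_fun setT f -> g \in SL2 ->
  (forall x, `|f x| <= `|g x|) -> f \in SL2.
Proof.
move=> mf /Lfun2P[mg ig] fg; apply/Lfun2P; split => //.
apply: le_integrable ig => //.
  by apply/measurable_EFinP; exact: measurable_funX.
by move=> x _ /=; rewrite lee_fin !normrX ler_sqr ?nnegrE.
Qed.

Lemma Lfun2D f g : f \in SL2 -> g \in SL2 -> f \+ g \in SL2.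
Proof.
have p1 : (1 <= 2%:E :> \bar R)%E by rewrite lee_fin ler1n.
by move=> fL gL; exact: (Lfun_addr_closed mu p1).2.
Qed.

Lemma Lfun2Z (a : R) f : f \in SL2 -> (fun x => a * f x) \in SL2.
Proof.
move=> /Lfun2P[mf intf]; apply/Lfun2P; split; first exact: measurable_funM.
apply: eq_integrable (integrableZl _ (a ^+ 2) intf) => // x _ /=.
by rewrite exprMn EFinM.
Qed.

Lemma Lfun2_cst0 : cst 0 \in SL2.
Proof.
have p1 : (1 <= 2%:E :> \bar R)%E by rewrite lee_fin ler1n.
exact: (Lfun_addr_closed mu p1).1.
Qed.

Lemma Lfun2N f : f \in SL2 -> \- f \in SL2.
Proof.
move=> fL; rewrite (_ : \- f = fun x => -1 * f x); first exact: Lfun2Z.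
by apply/funext => x /=; rewrite mulN1r.
Qed.

Lemma Lfun2B f g : f \in SL2 -> g \in SL2 -> f \- g \in SL2.
Proof. by move=> fL gL; exact: Lfun2D fL (Lfun2N gL). Qed.

Lemma Lfun2_sum (I : Type) (s : seq I) (F : I -> T -> R) :
  (forall i, F i \in SL2) -> (fun x => \sum_(i <- s) F i x) \in SL2.
Proof.
move=> FL; elim: s => [|i s IH].
  by under eq_fun do rewrite big_nil; exact: Lfun2_cst0.
by under eq_fun do rewrite big_cons; exact: (Lfun2D (FL i) IH).
Qed.

Lemma Lfun2_norm f : f \in SL2 -> (fun x => `|f x|) \in SL2.
Proof.
move=> fL; apply: le_Lfun2 (fL) _ => [|x /=]; last by rewrite normr_id.
by apply: measurableT_comp => //; exact: Lfun2_measurable.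
Qed.

Lemma dotpC f g : dotp f g = dotp g f.
Proof. by apply: eq_Rintegral => x _; rewrite mulrC. Qed.

Lemma dotpDl f g h : f \in SL2 -> g \in SL2 -> h \in SL2 ->
  dotp (f \+ g) h = dotp f h + dotp g h.
Proof.
move=> fL gL hL; rewrite /L2dot -RintegralD//; [|exact: Lfun2_integrableM..].
by apply: eq_Rintegral => x _ /=; rewrite mulrDl.
Qed.

Lemma dotpBl f g h : f \in SL2 -> g \in SL2 -> h \in SL2 ->
  dotp (f \- g) h = dotp f h - dotp g h.
Proof.
move=> fL gL hL; rewrite /L2dot -RintegralB//; [|exact: Lfun2_integrableM..].
by apply: eq_Rintegral => x _ /=; rewrite mulrBl.
Qed.

Lemma dotpZl (a : R) f g : f \in SL2 -> g \in SL2 ->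
  dotp (fun x => a * f x) g = a * dotp f g.
Proof.
move=> fL gL; rewrite /L2dot -RintegralZl//; last exact: Lfun2_integrableM.
by apply: eq_Rintegral => x _ /=; rewrite mulrA.
Qed.

Lemma dotpDr f g h : f \in SL2 -> g \in SL2 -> h \in SL2 ->
  dotp h (f \+ g) = dotp h f + dotp h g.
Proof. by move=> *; rewrite dotpC dotpDl// !(dotpC h). Qed.

Lemma dotpBr f g h : f \in SL2 -> g \in SL2 -> h \in SL2 ->
  dotp h (f \- g) = dotp h f - dotp h g.
Proof. by move=> *; rewrite dotpC dotpBl// !(dotpC h). Qed.

Lemma dotpZr (a : R) f g : f \in SL2 -> g \in SL2 ->
  dotp g (fun x => a * f x) = a * dotp g f.
Proof. by move=> *; rewrite dotpC dotpZl// (dotpC g). Qed.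

Lemma dotp_suml (I : Type) (s : seq I) (F : I -> T -> R) g :
  (forall i, F i \in SL2) -> g \in SL2 ->
  dotp (fun x => \sum_(i <- s) F i x) g = \sum_(i <- s) dotp (F i) g.
Proof.
move=> FL gL; elim: s => [|i s IH].
  rewrite big_nil /L2dot; under eq_Rintegral do rewrite big_nil mul0r.
  by rewrite Rintegral_cst// mul0r.
rewrite big_cons -IH -dotpDl//; last exact: Lfun2_sum.
by apply: eq_Rintegral => x _ /=; rewrite big_cons.
Qed.

Lemma dotp_ge0 f : 0 <= dotp f f.
Proof. by apply: Rintegral_ge0 => x _; rewrite -expr2 sqr_ge0. Qed.

Lemma nrm2_ge0 f : 0 <= nrm2 f. Proof. exact: sqrtr_ge0. Qed.

Lemma sqr_nrm2 f : nrm2 f ^+ 2 = dotp f f.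
Proof. by rewrite sqr_sqrtr// dotp_ge0. Qed.

(** The bridge between the real norm and the extended-real integral, to which the convergence
    theorems and Tonelli apply. *)
Lemma dotp_nrm2_fin f : f \in SL2 ->
  (\int[mu]_x (f x ^+ 2)%:E)%E = (nrm2 f ^+ 2)%:E.
Proof.
move=> fL; rewrite sqr_nrm2 /L2dot /Rintegral fineK; last first.
  by apply: integrable_fin_num => //; exact: Lfun2_integrableM.
by apply: eq_integral => x _; rewrite expr2.
Qed.

Lemma Lnorm2E f : f \in SL2 -> ('N[mu]_2%:E [EFin \o f])%E = (nrm2 f)%:E.
Proof.
move=> fL; rewrite unlock.
under eq_integral do rewrite /= powR_mulrn// real_normK ?num_real//.
by rewrite dotp_nrm2_fin// poweR_EFin -powR_mulrn ?nrm2_ge0// -powRrM mulfV// powRr1 ?nrm2_ge0.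
Qed.

Lemma CauchySchwarz_dotp f g : f \in SL2 -> g \in SL2 ->
  `|dotp f g| <= nrm2 f * nrm2 g.
Proof.
move=> fL gL.
have qf (a b : R) : 0 <= a ^+ 2 * dotp f f + 2 * a * b * dotp f g + b ^+ 2 * dotp g g.
  have := dotp_ge0 ((fun x => a * f x) \+ (fun x => b * g x)).
  have aL := Lfun2Z a fL; have bL := Lfun2Z b gL.
  rewrite dotpDl ?dotpDr ?dotpZl ?dotpZr//; try exact: Lfun2D.
  by rewrite (dotpC g f); congr (_ <= _); ring.
rewrite -ler_sqr ?nnegrE ?mulr_ge0 ?nrm2_ge0// exprMn !sqr_nrm2 real_normK ?num_real//.
have [f0|f0] := eqVneq (dotp f f) 0.
  (* With [x = dotp g g] and [y = dotp f g], these coefficients turn the form into [- (x + 2) y^4],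
     whose nonnegativity forces [y = 0]. *)
  have := qf (- dotp f g * (dotp g g + 1)) (dotp f g ^+ 2); rewrite f0.
  have := dotp_ge0 g; set x := dotp g g; set y := dotp f g => x0.
  have -> : (- y * (x + 1)) ^+ 2 * 0 + 2 * (- y * (x + 1)) * y ^+ 2 * y +
    (y ^+ 2) ^+ 2 * x = - ((x + 2) * (y ^+ 2) ^+ 2) by ring.
  rewrite oppr_ge0 pmulr_rle0; last by lra.
  have := sqr_ge0 (y ^+ 2) => /[swap] y4 y4'.
  have /eqP : (y ^+ 2) ^+ 2 = 0 by apply/eqP; rewrite eq_le y4 y4'.
  rewrite sqrf_eq0 => /eqP y0.
  by rewrite y0 mul0r.
have f1 : 0 < dotp f f by rewrite lt_def f0 dotp_ge0.
have := qf (- dotp f g) (dotp f f); set x := dotp g g; set y := dotp f g; set z := dotp f f in f1 *.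
have -> : (- y) ^+ 2 * z + 2 * (- y) * z * y + z ^+ 2 * x = z * (z * x - y ^+ 2) by ring.
by rewrite pmulr_rge0// subr_ge0.
Qed.

Lemma dotp_le_nrm2 f g : f \in SL2 -> g \in SL2 -> dotp f g <= nrm2 f * nrm2 g.
Proof.
by move=> fL gL; apply: le_trans (CauchySchwarz_dotp fL gL); exact: ler_norm.
Qed.

Lemma nrm2D f g : f \in SL2 -> g \in SL2 -> nrm2 (f \+ g) <= nrm2 f + nrm2 g.
Proof.
move=> fL gL; rewrite -ler_sqr ?nnegrE ?addr_ge0 ?nrm2_ge0//.
rewrite sqr_nrm2 dotpDl ?dotpDr//; try exact: Lfun2D.
rewrite sqrrD !sqr_nrm2 (dotpC g f).
have := dotp_le_nrm2 fL gL; lra.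
Qed.

Lemma nrm2Z (a : R) f : f \in SL2 -> nrm2 (fun x => a * f x) = `|a| * nrm2 f.
Proof.
move=> fL; rewrite /L2nrm dotpZl ?dotpZr//; last exact: Lfun2Z.
by rewrite mulrA -expr2 sqrtrM ?sqr_ge0// sqrtr_sqr.
Qed.

Lemma nrm2N f : f \in SL2 -> nrm2 (\- f) = nrm2 f.
Proof.
move=> fL; rewrite -[RHS]mul1r -[1]normr1 -[`|1|]normrN -nrm2Z//.
by congr nrm2; apply/funext => x; rewrite mulN1r.
Qed.

Lemma nrm2_distC f g : nrm2 (f \- g) = nrm2 (g \- f).
Proof.
by rewrite /L2nrm; congr Num.sqrt; apply: eq_Rintegral => x _ /=; ring.
Qed.

Lemma nrm2B f g : f \in SL2 -> g \in SL2 -> nrm2 (f \- g) <= nrm2 f + nrm2 g.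
Proof.
by move=> fL gL; rewrite -(nrm2N gL); apply: nrm2D => //; exact: Lfun2N.
Qed.

Lemma nrm2_cst0 : nrm2 (cst 0) = 0.
Proof.
rewrite /L2nrm /L2dot; under eq_Rintegral do rewrite /= mul0r.
by rewrite Rintegral_cst// mul0r sqrtr0.
Qed.

Lemma nrm2_triangle h f g : f \in SL2 -> g \in SL2 -> h \in SL2 ->
  nrm2 (f \- g) <= nrm2 (f \- h) + nrm2 (h \- g).
Proof.
move=> fL gL hL; rewrite (_ : f \- g = (f \- h) \+ (h \- g)).
  by apply: nrm2D; exact: Lfun2B.
by apply/funext => x /=; ring.
Qed.

Lemma nrm2_sum (I : Type) (s : seq I) (F : I -> T -> R) :
  (forall i, F i \in SL2) ->
  nrm2 (fun x => \sum_(i <- s) F i x) <= \sum_(i <- s) nrm2 (F i).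
Proof.
move=> FL; elim: s => [|i s IH].
  by rewrite big_nil; under eq_fun do rewrite big_nil; rewrite nrm2_cst0.
rewrite big_cons; under eq_fun do rewrite big_cons.
by apply: (le_trans (nrm2D (FL i) (Lfun2_sum s FL))); rewrite lerD2l.
Qed.

Lemma eq_ae_dotp f1 f2 g : f1 \in SL2 -> f2 \in SL2 -> g \in SL2 ->
  f1 = f2 %[ae mu] -> dotp f1 g = dotp f2 g.
Proof.
move=> f1L f2L gL f12; rewrite /L2dot /Rintegral; congr fine.
have m1 := Lfun2_measurable f1L; have m2 := Lfun2_measurable f2L.
have m3 := Lfun2_measurable gL.
apply: ae_eq_integral => //; try by apply/measurable_EFinP; exact: measurable_funM.
by apply: filterS f12 => x /= + _ => ->.
Qed.

Lemma Lfun2_indic (A : set T) : measurable A -> (mu A < +oo)%E ->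
  (\1_A : T -> R) \in SL2.
Proof.
move=> mA A_fin; apply/Lfun2P; split; first exact: measurable_indic.
rewrite (_ : (fun x => _) = \1_A); last first.
  by apply/funext => x; rewrite indicE; case: (_ \in _); rewrite ?expr1n ?expr0n.
apply/integrableP; split; first by apply/measurable_EFinP; exact: measurable_indic.
rewrite (eq_integral (fun x => (\1_A x)%:E)) ?integral_indic ?setIT// => x _.
by rewrite /= ger0_norm// indicE.
Qed.

End square_integrable.

(** * Dominated convergence and completeness of L^2 *)

Section L2_convergence.
Context d {T : measurableType d} {R : realType}.
Variable mu : {measure set T -> \bar R}.
Local Notation SL2 := (Lfun mu 2%:E).
Local Notation dotp := (L2dot mu).
Local Notation nrm2 := (L2nrm mu).

(** Dominated convergence for the squares [(w k - f)^2], which lie below the integrable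
    [(2 g)^2]. *)
Lemma dominated_nrm2_cvg (w : nat -> T -> R) (f g : T -> R) :
  (forall k, measurable_fun setT (w k)) -> g \in SL2 ->
  (forall k x, `|w k x| <= g x) -> (forall x, w ^~ x @ \oo --> f x) ->
  f \in SL2 /\ nrm2 (w k \- f) @[k --> \oo] --> 0.
Proof.
move=> mw gL wg wf.
have mf : measurable_fun setT f.
  by apply: (measurable_fun_cvg (h := w)) => // x _; exact: wf.
have fg x : `|f x| <= `|g x|.
  apply: (@le_trans _ _ (g x)); last exact: ler_norm.
  have h : `|w k x| @[k --> \oo] --> `|f x| by apply: cvg_norm; exact: wf.
  rewrite -(cvg_lim _ h)//.
  by apply: limr_le; [apply: cvgP h | near=> k; exact: wg].
have fL : f \in SL2 by exact: le_Lfun2 fg.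
have wL k : w k \in SL2.
  by apply: (le_Lfun2 (mw k) gL) => x; exact: le_trans (wg k x) (ler_norm _).
split => //.
have g2L : (fun x => 2 * g x) \in SL2 by exact: Lfun2Z.
have mB k : measurable_fun setT (fun x => (((w k x - f x) ^+ 2)%:E)).
  by apply/measurable_EFinP; apply: measurable_funX; exact: measurable_funB.
have cvgB x : (fun k => ((w k x - f x) ^+ 2)%:E) @ \oo --> (0%R)%:E.
  apply: cvg_EFin; first by near=> k.
  rewrite /comp /= -[X in _ --> X](expr0n _ 2)/= .
  rewrite -(subrr (f x)).
  apply: (@cvg_comp _ _ _ (fun k => w k x - f x) (fun y : R => y ^+ 2) _ (nbhs (f x - f x))).
    by apply: cvgB; [exact: wf|exact: cvg_cst].
  exact: exprn_continuous.
have B2 k x : `|w k x - f x| <= 2 * g x.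
  apply: (le_trans (ler_normB _ _)).
  have := wg k x; have := fg x; rewrite (ger0_norm (x := g x)); last first.
    by apply: le_trans (wg k x); exact: normr_ge0.
  lra.
have g2i := (proj1 (Lfun2P mu _) g2L).2.
have := @dominated_convergence _ T R mu setT measurableT
  (fun k x => ((w k x - f x) ^+ 2)%:E) (cst 0%E) (EFin \o (fun x => (2 * g x) ^+ 2)).
case.
- exact: mB.
- exact: measurable_cst.
- by apply: aeW => x _; exact: cvgB.
- exact: g2i.
- apply: aeW => x k _ /=; rewrite lee_fin normrX.
  by apply: lerXn2r; rewrite ?nnegrE//; exact: le_trans (B2 k x).
move=> _ _; rewrite integral0 => h.
have {}h : (fun k => (nrm2 (w k \- f) ^+ 2)%:E) @ \oo --> (0%R)%:E.
  apply: cvg_trans h; apply: near_eq_cvg; near=> k.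
  by rewrite -dotp_nrm2_fin//; exact: Lfun2B.
have {}h : (fun k => (nrm2 (w k \- f) ^+ 2)) @ \oo --> 0.
  by move/fine_cvgP : h => [_].
rewrite -[X in _ --> X]sqrtr0.
under eq_fun => k.
  rewrite -(ger0_norm (nrm2_ge0 mu (w k \- f))) -sqrtr_sqr; over.
exact: (cvg_comp _ _ h (@sqrt_continuous R 0)).
Unshelve. all: by end_near. Qed.

Lemma nrm2_eq_ae (f g : T -> R) : f \in SL2 -> g \in SL2 -> f = g %[ae mu] ->
  nrm2 (f \- g) = 0.
Proof.
move=> fL gL fg; rewrite /L2nrm.
rewrite dotpBl ?dotpBr//; try exact: Lfun2B.
rewrite (eq_ae_dotp fL gL fL fg) (eq_ae_dotp fL gL gL fg).
by rewrite !subrr sqrtr0.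
Qed.

(** Riesz-Fischer. Along a subsequence with increments at most [2^-j], the sums [S k] of absolute
    increments are bounded in L^2, so by monotone convergence their limit is square integrable; it
    dominates the subsequence, which converges almost everywhere. The Cauchy property then carries
    the whole sequence along. *)
Lemma L2_complete (u : nat -> T -> R) : (forall k, u k \in SL2) ->
  (forall e, 0 < e -> exists N, forall k m, (N <= k)%N -> (N <= m)%N ->
     nrm2 (u k \- u m) <= e) ->
  exists2 f, f \in SL2 & nrm2 (u k \- f) @[k --> \oo] --> 0.
Proof.
move=> uL uC.
have /choice[N_ N_P] : forall j : nat, exists N, forall k m, (N <= k)%N ->
    (N <= m)%N -> nrm2 (u k \- u m) <= 2^-1 ^+ j.
  by move=> j; apply: uC; rewrite exprn_gt0.
(* The maximum puts [M j] beyond every [N_ i] with [i <= j]; the summand [j] makes [M j] at least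
   [j], so that the subsequence eventually passes any given rank. *)
pose M j := (j + \max_(i < j.+1) N_ i)%N.
have NM i j : (i <= j)%N -> (N_ i <= M j)%N.
  move=> ij; rewrite /M (bigD1 (Ordinal (ij : i < j.+1)%N))//=.
  exact: leq_trans (leq_maxl _ _) (leq_addl _ _).
pose v j := u (M j).
have vL j : v j \in SL2 by exact: uL.
have vB j : nrm2 (v j.+1 \- v j) <= 2^-1 ^+ j.
  by apply: N_P; apply: NM.
pose D j x := `|v j.+1 x - v j x|.
have DL j : D j \in SL2 by apply: Lfun2_norm; exact: Lfun2B.
pose S k x := `|v 0%N x| + \sum_(j < k) D j x.
have SL k : S k \in SL2.
  by apply: Lfun2D; [exact: Lfun2_norm|exact: Lfun2_sum].
pose C := nrm2 (v 0%N) + 2.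
have nrm_abs (f : T -> R) : nrm2 (fun x => `|f x|) = nrm2 f.
  rewrite /L2nrm; congr Num.sqrt; apply: eq_Rintegral => x _.
  by rewrite -!expr2 real_normK ?num_real.
have SC k : nrm2 (S k) <= C.
  have -> : S k = (fun x => `|v 0%N x|) \+ (fun x => \sum_(j < k) D j x) by [].
  have DL' (j : 'I_k) : D j \in SL2 by [].
  apply: (le_trans (nrm2D (Lfun2_norm (vL 0%N)) (Lfun2_sum _ DL'))).
  rewrite nrm_abs lerD2l; apply: (le_trans (nrm2_sum _ DL')).
  apply: (@le_trans _ _ (\sum_(j < k) 2^-1 ^+ j)).
    by apply: ler_sum => j _; rewrite nrm_abs; exact: vB.
  have := @subrX1 R 2^-1 k; rewrite -(big_mkord xpredT (fun i => 2^-1 ^+ i)).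
  rewrite big_mkord => h.
  have : 0 <= 2^-1 ^+ k :> R by exact: exprn_ge0.
  have h2 : \sum_(i < k) 2^-1 ^+ i = 2 * (1 - 2^-1 ^+ k) :> R.
    by move: h; set s := \sum_(i < k) _; set q := 2^-1 ^+ k; lra.
  rewrite h2; lra.
have S_ge0 k x : 0 <= S k x by rewrite addr_ge0// sumr_ge0// => i _; exact: normr_ge0.
have S_nd x k m : (k <= m)%N -> S k x <= S m x.
  move=> /subnK <-; elim: (m - k)%N => // i IH; apply: (le_trans IH).
  by rewrite addSn /S big_ord_recr /= addrA lerDl normr_ge0.
have vS k x : `|v k x| <= S k x.
  elim: k => [|k IH]; first by rewrite /S big_ord0 addr0.
  rewrite /S big_ord_recr /= addrA -/(S k x).
  rewrite -[v k.+1 x](subrK (v k x)) addrC.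
  by apply: (le_trans (ler_normD _ _)); rewrite lerD.
pose F x := limn (fun k => (S k x ^+ 2)%:E).
have mS2 k : measurable_fun setT (fun x => (S k x ^+ 2)%:E).
  by apply/measurable_EFinP; apply: measurable_funX; exact: Lfun2_measurable (SL k).
have nd2 x k m : (k <= m)%N -> ((S k x ^+ 2)%:E <= (S m x ^+ 2)%:E)%E.
  by move=> km; rewrite lee_fin ler_sqr ?nnegrE//; exact: S_nd.
have cF x : (fun k => (S k x ^+ 2)%:E) @ \oo --> F x.
  by apply: ereal_nondecreasing_is_cvgn => k m; exact: nd2.
have mF : measurable_fun setT F.
  by apply: (emeasurable_fun_cvg _ _ mS2) => x _; exact: cF.
have leF x k : ((S k x ^+ 2)%:E <= F x)%E.
  apply: lime_ge; first by apply: ereal_nondecreasing_is_cvgn => k' m; exact: nd2.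
  by near=> m; apply: nd2; near: m; exact: nbhs_infty_ge.
have F0 x : (0 <= F x)%E by apply: le_trans (leF x 0%N); rewrite lee_fin sqr_ge0.
have intF : (\int[mu]_x F x <= (C ^+ 2)%:E)%E.
  rewrite (@monotone_convergence _ _ _ mu _ measurableT
    (fun k x => (S k x ^+ 2)%:E) mS2); last 2 first.
  - by move=> k x _; rewrite lee_fin sqr_ge0.
  - by move=> x _ k m; exact: nd2.
  apply: lime_le.
    apply: ereal_nondecreasing_is_cvgn => k m km.
    apply: ge0_le_integral => //; first by move=> x _; rewrite lee_fin sqr_ge0.
    by move=> x _; exact: nd2.
  near=> k; rewrite dotp_nrm2_fin// lee_fin ler_sqr ?nnegrE ?nrm2_ge0//.
  by rewrite addr_ge0// nrm2_ge0.
have iF : mu.-integrable setT F.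
  apply/integrableP; split => //.
  under eq_integral do rewrite gee0_abs//.
  by apply: le_lt_trans intF _; exact: ltry.
(* [F] may be infinite on a null set. Cutting to [A] gives domination and convergence at every
   point, as [dominated_nrm2_cvg] asks. *)
pose A := [set x | F x \is a fin_num].
have mA : measurable A.
  by rewrite -[A]setTI; exact: emeasurable_fin_num.
have aeA : {ae mu, forall x, A x}.
  by have := integrable_ae measurableT iF; apply: filterS => x /(_ Logic.I).
pose G x := Num.sqrt (fine (F x)) * \1_A x.
have SG k x : A x -> S k x <= G x.
  move=> Ax; rewrite /G indicE mem_set// mulr1 -(ger0_norm (S_ge0 k x)) -sqrtr_sqr.
  by rewrite ler_wsqrtr// -lee_fin fineK//; exact: leF.
have G_ge0 x : 0 <= G x by rewrite mulr_ge0 ?sqrtr_ge0// indicE.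
have mG : measurable_fun setT G.
  apply: measurable_funM; last exact: measurable_indic.
  apply: (@measurableT_comp _ _ _ _ _ _ (@Num.sqrt R)).
    by apply: continuous_measurable_fun; exact: sqrt_continuous.
  by apply: measurableT_comp => //; exact: fine_measurable.
have GL : G \in SL2.
  apply/Lfun2P; split => //; apply: le_integrable iF => //.
    by apply/measurable_EFinP; exact: measurable_funX.
  move=> x _ /=; rewrite exprMn sqr_sqrtr ?fine_ge0// indicE.
  have [Ax|nAx] := boolP (x \in A).
    rewrite expr1n mulr1 (ger0_norm (fine_ge0 (F0 x))) fineK ?gee0_abs//.
    by move: Ax; rewrite inE.
  by rewrite expr0n mulr0 normr0 abse_ge0.
pose w k x := v k x * \1_A x.
have mw k : measurable_fun setT (w k).
  by apply: measurable_funM; [exact: Lfun2_measurable (vL k)|exact: measurable_indic].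
have wG k x : `|w k x| <= G x.
  rewrite /w indicE; have [|nAx] := boolP (x \in A).
    by rewrite inE => Ax; rewrite mulr1 (le_trans (vS k x))// SG.
  by rewrite mulr0 normr0.
have cw x : cvgn (w ^~ x).
  rewrite /w indicE; have [|nAx] := boolP (x \in A); last first.
    by under eq_fun do rewrite mulr0; exact: is_cvg_cst.
  rewrite inE => Ax; under eq_fun do rewrite mulr1.
  have -> : v ^~ x = (fun k => v 0%N x + series (fun j => v j.+1 x - v j x) k).
    apply/funext => k; rewrite /series /= telescope_sumr//; lra.
  apply: is_cvgD; first exact: is_cvg_cst.
  apply: normed_cvg; apply: nondecreasing_is_cvgn.
    move=> k m km; have := S_nd x _ _ km; rewrite /normed_series_of !seriesEord/=.
    by rewrite /S lerD2l.
  exists (G x) => _ [k _ <-]; apply: le_trans (SG k x Ax).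
  by rewrite /normed_series_of seriesEord /= /S lerDr.
have [fL wf] := dominated_nrm2_cvg mw GL wG cw.
set f := (fun x => _) in fL wf; exists f => //.
have wL k : w k \in SL2.
  apply: (le_Lfun2 (mw k) GL) => x; apply: (le_trans (wG k x)); exact: ler_norm.
have vw k : nrm2 (v k \- w k) = 0.
  apply: nrm2_eq_ae => //; apply: filterS aeA => x Ax.
  by rewrite /= /w indicE mem_set// mulr1.
apply/cvgrPdist_le => /= e e0.
have e2 : 0 < e / 2 by rewrite divr_gt0.
have [N NP] := uC _ e2.
have [j Nj wj] : exists2 j, (N <= j)%N & nrm2 (w j \- f) <= e / 2.
  have /cvgrPdist_le/(_ _ e2)[K _ KP] := wf; exists (maxn N K); first exact: leq_maxl.
  have := KP _ (leq_maxr N K); rewrite sub0r normrN ger0_norm ?nrm2_ge0//.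
near=> k.
rewrite sub0r normrN ger0_norm ?nrm2_ge0//.
have h1 : nrm2 (u k \- v j) <= e / 2.
  apply: NP; first by near: k; exact: nbhs_infty_ge.
  exact: leq_trans Nj (leq_addr _ _).
have h2 := nrm2_triangle (vL j) fL (wL j).
have h3 := nrm2_triangle (uL k) fL (vL j).
move: (vw j) => h4; move: h1 h2 h3 wj; rewrite h4; lra.
Unshelve. all: by end_near. Qed.

Lemma dotp_cvgr (I : Type) (F : set_system I) {FF : Filter F}
    (w : I -> T -> R) (f h : T -> R) :
  (\forall k \near F, w k \in SL2) -> f \in SL2 -> h \in SL2 ->
  nrm2 (w k \- f) @[k --> F] --> 0 -> dotp h (w k) @[k --> F] --> dotp h f.
Proof.
move=> wL fL hL wf; apply/cvgrPdist_le => e e0.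
have h0 : 0 < nrm2 h + 1 by rewrite ltr_wpDl// nrm2_ge0.
have eh : 0 < e / (nrm2 h + 1) by rewrite divr_gt0.
have {}wf := (cvgrPdist_le _ _).1 wf _ eh; near=> k.
have wkL : w k \in SL2 by near: k.
have : `|0 - nrm2 (w k \- f)| <= e / (nrm2 h + 1) by near: k; exact: wf.
rewrite sub0r normrN ger0_norm ?nrm2_ge0// => wk.
rewrite -dotpBr//; apply: (le_trans (CauchySchwarz_dotp hL (Lfun2B fL wkL))).
rewrite nrm2_distC; move: wk; rewrite ler_pdivlMr// => wk.
apply: le_trans wk; rewrite mulrC ler_wpM2l ?nrm2_ge0// lerDl//.
Unshelve. all: by end_near. Qed.

End L2_convergence.

(** * Borel sets and translations in R^n *)

Section rV_borel.
Context {R : realType} {n : nat}.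
Local Notation E := 'rV[R]_n.

Lemma rV_nbhs_box (x : E) (U : set E) : nbhs x U ->
  exists2 e : R, 0 < e & forall y : E, (forall i, `|y 0 i - x 0 i| < e) -> U y.
Proof.
move=> /nbhs_ballP[e /= e0 xU]; exists e => // y yx; apply: xU; split => // i j.
by rewrite ord1 /ball /= distrC.
Qed.

(** A countable base of the topology: cubes with rational centre and half-side [1 / (k + 1)]. *)
Definition rat_box (p : 'rV[rat]_n * nat) : set E :=
  [set y | forall i, `|y 0 i - ratr (p.1 0 i)| < p.2.+1%:R^-1].

Lemma measurable_rat_box p : measurable (rat_box p).
Proof.
apply: (@measurable_rV_box R n
  (fun i => [set r | `|r - ratr (p.1 0 i)| < p.2.+1%:R^-1])) => i.
rewrite (_ : [set r | _] = `](ratr (p.1 0 i) - p.2.+1%:R^-1),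
    (ratr (p.1 0 i) + p.2.+1%:R^-1)[%classic).
  exact: measurable_itv.
by apply/seteqP; split => r /=; rewrite in_itv /= ltr_distl.
Qed.

Lemma open_rat_box (U : set E) x : open U -> U x ->
  exists2 p, rat_box p `<=` U & rat_box p x.
Proof.
rewrite openE => /[apply] /rV_nbhs_box[e e0 eU].
have [k ke] : exists k, k.+1%:R^-1 < e / 2.
  have e2 : 0 < e / 2 by rewrite divr_gt0.
  have := near_infty_natSinv_lt (PosNum e2) => -[k _ /(_ k (leqnn _))/= h].
  by exists k.
have k0 : 0 < k.+1%:R^-1 :> R by rewrite invr_gt0.
have /choice[q qx] : forall i : 'I_n, exists q : rat,
    `|x 0 i - ratr q| < k.+1%:R^-1.
  move=> i; have /rat_in_itvoo[q] : x 0 i - k.+1%:R^-1 < x 0 i + k.+1%:R^-1.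
    by move: k0; set c := k.+1%:R^-1; lra.
  rewrite in_itv /= -ltr_distl => h; exists q; by rewrite distrC.
exists ((\row_i q i), k) => [y yq|i] /=; last by rewrite mxE.
apply: eU => i; have := yq i; rewrite /= mxE => h.
rewrite (_ : y 0 i - x 0 i = (y 0 i - ratr (q i)) - (x 0 i - ratr (q i))); last by ring.
apply: (le_lt_trans (ler_normB _ _)); have := qx i; move: h ke.
set c := k.+1%:R^-1; lra.
Qed.

Lemma open_rV_bigcup (U : set E) : open U ->
  U = \bigcup_(p : 'rV[rat]_n * nat)
        (if `[< rat_box p `<=` U >] then rat_box p else set0).
Proof.
move=> oU; apply/seteqP; split => [x Ux|x [p _]]; last by case: asboolP => // + px; apply.
by have [p pU px] := open_rat_box oU Ux; exists p => //; rewrite asboolT.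
Qed.

Lemma open_rV_measurable (U : set E) : open U -> measurable U.
Proof.
move=> /open_rV_bigcup ->; apply: countable_bigcupT_measurable.
  exact: countableP.
by move=> p; case: asboolP => // _; exact: measurable_rat_box.
Qed.

Lemma continuous_coord (i : 'I_n) : continuous (fun x : E => x 0 i).
Proof. by move=> x; exact: coord_continuous. Qed.

(** The sigma-algebra is defined through coordinates. Open sets are countable unions of rational
    boxes, and coordinates are continuous, which gives the two inclusions. Open sets being stable
    under intersection, this makes Dynkin's theorem available in [good_measurable]. *)
Lemma rV_measurable_open : (@measurable _ E) = <<s [set U : set E | open U] >>.
Proof.
apply/seteqP; split; last first.
  apply: smallest_sub; first exact: sigma_algebra_measurable.
  by move=> U; exact: open_rV_measurable.
pose T' := g_sigma_algebraType [set U : set E | open U].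
have mid : measurable_fun setT (fun x : T' => x : E).
  apply: measurable_fun_rV => i.
  move=> mD; apply: (measurability _ (RGenOpens.measurableE R)) => // _ [_ [a [b ->]] <-].
  rewrite setTI; apply: sub_sigma_algebra => /=.
  apply: open_comp; last exact: interval_open.
  by move=> x _; exact: continuous_coord.
move=> A mA; have := mid measurableT A mA.
by rewrite setTI preimage_id.
Qed.

Lemma continuous_rV_measurable (f : E -> R) : continuous f -> measurable_fun setT f.
Proof.
move=> cf mD; apply: (measurability _ (RGenOpens.measurableE R)) => // _ [_ [a [b ->]] <-].
rewrite setTI; apply: open_rV_measurable; apply: open_comp; last exact: interval_open.
by move=> x _; exact: cf.
Qed.

(* The rational boxes give a countable basis, hence a countable subcover of the
   complement. *)
Lemma ess_supp_negligible (f : E -> R) :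
  (@lebesgue_rV R n).-negligible (~` ess_supp f `&` [set y | f y != 0]).
Proof.
set mu := @lebesgue_rV R n.
pose N p := if `[< mu.-negligible (rat_box p `&` [set y | f y != 0]) >]
  then rat_box p `&` [set y | f y != 0] else set0.
have [fN hN] : exists g : nat -> set E, (forall k, mu.-negligible (g k)) /\
    \bigcup_p N p `<=` \bigcup_k g k.
  exists (fun k => if unpickle k is Some p then N p else set0); split.
    move=> k; case: unpickle => [p|]; last exact: negligible_set0.
    by rewrite /N; case: asboolP => // _; exact: negligible_set0.
  by move=> x [p _ Npx]; exists (pickle p) => //; rewrite pickleK.
apply: (@negligibleS _ _ _ mu (\bigcup_k fN k)); last first.
  by apply: negligible_bigcup; case: hN.
apply: subset_trans hN.2 => x [/= xs fx].
move: xs; rewrite /ess_supp /= => /existsNP[U /not_implyP[[oU Ux] /contrapT UN]].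
have [p pU px] := open_rat_box oU Ux.
exists p => //; rewrite /N asboolT//.
by apply: negligibleS UN => y [py fy]; split => //; exact: pU.
Qed.

End rV_borel.

(** * Translation invariance of Lebesgue measure on R^n *)

Section rV_translation.
Context {R : realType}.

Lemma lebesgue_measure_translate (a : R) (A : set R) : measurable A ->
  pushforward lebesgue_measure (fun x : R => x + a : measurableTypeR R) A
  = lebesgue_measure A.
Proof.
move=> mA; apply/esym/lebesgue_measure_unique => //=; first exact: measurable_funD.
move=> _ _ [[x y]] _ <-.
rewrite /pushforward /=.
rewrite (_ : _ @^-1` _ = `]x - a, y - a]%classic); last first.
  by apply/seteqP; split => z /=; rewrite !in_itv /= ltrBlDr lerBrDr.
rewrite !lebesgue_measure_itv/= !lte_fin ltrD2r.
by case: ifPn => // _; rewrite -!EFinD; congr EFin; ring.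
Qed.

Lemma ge0_integral_translate (a : R) (f : R -> \bar R) :
  measurable_fun setT f -> (forall x, 0 <= f x)%E ->
  (\int[lebesgue_measure]_x f (x + a)%R = \int[lebesgue_measure]_x f x)%E.
Proof.
move=> mf f0.
transitivity (\int[pushforward (@lebesgue_measure R)
    (fun x : R => (x + a)%R : measurableTypeR R)]_x f x)%E.
  rewrite ge0_integral_pushforward//; exact: measurable_funD.
apply: eq_measure_integral; first exact: measurable_funD.
by move=> ? A mA _; exact: lebesgue_measure_translate.
Qed.

Lemma measurable_rV_translate n (a : 'rV[R]_n) :
  measurable_fun setT (fun x : 'rV[R]_n => x + a).
Proof.
apply: measurable_fun_rV => i; under eq_fun do rewrite mxE.
by apply: measurable_funD => //; exact: measurable_coord.
Qed.

(** Induction on the dimension: the induction hypothesis translates each section, and the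
    one-dimensional invariance translates the variable that indexes the sections. *)
Lemma lebesgue_rV_translate n (a : 'rV[R]_n) (A : set 'rV[R]_n) :
  measurable A -> lebesgue_rV n ((fun x => x + a) @^-1` A) = lebesgue_rV n A.
Proof.
elim: n a A => [|n IH] a A mA.
  by congr (_ _); apply/seteqP; split => x /=; rewrite (_ : x + a = x)//;
    apply/rowP => -[].
rewrite /= /lebesgue_rV_cons /pushforward.
set B := @rV_cons R n @^-1` A.
have mB : measurable B.
  by rewrite -[X in measurable X]setTI; exact: measurable_rV_cons.
pose a' : 'rV[R]_n := \row_j a 0 (lift ord0 j).
rewrite (_ : _ @^-1` _ = (fun p => (p.1 + a 0 ord0, p.2 + a')) @^-1` B); last first.
  apply/seteqP; split => -[x v] /=; rewrite /B /=; congr A;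
    apply/rowP => i; rewrite !mxE; case: unliftP => [j ->|->]; rewrite ?mxE//.
rewrite /product_measure1.
transitivity (\int[lebesgue_measure]_x
    lebesgue_rV n (xsection B (x + a 0 ord0)%R))%E.
  apply: eq_integral => x _.
  rewrite -[RHS](IH a'); last exact: measurable_xsection.
  by congr (_ _); apply/seteqP; split => v; rewrite /xsection /= !inE.
apply: (@ge0_integral_translate (a 0 ord0) (fun x => lebesgue_rV n (xsection B x))).
  exact: measurable_fun_xsection.
by [].
Qed.

Lemma ge0_integral_rV_translate n (a : 'rV[R]_n) (f : 'rV[R]_n -> \bar R) :
  measurable_fun setT f -> (forall x, 0 <= f x)%E ->
  (\int[lebesgue_rV n]_x f (x + a)%R = \int[lebesgue_rV n]_x f x)%E.
Proof.
move=> mf f0.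
transitivity (\int[pushforward (lebesgue_rV n)
    (fun x : 'rV[R]_n => (x + a)%R)]_x f x)%E.
  rewrite ge0_integral_pushforward//; exact: measurable_rV_translate.
apply: eq_measure_integral; first exact: measurable_rV_translate.
by move=> ? A mA _; exact: lebesgue_rV_translate.
Qed.

End rV_translation.

(** * Smooth functions *)

Section Ck_closure.
Context {R : realType} {W : normedModType R}.
Implicit Types (f g : W -> R) (k : nat).

Lemma Ck_continuous k f : Ck k f -> continuous f.
Proof. by case: k => [|k] []. Qed.

Lemma Ck_derivable k f v x : Ck k.+1 f -> derivable f x v.
Proof. by move=> [_ /(_ v)[]]. Qed.

Lemma Ck_derive k f v : Ck k.+1 f -> Ck k (fun x => 'D_v f x).
Proof. by move=> [_ /(_ v)[]]. Qed.

Lemma CkS k f : Ck k.+1 f -> Ck k f.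
Proof.
elim: k f => [|k IH] f; first by move=> [].
move=> [cf df]; split=> // v; have [dfv Cf] := df v; split=> //; exact: IH.
Qed.

Lemma Ck_cst k (a : R) : Ck k (fun _ : W => a).
Proof.
elim: k a => [|k IH] a; first by split=> //; exact: cst_continuous.
split=> [|v]; first exact: cst_continuous.
split; first by move=> x; exact: derivable_cst.
have -> : (fun x => 'D_v (fun=> a) x) = (fun=> 0 : R).
  by apply/funext => x; rewrite derive_cst.
exact: IH.
Qed.

Lemma CkD k f g : Ck k f -> Ck k g -> Ck k (fun x => f x + g x).
Proof.
elim: k f g => [|k IH] f g.
  by move=> [cf _] [cg _]; split=> // x; apply: cvgD; [exact: cf|exact: cg].
move=> Cf Cg; split.
  by move=> x; apply: cvgD; [exact: (Ck_continuous Cf)|exact: (Ck_continuous Cg)].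
move=> v; split.
  by move=> x; apply: derivableD; [exact: Ck_derivable Cf|exact: Ck_derivable Cg].
have -> : (fun x => 'D_v (fun y => f y + g y) x) = (fun x => 'D_v f x + 'D_v g x).
  apply/funext => x; rewrite -[LHS]/('D_v (f + g) x) deriveD//.
    exact: Ck_derivable Cf.
  exact: Ck_derivable Cg.
by apply: IH; exact: Ck_derive.
Qed.

Lemma CkM k f g : Ck k f -> Ck k g -> Ck k (fun x => f x * g x).
Proof.
elim: k f g => [|k IH] f g.
  by move=> [cf _] [cg _]; split=> // x; apply: cvgM; [exact: cf|exact: cg].
move=> Cf Cg; split.
  by move=> x; apply: cvgM; [exact: (Ck_continuous Cf)|exact: (Ck_continuous Cg)].
move=> v; split.
  by move=> x; apply: derivableM; [exact: Ck_derivable Cf|exact: Ck_derivable Cg].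
have -> : (fun x => 'D_v (fun y => f y * g y) x) =
    (fun x => f x * 'D_v g x + g x * 'D_v f x).
  apply/funext => x; rewrite -[LHS]/('D_v (f * g) x) deriveM//.
    exact: Ck_derivable Cf.
  exact: Ck_derivable Cg.
by apply: CkD; apply: IH; [exact: CkS|exact: Ck_derive|exact: CkS|exact: Ck_derive].
Qed.

Lemma Ck_prod k (I : Type) (s : seq I) (F : I -> W -> R) :
  (forall i, Ck k (F i)) -> Ck k (fun x => \prod_(i <- s) F i x).
Proof.
move=> CF; elim: s => [|i s IH].
  by under eq_fun do rewrite big_nil; exact: Ck_cst.
by under eq_fun do rewrite big_cons; exact: CkM.
Qed.

End Ck_closure.

Section Ck_comp.
Context {R : realType} {W W' : normedModType R}.
Variables (l : W -> W') (l' : W -> W').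
Hypothesis lc : continuous l.
Hypothesis ll : forall (h : R) v x, l (h *: v + x) = h *: l' v + l x.

(** Composing with an affine map of linear part [l'] only replaces the direction [v] by [l' v] in
    the difference quotient. No chain rule is involved, so directional derivatives suffice, and
    these are all that [Ck] provides. *)
Let quotE (f : W' -> R) v x :
  (fun h : R => h^-1 *: (((f \o l) \o shift x) (h *: v) - (f \o l) x)) =
  (fun h : R => h^-1 *: ((f \o shift (l x)) (h *: l' v) - f (l x))).
Proof. by apply/funext => h /=; rewrite ll. Qed.

Lemma derivable_comp_affine (f : W' -> R) v x :
  derivable f (l x) (l' v) -> derivable (f \o l) x v.
Proof. by rewrite /derivable quotE. Qed.

Lemma derive_comp_affine (f : W' -> R) v x :
  'D_v (f \o l) x = 'D_(l' v) f (l x).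
Proof. by rewrite /derive quotE. Qed.

Lemma Ck_comp_affine k (f : W' -> R) : Ck k f -> Ck k (f \o l).
Proof.
elim: k f => [|k IH] f Cf.
  by split=> // x; apply: continuous_comp; [exact: lc|exact: (Ck_continuous Cf)].
split; first by move=> x; apply: continuous_comp; [exact: lc|exact: (Ck_continuous Cf)].
move=> v; split.
  by move=> x; apply: derivable_comp_affine; exact: Ck_derivable Cf.
have -> : (fun x => 'D_v (f \o l) x) = (fun y => 'D_(l' v) f y) \o l.
  by apply/funext => x; rewrite derive_comp_affine.
by apply: IH; exact: Ck_derive.
Qed.
End Ck_comp.

(** * A smooth bump and a smooth step on the line *)

Section smooth_bump.
Context {R : realType}.
Implicit Types (x : R) (m k : nat).

(** [x^(-m) exp(-1/x)] extended by zero. The exponent [m] makes the span of the family stable under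
    differentiation. *)
Definition flat m x : R := if 0 < x then x^-1 ^+ m * expR (- x^-1) else 0.

(** From [exp y >= y^(m+1) / (m+1)!] at [y = 1/x]. The linear bound makes every [flat m] tend to
    zero at the origin. *)
Lemma flat_le m x : `|flat m x| <= m.+1`!%:R * `|x|.
Proof.
rewrite /flat; case: ifPn => x0; last by rewrite normr0 mulr_ge0.
have y0 : 0 < x^-1 by rewrite invr_gt0.
rewrite ger0_norm; last by rewrite mulr_ge0 ?exprn_ge0 ?expR_ge0// (ltW y0).
rewrite expRN ler_pdivrMr ?expR_gt0// gtr0_norm//.
have := @expR_ge1Dxn R x^-1 m (ltW y0) => h.
have {}h : x^-1 ^+ m.+1 / m.+1`!%:R <= expR x^-1 by apply: le_trans h; rewrite lerDr.
rewrite ler_pdivrMr ?ltr0n ?fact_gt0// in h.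
rewrite -(ler_pM2l y0) -exprS (le_trans h)//.
by rewrite (_ : _ * (_ * _ * _) = (x^-1 * x) * (expR x^-1 * m.+1`!%:R)); [rewrite mulVf ?mul1r ?gt_eqF|ring].
Qed.

Lemma flatS m x : x^-1 * flat m x = flat m.+1 x.
Proof. by rewrite /flat; case: ifPn => x0; rewrite ?mulr0// exprS mulrA. Qed.

Lemma is_derive_flat m x :
  is_derive x 1 (flat m) (- m%:R * flat m.+1 x + flat m.+2 x).
Proof.
have [x0|x0|->] := ltgtP x 0.
- rewrite {2 3}/flat ltNge (ltW x0)/= mulr0 addr0.
  apply: (@near_eq_is_derive _ _ _ (cst 0)).
  near=> y; rewrite /flat ifF//; apply/negbTE; rewrite -leNgt ltW//.
  by near: y; exact: lt_nbhsl.
- have xn0 : x != 0 by rewrite gt_eqF.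
  have d1 : is_derive x 1 (fun y : R => y^-1) (- x ^- 2 *: 1).
    exact: (@is_deriveV R id x 1 1 xn0 (is_derive_id x 1)).
  have d2 : is_derive x^-1 1 (fun y : R => y ^+ m * expR (- y))
      (x^-1 ^+ m * - expR (- x^-1) + expR (- x^-1) * (m%:R * x^-1 ^+ m.-1)).
    have e1 : is_derive x^-1 1 (fun y : R => expR (- y)) (expR (- x^-1) * (- 1)).
      exact: (@is_derive1_comp R expR -%R).
    have e2 := @is_deriveX _ _ id m x^-1 1 1 (is_derive_id _ _).
    have fE : (id ^+ m : R -> R) = fun y => y ^+ m.
      by elim: m {e2} => [|m IH]; apply/funext => y; rewrite ?expr0// exprS IH exprS.
    have := @is_deriveM _ _ _ _ _ _ _ _ e2 e1; rewrite fE.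
    rewrite -[_ * (fun y : R => expR (- y))]/(fun y : R => y ^+ m * expR (- y)).
    by move=> h; apply: (is_derive_eq h); rewrite mulrN1 /GRing.scale /= mulr1.
  have d3 := @is_derive1_comp R _ _ x _ _ d2 d1.
  have d4 : is_derive x 1 (flat m) ((x^-1 ^+ m * - expR (- x^-1) +
      expR (- x^-1) * (m%:R * x^-1 ^+ m.-1)) * (- x ^- 2 *: 1)).
    apply: (near_eq_is_derive _ d3); near=> y; rewrite /flat ifT//.
    by near: y; exact: lt_nbhsr.
  apply: (is_derive_eq d4); rewrite /flat x0 /GRing.scale /= mulr1.
  rewrite -exprVn; move: (x^-1) (expR _) => y e.
  case: m {d2 d3 d4} => [|m] /=; first by rewrite !mulr0n; ring.
  by rewrite !exprS; move: (m.+1%:R : R) => c; ring.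
(* At the origin the difference quotient of [flat m] is [flat m.+1] itself, which tends to zero by
   [flat_le]. *)
- rewrite /flat ltxx mulr0 addr0.
  have h0 : (fun h => h^-1 *: ((flat m \o shift 0) (h *: 1) - flat m 0)) @ 0^' --> 0.
    rewrite (_ : (fun h => _) = flat m.+1); last first.
      apply/funext => h /=; rewrite addr0 scaler1 {2}/flat ltxx subr0.
      by rewrite -flatS.
    apply: (@cvg_to_0_linear R _ m.+2`!%:R 1) => // r _; exact: flat_le.
  by split; [apply: cvgP h0|exact: cvg_lim h0].
Unshelve. all: by end_near. Qed.

End smooth_bump.

Section bumpf.
Context {R : realType}.
Implicit Types (x : R) (m k : nat).

Lemma derive_scale1 (f : R -> R) x (v df : R) : is_derive x 1 f df ->
  derivable f x v /\ 'D_v f x = v * df.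
Proof.
move=> [/derivable1_diffP fx fE]; split; first exact: diff_derivable.
have := deriveE v fx; have := deriveE (1 : R) fx; rewrite fE => -> ->.
have -> : v = v *: (1 : R) by rewrite /GRing.scale /= mulr1.
by rewrite linearZ /GRing.scale /= mulr1.
Qed.

(** A class of functions closed under differentiation consists of smooth functions. The factor [v]
    appears because [Ck] asks for the derivative in every direction [v] of the line. *)
Lemma Ck_ind1 (P : (R -> R) -> Prop) :
  (forall f, P f -> exists2 df, (forall x, is_derive x 1 f (df x)) &
     forall v : R, P (fun x => v * df x)) ->
  forall k f, P f -> Ck k f.
Proof.
move=> HP; elim=> [|k IH] f Pf.
  have [df fdf _] := HP _ Pf; split=> // x.
  by apply: differentiable_continuous; apply/derivable1_diffP; case: (fdf x).
have [df fdf Pdf] := HP _ Pf; split.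
  by move=> x; apply: differentiable_continuous; apply/derivable1_diffP; case: (fdf x).
move=> v; split; first by move=> x; have [] := derive_scale1 v (fdf x).
have -> : (fun x => 'D_v f x) = fun x => v * df x.
  by apply/funext => x; have [] := derive_scale1 v (fdf x).
exact: IH.
Qed.

(** The stable class is that of finite combinations of the [flat j], encoded as lists of pairs
    (coefficient, exponent). *)
Lemma Ck_flat k m : Ck k (@flat R m).
Proof.
apply: (Ck_ind1 (P := fun f => exists s : seq (R * nat),
    f = fun x => \sum_(p <- s) p.1 * flat p.2 x)); last first.
  by exists [:: (1, m)]; apply/funext => x; rewrite big_seq1 mul1r.
move=> _ [s ->].
pose ds := flatten [seq [:: (- p.1 * p.2%:R, p.2.+1); (p.1, p.2.+2)] | p <- s].
have dsE x : \sum_(p <- ds) p.1 * flat p.2 x =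
    \sum_(p <- s) p.1 * (- p.2%:R * flat p.2.+1 x + flat p.2.+2 x).
  rewrite big_flatten big_map; apply: eq_bigr => p _.
  by rewrite big_cons big_seq1 /=; ring.
exists (fun x => \sum_(p <- ds) p.1 * flat p.2 x).
  move=> x; rewrite dsE; elim: s {ds dsE} => [|p s IH].
    rewrite big_nil; under eq_fun do rewrite big_nil; exact: is_derive_cst.
  rewrite big_cons; under eq_fun do rewrite big_cons.
  apply: is_deriveD.
  exact: (@is_deriveZ _ _ _ (flat p.2) p.1 x 1 _ (is_derive_flat _ _)).
move=> v; exists [seq (v * p.1, p.2) | p <- ds].
apply/funext => x; rewrite big_map mulr_sumr; apply: eq_bigr => p _.
by rewrite mulrA.
Qed.

Lemma flat_ge0 x : 0 <= flat 0 x.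
Proof. by rewrite /flat; case: ifPn => // _; rewrite mulr_ge0 ?expR_ge0. Qed.

(** [exp(- 1/(1 - x) - 1/(1 + x))] on [(-1, 1)], zero elsewhere. *)
Definition bumpf x := flat 0 (1 - x) * flat 0 (1 + x).

Lemma bumpN x : bumpf (- x) = bumpf x.
Proof. by rewrite /bumpf opprK mulrC. Qed.

Lemma bump_ge0 x : 0 <= bumpf x.
Proof. by rewrite mulr_ge0 ?flat_ge0. Qed.

Lemma bump_gt0 x : `|x| < 1 -> 0 < bumpf x.
Proof.
rewrite ltr_norml => /andP[x1 x2]; rewrite mulr_gt0// /flat ifT ?mulr_gt0 ?expR_gt0//.
  by rewrite subr_gt0.
by lra.
Qed.

Lemma bump_eq0 x : 1 <= `|x| -> bumpf x = 0.
Proof.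
rewrite ler_normr => /orP[x1|x1]; rewrite /bumpf.
  by rewrite {1}/flat ifF ?mul0r//; apply/negbTE; rewrite -leNgt; lra.
by rewrite mulrC {1}/flat ifF ?mul0r//; apply/negbTE; rewrite -leNgt; lra.
Qed.

Lemma Ck_bump k : Ck k bumpf.
Proof.
apply: CkM.
  apply: (Ck_comp_affine (l := fun x : R => 1 - x) (l' := fun x => - x)
    _ _ (Ck_flat k 0)).
    by move=> x; apply: cvgB; [exact: cvg_cst|exact: cvg_id].
  by move=> h v x; rewrite /GRing.scale /=; ring.
apply: (Ck_comp_affine (l := fun x : R => 1 + x) (l' := fun x => x)
    _ _ (Ck_flat k 0)).
  by move=> x; apply: cvgD; [exact: cvg_cst|exact: cvg_id].
by move=> h v x; rewrite /GRing.scale /=; ring.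
Qed.

Lemma continuous_bump : continuous bumpf.
Proof. exact: Ck_continuous (Ck_bump 0). Qed.

Lemma continuous_integrable_itv (g : R -> R) a b :
  (forall x, a <= x -> {for x, continuous g}) ->
  lebesgue_measure.-integrable `[a, b] (EFin \o g).
Proof.
move=> cg; apply: continuous_compact_integrable; first exact: segment_compact.
apply: continuous_in_subspaceT => x /[!inE]/=; rewrite in_itv/= => /andP[ax _].
exact: cg.
Qed.

(** The primitive has its derivative only strictly to the right of the base point [a], so later uses
    take [a] to the left of the points of interest. *)
Lemma antiderivative (g : R -> R) (a : R) :
  (forall x, a <= x -> {for x, continuous g}) ->
  exists G : R -> R, forall x, a < x -> is_derive x 1 G (g x).
Proof.
move=> cg; exists (fun x => \int[lebesgue_measure]_(t in `[a, x]) g t) => x ax.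
have [] := @continuous_FTC1_closed R g a x (x + 1).
- by rewrite ltrDl.
- exact: continuous_integrable_itv.
- exact: ax.
- exact: cg (ltW ax).
by rewrite derive1E; set G := (fun x => _); exact: DeriveDef.
Qed.

Lemma derive0_eq (f : R -> R) a b : a <= b ->
  (forall x, a < x < b -> is_derive x 1 f 0) ->
  {within `[a, b], continuous f} -> f a = f b.
Proof.
rewrite le_eqVlt => /predU1P[->//|ab] f0 cf.
have [x _] := MVT (f := f) (df := cst 0) ab f0 cf.
by rewrite /= mul0r => /eqP; rewrite subr_eq0 => /eqP ->.
Qed.

Lemma smooth_step : exists P : R -> R,
  [/\ forall x, is_derive x 1 P (bumpf x), forall x, x <= -1 -> P x = 0 &
      forall x, 1 <= x -> P x = P 1].
Proof.
(* The base [-3] makes [G] differentiable from [-2] on; left of [-2] the step is set to zero by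
   hand, and the two definitions agree on [[-2, -1]], where the bump vanishes. *)
have [G G'] := @antiderivative bumpf (-3) (fun x _ => @continuous_bump x).
have cG (a b : R) : -3 < a -> {within `[a, b], continuous G}.
  move=> a3; apply: derivable_within_continuous => x; rewrite in_itv /= => /andP[ax _].
  by case: (G' x (lt_le_trans a3 ax)).
have G0 x : -2 <= x <= -1 -> G x = G (-2).
  move=> /andP[x2 x1]; apply/esym/derive0_eq => //; last by apply: cG; lra.
  move=> y /andP[y1 y2]; rewrite -(@bump_eq0 y); first by apply: G'; lra.
  by rewrite ler_normr; apply/orP; right; lra.
pose P x := if x <= -2 then 0 else G x - G (-2).
have P0 x : x <= -1 -> P x = 0.
  rewrite /P; case: ifPn => //; rewrite -ltNge => x2 x1.
  by rewrite G0 ?subrr// x1 ltW.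
have PG x : -2 <= x -> P x = G x - G (-2).
  rewrite /P => x2; case: ifPn => // x2'.
  by rewrite (_ : x = -2) ?subrr//; apply/eqP; rewrite eq_le x2 x2'.
have P' x : is_derive x 1 P (bumpf x).
  have [x1|x1] := ltP x (-1).
    rewrite bump_eq0; last by rewrite ler_normr; apply/orP; right; lra.
    apply: (@near_eq_is_derive _ _ _ (cst 0)).
    near=> y; rewrite P0//; apply/ltW; near: y; exact: lt_nbhsl.
  have d : is_derive x 1 (fun y => G y - G (-2)) (bumpf x - 0).
    by apply: is_deriveB; apply: G'; lra.
  rewrite subr0 in d; apply: near_eq_is_derive d.
  near=> y; rewrite PG//; apply/ltW; near: y; apply: lt_nbhsr; lra.
exists P; split=> // x x1; apply/esym/derive0_eq => //.
  move=> y /andP[y1 _]; rewrite -(@bump_eq0 y)//.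
  by rewrite ler_normr; apply/orP; left; lra.
apply: derivable_within_continuous => y _; by case: (P' y).
Unshelve. all: by end_near. Qed.

End bumpf.

Lemma Ck_step {R : realType} (P : R -> R) :
  (forall x : R, is_derive x 1 P (bumpf x)) -> forall k, Ck k P.
Proof.
move=> P'.
have cP : continuous P.
  by move=> x; apply: differentiable_continuous; apply/derivable1_diffP; case: (P' x).
case=> [|k]; first by split.
split=> // v; split; first by move=> x; have [] := derive_scale1 v (P' x).
have -> : (fun x => 'D_v P x) = fun x => v * bumpf x.
  by apply/funext => x; have [] := derive_scale1 v (P' x).
by apply: CkM; [exact: Ck_cst|exact: Ck_bump].
Qed.

(** * Test functions *)

Section test_functions.
Context {R : realType} {W : normedModType R}.
Implicit Types (f : W -> R) (U K : set W).

Lemma supp_sub f K : closed K -> (forall x, f x != 0 -> K x) -> supp f `<=` K.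
Proof.
move=> Kc fK; rewrite [X in _ `<=` X](proj1 (closure_id K) Kc).
by apply: closure_subset => x; exact: fK.
Qed.

Lemma test_funI U K f : (forall k, Ck k f) -> compact K -> K `<=` U ->
  (forall x, f x != 0 -> K x) -> test_fun U f.
Proof.
move=> Cf cK KU fK.
have Kcl : closed K by apply: compact_closed => //; exact: norm_hausdorff.
have fsK := supp_sub Kcl fK.
split=> //; last exact: subset_trans fsK KU.
by apply: subclosed_compact fsK => //; exact: closed_closure.
Qed.

Lemma supp_eq0 f x : ~ supp f x -> f x = 0.
Proof.
by move=> fx; apply/eqP; apply: contra_notT fx => fx; exact: subset_closure.
Qed.

Lemma test_fun_derive U f v : test_fun U f -> test_fun U (fun x => 'D_v f x).
Proof.
move=> [Cf cf fU]; apply: (@test_funI _ (supp f)) => //.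
  by move=> k; exact: Ck_derive (Cf k.+1).
move=> x; apply: contra_neqP => fx.
have <- : 'D_v (cst 0 : W -> R) x = 0 by rewrite derive_cst.
apply: near_eq_derive; have : nbhs x (~` supp f).
  by apply: open_nbhs_nbhs; split=> //; apply: closed_openC; exact: closed_closure.
by apply: filterS => y /supp_eq0 ->.
Qed.

Lemma test_fun_continuous U f : test_fun U f -> continuous f.
Proof. by case=> /(_ 0%N) /Ck_continuous. Qed.

Lemma test_fun_derivable U f x v : test_fun U f -> derivable f x v.
Proof. by case=> /(_ 1%N) /Ck_derivable. Qed.

Lemma test_fun_bounded U f : test_fun U f -> exists2 M, 0 <= M & forall x, `|f x| <= M.
Proof.
move=> tf; have cf := test_fun_continuous tf; case: tf => _ cs _.
have : bounded_set (f @` supp f).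
  apply: compact_bounded; apply: continuous_compact => //.
  exact: continuous_subspaceT.
move=> [M [_ HM]]; exists (`|M| + 1); first by rewrite addr_ge0.
move=> x; have [sx|nsx] := pselect (supp f x); last first.
  by rewrite supp_eq0// normr0 addr_ge0.
apply: HM; last by exists x.
by rewrite (le_lt_trans (ler_norm _))// ltrDl.
Qed.

End test_functions.

Section test_functions_rV.
Context {R : realType} {n : nat}.
Local Notation E := 'rV[R]_n.
Local Notation mu := (@lebesgue_rV R n).

Definition cube (r : R) : set E := [set x | forall i, -r < x 0 i < r].

Lemma measurable_cube r : measurable (cube r).
Proof.
apply: (@measurable_rV_box R n (fun=> `](-r), r[%classic)) => i.
exact: measurable_itv.
Qed.

Lemma open_cube r : open (cube r).
Proof.
rewrite openE => x cx; rewrite /interior.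
apply: (@filter_forall E _ (fun i : 'I_n => [set y : E | -r < y 0 i < r]) (nbhs x)) => i.
have oi : open ((fun y : E => y 0 i) @^-1` `](-r), r[%classic).
  by apply: open_comp; [move=> y _; exact: continuous_coord|exact: interval_open].
have /open_nbhs_nbhs : open_nbhs x ((fun y : E => y 0 i) @^-1` `](-r), r[%classic).
  by split=> //; rewrite /= in_itv; exact: cx.
by apply: filterS => y /=; rewrite in_itv.
Qed.


Lemma cube_fin r : (mu (cube r) < +oo)%E.
Proof.
rewrite (@lebesgue_rV_box R n (fun=> `](-r), r[%classic)); last first.
  by move=> i; exact: measurable_itv.
have h : (\prod_(i < n) lebesgue_measure (`](-r)%R, r[%classic : set R))%E \is a fin_num.
  apply: (big_ind (fun x : \bar R => x \is a fin_num)) => //.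
    by move=> x y; exact: fin_numM.
  by move=> i _; rewrite lebesgue_measure_itv/=; case: ifPn.
by rewrite ltey; move: h; rewrite fin_numE => /andP[].
Qed.

Lemma compact_cube (K : set E) : compact K -> exists2 r, 0 < r & K `<=` cube r.
Proof.
move=> /compact_bounded [M [_ HM]]; exists (`|M| + 2); first by rewrite ltr_wpDl.
move=> x Kx i; have /HM : M < `|M| + 1 by rewrite (le_lt_trans (ler_norm _))// ltrDl.
move=> /(_ x Kx) xM.
have xi : `|x 0 i| <= `|x|.
  rewrite [leRHS]/Num.norm /= mx_normrE.
  by apply/bigmax_geP; right; exists (0, i).
rewrite -ltr_norml (le_lt_trans xi)// (le_lt_trans xM)// ltrD2l; lra.
Qed.

Lemma bounded_Lfun2 (f : E -> R) M r : measurable_fun setT f ->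
  (forall x, `|f x| <= M) -> (forall x, f x != 0 -> cube r x) -> f \in L2.
Proof.
move=> mf fM fr; apply: (@le_Lfun2 _ _ _ mu f (fun x => M * \1_(cube r) x)) => //.
  by apply: Lfun2Z; apply: Lfun2_indic; [exact: measurable_cube|exact: cube_fin].
move=> x; have [->|fx] := eqVneq (f x) 0; first by rewrite normr0.
rewrite indicE mem_set ?mulr1; first exact: le_trans (ler_norm _).
exact: fr.
Qed.

Lemma test_fun_L2 (f : E -> R) : test_fun setT f -> f \in L2.
Proof.
move=> tf; have [M _ fM] := test_fun_bounded tf.
have [r _ Kr] : exists2 r, 0 < r & supp f `<=` cube r by case: tf => _ /compact_cube.
apply: (bounded_Lfun2 (M := M) (r := r)) => //.
  exact: continuous_rV_measurable (test_fun_continuous tf).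
by move=> x fx; apply: Kr; exact: subset_closure.
Qed.

(* Not normalized: [rho] is. *)
Definition mollifier (m : nat) (x : E) : R := \prod_(i < n) bumpf (m.+1%:R * x 0 i).

Lemma mollifierN m x : mollifier m (- x) = mollifier m x.
Proof. by apply: eq_bigr => i _; rewrite mxE mulrN bumpN. Qed.

Lemma mollifier_ge0 m x : 0 <= mollifier m x.
Proof. by apply: prodr_ge0 => i _; exact: bump_ge0. Qed.

Lemma mollifier_neq0 m x i : mollifier m x != 0 -> `|x 0 i| < m.+1%:R^-1.
Proof.
apply: contraNT; rewrite -leNgt => xi; rewrite /mollifier (bigD1 i)//= bump_eq0 ?mul0r//.
rewrite normrM ger0_norm// -ler_pdivrMl ?mulr1//.
Qed.

Lemma test_fun_mollifier m (y : E) : test_fun setT (fun x => mollifier m (x - y)).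
Proof.
apply: (@test_funI _ _ _ [set x : E | forall i, `[y 0 i - 1, y 0 i + 1]%classic (x 0 i)]) => //.
- move=> k; apply: Ck_prod => i.
  apply: (Ck_comp_affine (l := fun x : E => m.+1%:R * (x - y) 0 i)
    (l' := fun x => m.+1%:R * x 0 i) _ _ (Ck_bump k)).
    have c1 : continuous (fun x : E => (x - y) 0 i).
      move=> x; apply: (@continuous_comp _ _ _ (fun x : E => x - y) (fun x : E => x 0 i)).
        by apply: (@continuousB _ _ E); [move=> ?; exact: cvg_id|exact: cst_continuous].
      exact: continuous_coord.
    by move=> x; apply: (@continuousM R E); [exact: cst_continuous|exact: c1].
  by move=> h v x; rewrite !mxE /GRing.scale /=; ring.
- apply: (@rV_compact R n (fun i => `[y 0 i - 1, y 0 i + 1]%classic)) => i.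
  exact: segment_compact.
move=> x /mollifier_neq0 h i; have := h i; rewrite !mxE /= in_itv /= => xy.
have : m.+1%:R^-1 <= 1 :> R by rewrite invf_le1// ler1n.
by move: xy; rewrite ltr_norml; set c := _^-1 => /andP[]; lra.
Qed.

(** The wave equation is tested with such products only; [0 < a] keeps the support inside the open
    half-space of positive times. *)
Lemma test_fun_time (eta : R -> R) (psi : E -> R) (a b : R) :
  (forall k, Ck k eta) -> 0 < a -> (forall t, eta t != 0 -> a <= t <= b) ->
  test_fun setT psi ->
  test_fun [set z : R * E | 0 < z.1] (fun z => eta z.1 * psi z.2).
Proof.
move=> Ceta a0 etaab [Cpsi cpsi _].
apply: (@test_funI _ _ _ (`[a, b] `*` supp psi)).
- move=> k; apply: CkM.
    apply: (Ck_comp_affine (l := fun z : R * E => z.1) (l' := fun z => z.1) _ _ (Ceta k)) => //.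
    by move=> z; exact: cvg_fst.
  apply: (Ck_comp_affine (l := fun z : R * E => z.2) (l' := fun z => z.2) _ _ (Cpsi k)) => //.
  by move=> z; exact: cvg_snd.
- by apply: compact_setX => //; exact: segment_compact.
- by move=> [t x] [/=]; rewrite in_itv /= => /andP[at_ _] _; exact: lt_le_trans at_.
move=> [t x] /=; rewrite mulf_eq0 negb_or => /andP[et px]; split => /=.
  by rewrite in_itv /=; exact: etaab.
exact: subset_closure.
Qed.

End test_functions_rV.

(** * Mollification and weak derivatives *)

Section kernels.
Context {R : realType} {n : nat}.
Local Notation E := 'rV[R]_n.
Local Notation mu := (@lebesgue_rV R n).
Local Notation dotp := (L2dot mu).
Local Notation nrm2 := (L2nrm mu).

Lemma measurable_rV_sub : measurable_fun setT (fun p : E * E => p.1 - p.2).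
Proof.
apply: measurable_fun_rV => i; under eq_fun do rewrite !mxE.
apply: measurable_funB.
  by apply: (measurableT_comp (measurable_coord i)); exact: measurable_fst.
by apply: (measurableT_comp (measurable_coord i)); exact: measurable_snd.
Qed.

Lemma Lfun2_translate (f : E -> R) (y : E) : f \in L2 -> (fun x => f (x + y)) \in L2.
Proof.
move=> /Lfun2P[mf fi]; have mt := measurable_rV_translate y.
apply/Lfun2P; split; first exact: measurableT_comp.
move/integrableP : fi => [mf2 fi]; apply/integrableP; split.
  by apply/measurable_EFinP; apply: measurable_funX; exact: measurableT_comp.
have := @ge0_integral_rV_translate R n y (fun x => `|(f x ^+ 2)%:E|)%E.
by move=> -> //; apply: measurableT_comp.
Qed.

(** A common setting for the mollifiers and their derivatives: Fubini for the convolution needs only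
    boundedness and bounded support. *)
Definition cube_kernel (kappa : E -> R) := measurable_fun setT kappa /\
  exists M r, forall x, `|kappa x| <= M * \1_(cube r) x.

Lemma test_fun_cube_kernel (kappa : E -> R) : test_fun setT kappa -> cube_kernel kappa.
Proof.
move=> tk; have [M M0 kM] := test_fun_bounded tk.
have [r _ Kr] : exists2 r, 0 < r & supp kappa `<=` cube r.
  by case: tk => _ /compact_cube.
split; first exact: continuous_rV_measurable (test_fun_continuous tk).
exists M, r => x; have [->|kx] := eqVneq (kappa x) 0.
  by rewrite normr0 mulr_ge0.
by rewrite indicE mem_set ?mulr1//; apply: Kr; exact: subset_closure.
Qed.

Lemma cube_kernel_L2 kappa : cube_kernel kappa -> kappa \in L2.
Proof.
move=> [mk [M [r kM]]].
apply: (@le_Lfun2 _ _ _ mu kappa (fun x => M * \1_(cube r) x)) => //.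
  by apply: Lfun2Z; apply: Lfun2_indic; [exact: measurable_cube|exact: cube_fin].
by move=> x; exact: le_trans (ler_norm _).
Qed.

Lemma cube_kernel_translate_L2 kappa y : cube_kernel kappa ->
  (fun x => kappa (x - y)) \in L2.
Proof. by move=> /cube_kernel_L2 kL; exact: Lfun2_translate. Qed.

Lemma cubeN r (x : E) : cube r (- x) = cube r x.
Proof.
by apply/propext; split => cx i; have := cx i; rewrite mxE; lra.
Qed.

Lemma indic_cubeN r (x : E) : \1_(cube r) (- x) = \1_(cube r) x :> R.
Proof.
rewrite !indicE (_ : (- x \in cube r) = (x \in cube r))//.
by apply/idP/idP; rewrite !inE cubeN.
Qed.

Let indic_int (r : R) (f : E -> R) : f \in L2 ->
  (\int[mu]_x \int[mu]_y (f x ^+ 2 * \1_(cube r) (x - y)%R)%:E < +oo)%E /\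
  (\int[mu]_y \int[mu]_x (f y ^+ 2 * \1_(cube r) (x - y)%R)%:E < +oo)%E.
Proof.
move=> fL.
have mi : measurable_fun setT (fun y : E => (\1_(cube r) y : R)%:E).
  by apply/measurable_EFinP; apply: measurable_indic; exact: measurable_cube.
have cint y : (\int[mu]_x (\1_(cube r) (x - y)%R : R)%:E = mu (cube r))%E.
  have := @ge0_integral_rV_translate R n (- y) _ mi => -> //.
  by rewrite integral_indic ?setIT//; exact: measurable_cube.
have i2 y : (\int[mu]_x (f y ^+ 2 * \1_(cube r) (x - y)%R)%:E =
    (f y ^+ 2)%:E * mu (cube r))%E.
  rewrite -(cint y) -ge0_integralZl//.
  - by apply: (measurableT_comp mi); exact: measurable_rV_translate.
  - by rewrite lee_fin sqr_ge0.
have mf := Lfun2_measurable fL.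
have i3 : (\int[mu]_y ((f y ^+ 2)%:E * mu (cube r)) < +oo)%E.
  rewrite ge0_integralZr//; last 2 first.
  - by apply/measurable_EFinP; exact: measurable_funX.
  - by move=> x _; rewrite lee_fin sqr_ge0.
  rewrite dotp_nrm2_fin// lte_mul_pinfty ?lee_fin ?sqr_ge0//.
  exact: cube_fin.
split; last by under eq_integral do rewrite i2.
rewrite (eq_integral (fun y => (f y ^+ 2)%:E * mu (cube r)))%E// => y _.
rewrite -i2; apply: eq_integral => x _; congr (_ * _)%:E.
by rewrite -(indic_cubeN r (x - y)) opprB.
Qed.

(** The integrand is at most [|M| (f(x)^2 + g(y)^2)] times the indicator of the cube at [x - y]. By
    translation invariance each of the two terms has integral a multiple of the measure of the
    cube. *)
Lemma kernel_integrable (kappa f g : E -> R) : cube_kernel kappa ->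
  f \in L2 -> g \in L2 ->
  (mu \x mu)%E.-integrable setT
    (fun p : E * E => (f p.1 * kappa (p.1 - p.2) * g p.2)%:E).
Proof.
move=> [mk [M [r kM]]] fL gL.
have M0 : 0 <= `|M| by [].
have kM' x : `|kappa x| <= `|M| * \1_(cube r) x.
  by apply: (le_trans (kM x)); rewrite ler_wpM2r ?ler_norm.
have mf := Lfun2_measurable fL; have mg := Lfun2_measurable gL.
have mi : measurable_fun setT (fun p : E * E => \1_(cube r) (p.1 - p.2) : R).
  apply: measurableT_comp measurable_rV_sub.
  by apply: measurable_indic; exact: measurable_cube.
have mf1 : measurable_fun setT (fun p : E * E => f p.1).
  by apply: (measurableT_comp mf); exact: measurable_fst.
have mg2 : measurable_fun setT (fun p : E * E => g p.2).
  by apply: (measurableT_comp mg); exact: measurable_snd.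
pose D1 (p : E * E) := f p.1 ^+ 2 * \1_(cube r) (p.1 - p.2).
pose D2 (p : E * E) := g p.2 ^+ 2 * \1_(cube r) (p.1 - p.2).
have mD1 : measurable_fun setT D1.
  by apply: measurable_funM => //; exact: measurable_funX.
have mD2 : measurable_fun setT D2.
  by apply: measurable_funM => //; exact: measurable_funX.
have iD1 : (mu \x mu)%E.-integrable setT (EFin \o D1).
  apply/integrable12ltyP; first exact/measurable_EFinP.
  have [+ _] := indic_int r fL; apply: le_lt_trans; rewrite le_eqVlt; apply/orP; left.
  apply/eqP; apply: eq_integral => x _; apply: eq_integral => y _.
  by rewrite /= ger0_norm// mulr_ge0 ?sqr_ge0.
have iD2 : (mu \x mu)%E.-integrable setT (EFin \o D2).
  apply/integrable21ltyP; first exact/measurable_EFinP.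
  have [_ +] := indic_int r gL; apply: le_lt_trans; rewrite le_eqVlt; apply/orP; left.
  apply/eqP; apply: eq_integral => x _; apply: eq_integral => y _.
  by rewrite /= ger0_norm// mulr_ge0 ?sqr_ge0.
have iD := integrableZl measurableT `|M| (integrableD measurableT iD1 iD2).
apply: le_integrable iD => //.
  apply/measurable_EFinP; apply: measurable_funM => //; apply: measurable_funM => //.
  exact: measurableT_comp mk measurable_rV_sub.
move=> [x y] _ /=; rewrite lee_fin /D1 /D2 /=.
rewrite [leRHS]ger0_norm; last first.
  by rewrite mulr_ge0// addr_ge0// mulr_ge0 ?sqr_ge0.
rewrite !normrM.
have h : `|f x| * `|g y| <= f x ^+ 2 + g y ^+ 2.
  have := sqr_ge0 (`|f x| - `|g y|); rewrite -[f x ^+ 2]real_normK ?num_real//.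
  by rewrite -[g y ^+ 2]real_normK ?num_real//; nra.
have -> : `|M| * (f x ^+ 2 * \1_(cube r) (x - y) + g y ^+ 2 * \1_(cube r) (x - y)) =
  (f x ^+ 2 + g y ^+ 2) * (`|M| * \1_(cube r) (x - y)) by ring.
by rewrite mulrAC ler_pM ?mulr_ge0.
Qed.

End kernels.

(** * Mollification as a contraction of L^2 *)

Section mollification.
Context {R : realType} {n : nat}.
Local Notation E := 'rV[R]_n.
Local Notation mu := (@lebesgue_rV R n).
Local Notation dotp := (L2dot mu).
Local Notation nrm2 := (L2nrm mu).

Lemma cube_kernelN (kappa : E -> R) : cube_kernel kappa ->
  cube_kernel (fun z => kappa (- z)).
Proof.
move=> [mk [M [r kM]]].
split; last by exists M, r => z; rewrite -indic_cubeN; exact: kM.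
apply: measurableT_comp => //; apply: measurable_fun_rV => i.
under eq_fun do rewrite mxE; apply: measurableT_comp => //; exact: measurable_coord.
Qed.

Lemma cube_kernel_reflect_L2 (kappa : E -> R) (x : E) : cube_kernel kappa ->
  (fun y => kappa (x - y)) \in L2.
Proof.
move=> /cube_kernelN kN.
rewrite (_ : (fun y => kappa (x - y)) = (fun y => kappa (- (y - x)))).
  exact: (cube_kernel_translate_L2 x kN).
by apply/funext => y; rewrite opprB.
Qed.

(** Moves a convolution from one factor of the pairing to the other; applied both to [rho m] and to
    its partial derivatives. *)
Lemma kernel_fubini (kappa f g : E -> R) : cube_kernel kappa ->
  f \in L2 -> g \in L2 ->
  dotp g (fun y => dotp f (fun x => kappa (x - y))) =
  dotp f (fun x => dotp g (fun y => kappa (x - y))).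
Proof.
move=> ck fL gL; have ki := kernel_integrable ck fL gL.
transitivity (fine (\int[mu]_y \int[mu]_x (f x * kappa (x - y)%R * g y)%:E)%E).
  apply: (congr1 fine); apply: eq_integral => y _.
  have ky := cube_kernel_translate_L2 y ck.
  have iy := Lfun2_integrableM fL ky.
  rewrite EFinM fineK; last exact: integrable_fin_num.
  by rewrite muleC -integralZr//; apply: eq_integral => x _; rewrite EFinM.
rewrite -(Fubini ki); apply: (congr1 fine); apply: eq_integral => x _.
have kx := cube_kernel_reflect_L2 x ck.
have ix := Lfun2_integrableM gL kx.
rewrite EFinM fineK; last exact: integrable_fin_num.
rewrite -integralZl//; apply: eq_integral => y _ /=.
by rewrite -EFinM; congr EFin; ring.
Qed.

Lemma cube_kernel_mollifier m : cube_kernel (mollifier m : E -> R).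
Proof.
apply: test_fun_cube_kernel; have := @test_fun_mollifier R n m 0.
by rewrite (_ : (fun x => _) = mollifier m)//; apply/funext => x; rewrite subr0.
Qed.

Lemma cube_kernelZ a (kappa : E -> R) : cube_kernel kappa ->
  cube_kernel (fun x => a * kappa x).
Proof.
move=> [mk [M [r kM]]]; split; first exact: measurable_funM.
exists (`|a| * M), r => x; rewrite normrM -mulrA.
by rewrite ler_wpM2l.
Qed.

Lemma cube_kernel_integrable (kappa : E -> R) : cube_kernel kappa ->
  mu.-integrable setT (EFin \o kappa).
Proof.
move=> ck; have kL := cube_kernel_L2 ck; case: (ck) => mk [M [r kM]].
have iL : (\1_(cube r) : E -> R) \in L2.
  by apply: Lfun2_indic; [exact: measurable_cube|exact: cube_fin].
have := Lfun2_integrableM kL iL; apply: eq_integrable => // x _ /=; congr EFin.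
rewrite indicE; have [|nx] := boolP (x \in _); first by rewrite mulr1.
rewrite mulr0; apply/esym/eqP; rewrite -normr_le0.
by have := kM x; rewrite indicE (negbTE nx) mulr0.
Qed.

(** A zero integral would make the mollifier vanish almost everywhere, but it is positive on an open
    cube of positive measure. *)
Lemma mollifier_int_gt0 m : 0 < \int[mu]_x mollifier m x.
Proof.
rewrite lt_def Rintegral_ge0 ?andbT; last by move=> x _; exact: mollifier_ge0.
apply/eqP => i0.
have ki := cube_kernel_integrable (cube_kernel_mollifier m).
have : (\int[mu]_x `|(mollifier m x)%:E| = 0)%E.
  under eq_integral do rewrite gee0_abs ?lee_fin ?mollifier_ge0//.
  by rewrite -(fineK (integrable_fin_num measurableT ki)); congr EFin.
move/(ae_eq_integral_abs _ measurableT (measurable_int _ ki)) => -[N [mN N0 sN]].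
have : (mu (cube m.+1%:R^-1) <= mu N)%E.
  apply: le_measure; rewrite ?inE//; first exact: measurable_cube.
  move=> x cx; apply: sN => /= /(_ Logic.I) [] /eqP; apply/negP.
  rewrite gt_eqF// prodr_gt0// => i _; apply: bump_gt0.
  rewrite normrM ger0_norm// mulrC -ltr_pdivlMr// mul1r.
  by have := cx i; rewrite ltr_norml.
rewrite N0 (@lebesgue_rV_box R n (fun=> `](- m.+1%:R^-1)%R, (m.+1%:R^-1)[%classic)); last first.
  by move=> i; exact: measurable_itv.
apply/negP; rewrite -ltNge; apply: (@big_ind \bar R (fun x => 0 < x)%E) => //.
  by move=> x y; exact: mule_gt0.
move=> i _; rewrite lebesgue_measure_itv/= lte_fin gtrN ?invr_gt0// .
by rewrite -EFinD lte_fin opprK addr_gt0 ?invr_gt0.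
Qed.

Definition rho m (x : E) : R := (\int[mu]_x mollifier m x)^-1 * mollifier m x.

Lemma rho_ge0 m x : 0 <= rho m x.
Proof. by rewrite mulr_ge0 ?mollifier_ge0// invr_ge0 ltW ?mollifier_int_gt0. Qed.

Lemma rhoN m x : rho m (- x) = rho m x.
Proof. by rewrite /rho mollifierN. Qed.

Lemma cube_kernel_rho m : cube_kernel (rho m).
Proof. by apply: cube_kernelZ; exact: cube_kernel_mollifier. Qed.

Lemma rho_neq0 m x i : rho m x != 0 -> `|x 0 i| < m.+1%:R^-1.
Proof. by rewrite mulf_eq0 negb_or => /andP[_]; exact: mollifier_neq0. Qed.

Lemma rho_int m : \int[mu]_x rho m x = 1.
Proof.
rewrite RintegralZl//; last exact: cube_kernel_integrable (cube_kernel_mollifier m).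
by rewrite mulVf// gt_eqF// mollifier_int_gt0.
Qed.

Lemma rho_eint m (y : E) : (\int[mu]_x (rho m (x - y)%R)%:E = 1)%E.
Proof.
have [mr _] := cube_kernel_rho m.
have ir := cube_kernel_integrable (cube_kernel_rho m).
rewrite (@ge0_integral_rV_translate R n (- y) (fun x => (rho m x)%:E)).
- by rewrite -(fineK (integrable_fin_num measurableT ir)); congr EFin; exact: rho_int.
- exact/measurable_EFinP.
- by move=> x; rewrite lee_fin rho_ge0.
Qed.

Lemma test_fun_rho m (y : E) : test_fun setT (fun x => rho m (x - y)).
Proof.
have [Ct ct _] := @test_fun_mollifier R n m y.
apply: (@test_funI _ _ _ (supp (fun x : E => mollifier m (x - y)))) => //.
  by move=> k; apply: CkM; [exact: Ck_cst|exact: Ct].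
move=> x; rewrite mulf_eq0 negb_or => /andP[_ mx].
exact: subset_closure.
Qed.

(** The convolution of [f] with [rho m], which is even. The kernel is written as a test function of
    [x] centred at [y], the form in which weak identities can be applied. *)
Definition mollify m (f : E -> R) (y : E) : R := dotp f (fun x => rho m (x - y)).

Lemma rho_L2 m y : (fun x => rho m (x - y)) \in L2.
Proof. by apply: cube_kernel_translate_L2; exact: cube_kernel_rho. Qed.

Lemma mollifyD m f g : f \in L2 -> g \in L2 ->
  mollify m (f \+ g) = mollify m f \+ mollify m g.
Proof. by move=> fL gL; apply/funext => y; rewrite /mollify dotpDl//; exact: rho_L2. Qed.

Lemma mollifyB m f g : f \in L2 -> g \in L2 ->
  mollify m (f \- g) = mollify m f \- mollify m g.
Proof. by move=> fL gL; apply/funext => y; rewrite /mollify dotpBl//; exact: rho_L2. Qed.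

Lemma mollifyZ m a f : f \in L2 ->
  mollify m (fun x => a * f x) = fun y => a * mollify m f y.
Proof. by move=> fL; apply/funext => y; rewrite /mollify dotpZl//; exact: rho_L2. Qed.

Let measurable_mollify_ge0 m f : f \in L2 -> (forall x, 0 <= f x) ->
  measurable_fun setT (mollify m f).
Proof.
move=> fL f0; have [mr _] := cube_kernel_rho m.
have mf := Lfun2_measurable fL.
apply: (@measurableT_comp _ _ _ _ _ _ (@fine R)); first exact: fine_measurable.
apply: (@measurable_fun_fubini_tonelli_G _ _ _ _ _ mu
  (fun p : E * E => (f p.1 * rho m (p.1 - p.2))%:E)).
  apply/measurable_EFinP; apply: measurable_funM.
    by apply: (measurableT_comp mf); exact: measurable_fst.
  exact: measurableT_comp mr measurable_rV_sub.
by move=> p; rewrite lee_fin mulr_ge0// rho_ge0.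
Qed.

(** Tonelli settles nonnegative functions; the decomposition [f = (|f| + f) - |f|] reduces the
    general case to them within L^2. *)
Lemma measurable_mollify m f : f \in L2 -> measurable_fun setT (mollify m f).
Proof.
move=> fL.
have pL : (fun x => `|f x|) \+ f \in L2 by apply: Lfun2D => //; exact: Lfun2_norm.
have nL : (fun x => `|f x|) \in L2 by exact: Lfun2_norm.
have -> : f = ((fun x => `|f x|) \+ f) \- (fun x => `|f x|).
  by apply/funext => x /=; ring.
rewrite mollifyB//; apply: measurable_funB; apply: measurable_mollify_ge0 => // x /=.
by have := ler_norm (- f x); rewrite normrN; lra.
Qed.

(** Jensen's inequality for the probability density [rho m (. - y)]: the integral of [(f - l)^2]
    against it is nonnegative, [l] being the mean of [f]. *)
Lemma mollify_sqr_le m f y : f \in L2 ->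
  ((mollify m f y ^+ 2)%:E <= \int[mu]_x (f x ^+ 2 * rho m (x - y)%R)%:E)%E.
Proof.
move=> fL; set l := mollify m f y.
have mf := Lfun2_measurable fL.
have [mr [M [r rM]]] := cube_kernel_rho m.
have i1 : mu.-integrable setT (EFin \o (fun x => f x * rho m (x - y))).
  by apply: Lfun2_integrableM => //; exact: rho_L2.
have i0 : mu.-integrable setT (EFin \o (fun x => rho m (x - y))).
  apply/integrableP; split.
    by apply/measurable_EFinP; apply: measurableT_comp => //; exact: measurable_rV_translate.
  under eq_integral do rewrite /= ger0_norm ?rho_ge0//.
  by rewrite rho_eint ltry.
have i2 : mu.-integrable setT (EFin \o (fun x => f x ^+ 2 * rho m (x - y))).
  have rfL : (fun x => f x * rho m (x - y)) \in L2.
    apply: (@le_Lfun2 _ _ _ mu _ (fun x => `|M| * f x)); last 2 first.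
    - exact: Lfun2Z.
    - move=> x; rewrite normrM [leRHS]normrM normr_id mulrC ler_wpM2r//.
      apply: (le_trans (rM _)); rewrite indicE; apply: (@le_trans _ _ (`|M| * 1)).
        by case: (_ \in _); rewrite ?mulr1 ?mulr0// ler_norm.
      by rewrite mulr1.
    apply: measurable_funM => //; apply: measurableT_comp => //.
    exact: measurable_rV_translate.
  apply: eq_integrable (Lfun2_integrableM fL rfL) => // x _ /=.
  by rewrite expr2 mulrA.
rewrite -(fineK (integrable_fin_num measurableT i2)) lee_fin.
have : 0 <= \int[mu]_x ((f x ^+ 2 * rho m (x - y) - (2 * l) * (f x * rho m (x - y)))
                        + l ^+ 2 * rho m (x - y)).
  apply: Rintegral_ge0 => x _.
  rewrite (_ : _ + _ = (f x - l) ^+ 2 * rho m (x - y)); last by ring.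
  by rewrite mulr_ge0 ?sqr_ge0 ?rho_ge0.
have i1' := integrableZl measurableT (2 * l) i1.
have i0' := integrableZl measurableT (l ^+ 2) i0.
rewrite RintegralD//; last exact: (integrableB measurableT i2 i1').
rewrite RintegralB// RintegralZl// RintegralZl//.
have -> : \int[mu]_x rho m (x - y) = 1 by rewrite /Rintegral rho_eint.
rewrite -/(L2dot mu f (fun x => rho m (x - y))) -/(mollify m f y) -/l /Rintegral.
by set a := fine _; nra.
Qed.

(** [mollify_sqr_le] is integrated in [y] and the order of integration exchanged; the kernel has
    mass one in [y] too, being even. *)
Lemma mollify_contract m f : f \in L2 -> mollify m f \in L2 /\ nrm2 (mollify m f) <= nrm2 f.
Proof.
move=> fL; have mc := measurable_mollify m fL.
have mf := Lfun2_measurable fL; have [mr _] := cube_kernel_rho m.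
have le : (\int[mu]_y (mollify m f y ^+ 2)%:E <= (nrm2 f ^+ 2)%:E)%E.
  apply: (@le_trans _ _ (\int[mu]_y \int[mu]_x (f x ^+ 2 * rho m (x - y)%R)%:E)%E).
    apply: ge0_le_integral => //.
    - by move=> y _; rewrite lee_fin sqr_ge0.
    - by apply/measurable_EFinP; exact: measurable_funX.
    - apply: (@measurable_fun_fubini_tonelli_G _ _ _ _ _ mu
  (fun p : E * E => (f p.1 ^+ 2 * rho m (p.1 - p.2))%:E)).
        apply/measurable_EFinP; apply: measurable_funM.
          apply: measurable_funX.
          by apply: (measurableT_comp mf); exact: measurable_fst.
        exact: measurableT_comp mr measurable_rV_sub.
      by move=> p; rewrite lee_fin mulr_ge0 ?sqr_ge0// rho_ge0.
    - by move=> y _; exact: mollify_sqr_le.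
  rewrite -(@fubini_tonelli _ _ _ _ _ mu mu
    (fun p : E * E => (f p.1 ^+ 2 * rho m (p.1 - p.2))%:E)); last 2 first.
  - apply/measurable_EFinP; apply: measurable_funM.
      apply: measurable_funX.
      by apply: (measurableT_comp mf); exact: measurable_fst.
    exact: measurableT_comp mr measurable_rV_sub.
  - by move=> p; rewrite lee_fin mulr_ge0 ?sqr_ge0// rho_ge0.
  rewrite -dotp_nrm2_fin// le_eqVlt; apply/orP; left; apply/eqP.
  apply: eq_integral => x _ /=.
  under eq_integral do rewrite -opprB rhoN EFinM.
  rewrite ge0_integralZl//.
  - by rewrite rho_eint mule1.
  - apply/measurable_EFinP; apply: measurableT_comp => //.
    exact: measurable_rV_translate.
  - by move=> y _; rewrite lee_fin rho_ge0.
  - by rewrite lee_fin sqr_ge0.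
have cL : mollify m f \in L2.
  apply/Lfun2P; split => //; apply/integrableP; split.
    by apply/measurable_EFinP; exact: measurable_funX.
  under eq_integral do rewrite /= ger0_norm ?sqr_ge0//.
  exact: le_lt_trans le (ltry _).
split => //; rewrite -ler_sqr ?nnegrE ?nrm2_ge0// -lee_fin.
by rewrite -dotp_nrm2_fin.
Qed.

End mollification.

(** * Convergence of mollifications in L^2 *)

Section approximate_identity.
Import HBNNSimple.
Context {R : realType} {n : nat}.
Local Notation E := 'rV[R]_n.
Local Notation mu := (@lebesgue_rV R n).
Local Notation dotp := (L2dot mu).
Local Notation nrm2 := (L2nrm mu).

(** The functions approximated by their mollifications. This class is closed under linear
    combinations and L^2 limits; starting from indicators of open sets, it is extended to measurable
    sets by Dynkin's theorem and then to L^2 by simple functions. *)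
Let good (f : E -> R) : Prop := f \in L2 /\
  forall e : R, 0 < e -> \forall m \near \oo, nrm2 (mollify m f \- f) <= e.

Let mollify_indic_bound m (A : set E) y : measurable A -> (mu A < +oo)%E ->
  `|mollify m \1_A y| <= 1.
Proof.
move=> mA A_fin; have AL : (\1_A : E -> R) \in L2 by exact: Lfun2_indic.
rewrite ger0_norm; last first.
  by apply: Rintegral_ge0 => x _; rewrite mulr_ge0// rho_ge0.
rewrite -[leRHS](_ : \int[mu]_x rho m (x - y) = 1); last by rewrite /Rintegral rho_eint.
apply: le_Rintegral => //.
- by apply: Lfun2_integrableM => //; exact: rho_L2.
- apply/integrableP; split.
    apply/measurable_EFinP; apply: measurableT_comp; last exact: measurable_rV_translate.
    exact: (proj1 (cube_kernel_rho m)).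
  under eq_integral do rewrite /= ger0_norm ?rho_ge0//.
  by rewrite rho_eint ltry.
- move=> x _; rewrite indicE; case: (_ \in _); rewrite ?mul1r ?mul0r//.
  exact: rho_ge0.
Qed.

(** Pointwise convergence is clear inside [U], but the boundary is not under control. It suffices to
    know the mollification on [U]: as mollifying contracts the norm, the squared distance to [\1_U]
    is at most twice the pairing of [\1_U - w m] with [\1_U]. *)
Let good_open (U : set E) : open U -> (mu U < +oo)%E -> good \1_U.
Proof.
move=> oU U_fin; have mU := open_rV_measurable oU.
have UL : (\1_U : E -> R) \in L2 by exact: Lfun2_indic.
split=> // e e0.
pose w m y := mollify m \1_U y * \1_U y.
have mw m : measurable_fun setT (w m).
  by apply: measurable_funM; [exact: measurable_mollify|exact: measurable_indic].
have w1 m x : `|w m x| <= \1_U x.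
  rewrite /w normrM (ger0_norm (x := \1_U x))// ler_piMl//.
  exact: mollify_indic_bound.
have cw x : w ^~ x @ \oo --> (\1_U x : R).
  rewrite /w indicE; have [|xU] := boolP (x \in U); last first.
    by under eq_fun do rewrite mulr0; exact: cvg_cst.
  rewrite inE => Ux; under eq_fun do rewrite mulr1.
  have [r r0 rU] := rV_nbhs_box (open_nbhs_nbhs (conj oU Ux : open_nbhs x U)).
  apply: cvg_near_cst; near=> m.
  have mr : m.+1%:R^-1 < r by near: m; exact: (near_infty_natSinv_lt (PosNum r0)).
  rewrite -[RHS](_ : \int[mu]_z rho m (z - x) = 1); last by rewrite /Rintegral rho_eint.
  apply: eq_Rintegral => z _; have [->|zx] := eqVneq (rho m (z - x)) 0.
    by rewrite mulr0.
  rewrite indicE mem_set ?mul1r//; apply: rU => i.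
  by have := rho_neq0 i zx; rewrite !mxE => h; exact: lt_trans mr.
have [_ wU] := dominated_nrm2_cvg mw UL w1 cw.
have wL m : w m \in L2.
  by apply: (le_Lfun2 (mw m) UL) => x; exact: le_trans (w1 m x) (ler_norm _).
have [c c0 ce] : exists2 c, 0 < c & 2 * c * nrm2 \1_U <= e ^+ 2.
  exists (e ^+ 2 / (2 * nrm2 \1_U + 1)).
    by rewrite divr_gt0 ?exprn_gt0// ltr_wpDl// mulr_ge0 ?nrm2_ge0.
  have b0 : 0 < 2 * nrm2 \1_U + 1 by rewrite ltr_wpDl// mulr_ge0 ?nrm2_ge0.
  rewrite (_ : _ * _ * _ = e ^+ 2 * (2 * nrm2 \1_U) / (2 * nrm2 \1_U + 1)); last by ring.
  rewrite ler_pdivrMr// ler_wpM2l ?sqr_ge0//; lra.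
move/cvgrPdist_le : wU => /(_ _ c0); apply: filterS => m.
rewrite sub0r normrN ger0_norm ?nrm2_ge0// => wc.
have [cL cle] := mollify_contract m UL.
rewrite -ler_sqr ?nnegrE ?nrm2_ge0 ?(ltW e0)//.
rewrite sqr_nrm2 dotpBl ?dotpBr//; try exact: Lfun2B.
rewrite (dotpC _ \1_U (mollify m \1_U)).
have -> : dotp (mollify m \1_U) \1_U = dotp (w m) \1_U.
  apply: eq_Rintegral => x _; rewrite /w -mulrA; congr (_ * _).
  by rewrite indicE; case: (_ \in _); rewrite ?mulr1 ?mulr0.
have h1 : dotp (mollify m \1_U) (mollify m \1_U) <= dotp \1_U \1_U.
  by rewrite -!sqr_nrm2 ler_sqr ?nnegrE ?nrm2_ge0.
have h2 : dotp (\1_U \- w m) \1_U <= c * nrm2 \1_U.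
  apply: (le_trans (dotp_le_nrm2 _ _)) => //; first exact: Lfun2B.
  by rewrite nrm2_distC ler_wpM2r// nrm2_ge0.
by rewrite dotpBl// in h2; lra.
Unshelve. all: by end_near. Qed.

Let good_lim (g : nat -> E -> R) f : (forall k, good (g k)) -> f \in L2 ->
  nrm2 (g k \- f) @[k --> \oo] --> 0 -> good f.
Proof.
move=> gg fL gf; split=> // e e0.
have e3 : 0 < e / 3 by rewrite divr_gt0.
have [k _ /(_ k (leqnn _))] := (cvgrPdist_le _ _).1 gf _ e3.
rewrite /= sub0r normrN ger0_norm ?nrm2_ge0// => gk.
have [gL /(_ _ e3)] := gg k; apply: filterS => m cm.
have [cgL _] := mollify_contract m gL; have [cfL _] := mollify_contract m fL.
have h1 := nrm2_triangle cfL fL cgL.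
have h2 := nrm2_triangle cgL fL gL.
have h3 : nrm2 (mollify m f \- mollify m (g k)) <= e / 3.
  rewrite -mollifyB//; have [_] := mollify_contract m (Lfun2B fL gL).
  by move/le_trans; apply; rewrite nrm2_distC.
by move: h1 h2 h3 gk cm; lra.
Qed.

Let good_lin (a b : R) f g : good f -> good g ->
  good (fun x => a * f x + b * g x).
Proof.
move=> [fL gf] [gL gg].
have afL := Lfun2Z a fL; have bgL := Lfun2Z b gL.
split; first exact: (Lfun2D afL bgL).
move=> e e0.
have ea : 0 < e / 2 / (`|a| + 1) by rewrite !divr_gt0// ltr_wpDl.
have eb : 0 < e / 2 / (`|b| + 1) by rewrite !divr_gt0// ltr_wpDl.
near=> m.
have fm : nrm2 (mollify m f \- f) <= e / 2 / (`|a| + 1) by near: m; exact: gf.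
have gm : nrm2 (mollify m g \- g) <= e / 2 / (`|b| + 1) by near: m; exact: gg.
have [cfL _] := mollify_contract m fL; have [cgL _] := mollify_contract m gL.
have dfL := Lfun2B cfL fL; have dgL := Lfun2B cgL gL.
have -> : mollify m (fun x => a * f x + b * g x) \- (fun x => a * f x + b * g x) =
    (fun x => a * (mollify m f \- f) x) \+ (fun x => b * (mollify m g \- g) x).
  rewrite [mollify _ _](_ : _ = mollify m (fun x => a * f x) \+ mollify m (fun x => b * g x)).
    by rewrite !mollifyZ//; apply/funext => x /=; ring.
  by rewrite -mollifyD.
apply: (le_trans (nrm2D (Lfun2Z a dfL) (Lfun2Z b dgL))); rewrite !nrm2Z//.
have aux (c x : R) : 0 <= x -> x <= e / 2 / (`|c| + 1) -> `|c| * x <= e / 2.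
  move=> x0; rewrite ler_pdivlMr ?ltr_wpDl// => h.
  by apply: le_trans h; rewrite mulrC ler_wpM2l// lerDl.
have := aux a _ (nrm2_ge0 mu _) fm; have := aux b _ (nrm2_ge0 mu _) gm; lra.
Unshelve. all: by end_near. Qed.

Let good0 : good (cst 0).
Proof.
have := good_open open0; rewrite measure0 => /(_ (ltry 0)).
by rewrite indic0.
Qed.

Let good_sum (I : Type) (s : seq I) (a : I -> R) (F : I -> E -> R) :
  (forall i, good (F i)) -> good (fun x => \sum_(i <- s) a i * F i x).
Proof.
move=> gF; elim: s => [|i s IH].
  by under eq_fun do rewrite big_nil; exact: good0.
under eq_fun do rewrite big_cons.
have := good_lin (a i) 1 (gF i) IH.
by under eq_fun do rewrite mul1r.
Qed.

(** The sets with this property form a Dynkin system containing the open sets. The intersection with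
    a cube keeps measures finite and provides the dominating function for disjoint unions. *)
Let good_measurable (A : set E) (r : R) : measurable A -> good \1_(A `&` cube r).
Proof.
move=> mA; have mQ := measurable_cube r : measurable (cube r : set E).
have Qfin := cube_fin r : (mu (cube r : set E) < +oo)%E.
have QL : (\1_(cube r) : E -> R) \in L2 by exact: Lfun2_indic.
have gQ : good \1_(cube r) by apply: good_open => //; exact: open_cube.
pose D := [set B : set E | measurable B /\ good \1_(B `&` cube r)].
suff: <<s [set U : set E | open U] >> `<=` D.
  by rewrite -rV_measurable_open => /(_ _ mA)[].
rewrite -setI_closed_g_dynkin_g_sigma_algebra; last by move=> U V; exact: openI.
apply: smallest_sub; last first.
  move=> U oU; have mU := open_rV_measurable oU; split => //.
  apply: good_open; first by apply: openI => //; exact: open_cube.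
  apply: le_lt_trans Qfin; apply: le_measure; rewrite ?inE//.
  exact: measurableI.
split.
- by split => //; rewrite setTI.
- move=> B [mB gB]; split; first exact: measurableC.
  rewrite (_ : \1_(~` B `&` cube r) = fun x => 1 * \1_(cube r) x + -1 * \1_(B `&` cube r) x).
    exact: good_lin.
  apply/funext => x; rewrite !indicE !in_setI in_setC.
  by case: (x \in B); case: (x \in cube r); rewrite /= ?mulr1 ?mulr0 ?subrr ?addr0 ?mul1r ?mulN1r ?subrr ?oppr0 ?addr0.
- move=> F tF DF; split; first by apply: bigcup_measurable => k _; exact: (DF k).1.
  pose S k (x : E) := \sum_(i < k) \1_(F i `&` cube r) x : R.
  have gS k : good (S k).
    have := @good_sum _ (index_enum 'I_k) (fun=> 1) (fun i : 'I_k => \1_(F i `&` cube r)).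
    by under eq_fun do under eq_bigr do rewrite mul1r; apply => i; exact: (DF i).2.
  (* By disjointness only the term of index [j] counts at a point of [F j], and the sum over [i < k]
     contains it exactly when [j < k]. *)
  have Sj j x k : F j x -> cube r x -> S k x = (j < k)%N%:R.
    move=> Fjx Qx; rewrite /S; elim: k => [|k IH]; first by rewrite big_ord0.
    rewrite big_ord_recr/= IH indicE in_setI (mem_set Qx) andbT ltnS.
    have [->|kj] := eqVneq k j; first by rewrite ltnn leqnn mem_set// add0r.
    rewrite memNset ?addr0 ?ltn_neqAle 1?eq_sym ?kj//.
    move=> Fkx; move/trivIsetP : tF => /(_ _ _ Logic.I Logic.I kj) FI.
    by have : set0 x by rewrite -FI.
  have S0 x k : ~ ((\bigcup_k F k) `&` cube r) x -> S k x = 0.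
    move=> nx; rewrite /S big1// => i _; rewrite indicE memNset// => -[Fx Qx].
    by apply: nx; split => //; exists i.
  have S1 k x : `|S k x| <= \1_(cube r) x.
    have [[[j _ Fx] Qx]|nx] := pselect (((\bigcup_k F k) `&` cube r) x).
      by rewrite (Sj _ _ _ Fx Qx) indicE (mem_set Qx) ger0_norm// ler_nat leq_b1.
    by rewrite S0// normr0.
  have cS x : S ^~ x @ \oo --> (\1_((\bigcup_k F k) `&` cube r) x : R).
    have [[[j _ Fx] Qx]|nx] := pselect (((\bigcup_k F k) `&` cube r) x).
      rewrite indicE mem_set; last by split => //; exists j.
      apply: cvg_near_cst; near=> k; rewrite (Sj _ _ _ Fx Qx).
      by have -> : (j < k)%N by near: k; exists j.+1.
    rewrite indicE memNset//; apply: cvg_near_cst; near=> k; exact: S0.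
  have [fL Sf] := dominated_nrm2_cvg (fun k => Lfun2_measurable (gS k).1) QL S1 cS.
  exact: good_lim gS fL Sf.
Unshelve. all: by end_near. Qed.

Theorem mollify_cvg (f : E -> R) : f \in L2 ->
  nrm2 (mollify m f \- f) @[m --> \oo] --> 0.
Proof.
move=> fL; apply/cvgrPdist_le => e e0.
suff [_ /(_ _ e0)] : good f.
  by apply: filterS => m; rewrite sub0r normrN ger0_norm ?nrm2_ge0.
wlog f0 : f fL / forall x, 0 <= f x.
  move=> H.
  have nL : (fun x => `|f x|) \in L2 by exact: Lfun2_norm.
  have pL : (fun x => `|f x|) \+ f \in L2 by exact: Lfun2D.
  have gp : good ((fun x => `|f x|) \+ f).
    by apply: H => // x /=; have := ler_norm (- f x); rewrite normrN; lra.
  have gn : good (fun x => `|f x|) by apply: H => // x.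
  have := good_lin 1 (-1) gp gn.
  by under eq_fun do (rewrite /= mul1r mulN1r addrAC subrr add0r).
have mf : measurable_fun setT (EFin \o f).
  by apply/measurable_EFinP; exact: Lfun2_measurable fL.
pose g k : E -> R := nnsfun_approx measurableT mf k.
(* Simple functions increasing to [f], cut to growing cubes: each is then a combination of
   indicators covered by [good_measurable], and [f] dominates them all. *)
pose w k x := g k x * \1_(cube k%:R) x.
have gw k : good (w k).
  pose h : {nnsfun E >-> R} := nnsfun_approx measurableT mf k.
  have -> : w k = fun x => \sum_(y <- finmap.enum_fset (fset_set (range h)))
      y * \1_(h @^-1` [set y] `&` cube k%:R) x.
    apply/funext => x; rewrite /w /g -/h fimfunE fsbig_finite//= mulr_suml.
    apply: eq_bigr => y _.
    by rewrite -mulrA !indicE in_setI -natrM mulnb.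
  apply: good_sum => y; apply: good_measurable.
  by rewrite -[X in measurable X]setTI; exact: (measurable_funP h).
have g0 k x : 0 <= g k x by exact: fun_ge0.
have cg x : g ^~ x @ \oo --> f x.
  have h := @cvg_nnsfun_approx _ _ _ _ measurableT _ mf (fun x _ => f0 x : (0 <= (f x)%:E)%E) x Logic.I.
  by move/fine_cvgP : h => [_].
have gf k x : g k x <= f x.
  rewrite -(cvg_lim _ (cg x))//; apply: nondecreasing_cvgn_le; last by apply: cvgP (cg x).
  by move=> i j ij; exact/lefP/nd_nnsfun_approx.
have wf k x : `|w k x| <= f x.
  rewrite /w ger0_norm ?mulr_ge0//; apply: le_trans (gf k x).
  by rewrite ler_piMr// indicE; case: (_ \in _).
have cw x : w ^~ x @ \oo --> f x.
  have [r r0 xr] := compact_cube (@compact_set1 E x).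
  apply: cvg_trans (cg x); apply: near_eq_cvg; near=> k.
  rewrite /w indicE mem_set ?mulr1// => i.
  have := xr x erefl i; have : r <= k%:R by near: k; exact: nbhs_infty_ger.
  by move: (k%:R : R) => K; lra.
have [_ h] := dominated_nrm2_cvg (fun k => Lfun2_measurable (gw k).1) fL wf cw.
exact: good_lim gw fL h.
Unshelve. all: by end_near. Qed.

End approximate_identity.

(** Only one directional derivative is assumed, so [f] is restricted to the line through [a] along
    [v], where a derivable function is differentiable. *)
Lemma derive_scale_dir {R : realType} {W : normedModType R} (f : W -> R) (c : R) a v :
  derivable f a v -> 'D_(c *: v) f a = c * 'D_v f a.
Proof.
move=> df; pose l (h : R) := h *: v + a.
have ll (h w x : R) : l (h *: w + x) = h *: (w *: v) + l x.
  by rewrite /l scalerDl scalerA addrA.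
have l0 : l 0 = a by rewrite /l scale0r add0r.
have E1 := @derive_comp_affine R R W l (fun h => h *: v) ll f _ 0.
have d1 : is_derive (0 : R) (1 : R) (f \o l) ('D_v f a).
  split; last by rewrite E1 scale1r l0.
  by apply: (derivable_comp_affine ll); rewrite scale1r l0.
have [_] := derive_scale1 c d1.
by rewrite E1 l0.
Qed.

(** * Weak derivatives and weak equations *)

Section weak_derivatives.
Context {R : realType} {n : nat}.
Local Notation E := 'rV[R]_n.
Local Notation mu := (@lebesgue_rV R n).
Local Notation dotp := (L2dot mu).
Local Notation nrm2 := (L2nrm mu).

Lemma kernel_integrable_inner (kappa f g : E -> R) : cube_kernel kappa ->
  f \in L2 -> g \in L2 ->
  mu.-integrable setT (EFin \o (fun y => g y * dotp f (fun x => kappa (x - y)))).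
Proof.
move=> ck fL gL; have ki := kernel_integrable (cube_kernelN ck) gL fL.
have := integrable_fubini_F ki; apply: eq_integrable => // y _.
have iy := Lfun2_integrableM fL (cube_kernel_translate_L2 y ck).
rewrite /fubini_F /= /L2dot /Rintegral EFinM fineK; last exact: integrable_fin_num.
rewrite -integralZl//; apply: eq_integral => x _; rewrite -!EFinM opprB.
by congr EFin; ring.
Qed.

Definition drho i m (z : E) : R := 'D_(basis_vec i) (rho m) z.

Lemma test_fun_rho0 m : test_fun setT (rho m : E -> R).
Proof.
have := @test_fun_rho R n m 0.
by rewrite (_ : (fun x => _) = rho m)//; apply/funext => x; rewrite subr0.
Qed.

Lemma cube_kernel_drho i m : cube_kernel (drho i m).
Proof. apply: test_fun_cube_kernel; apply: test_fun_derive; exact: test_fun_rho0. Qed.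

Lemma derive_rho_translate i m (x y : E) :
  'D_(basis_vec i) (fun x => rho m (x - y)) x = drho i m (x - y).
Proof.
have := @derive_comp_affine R E E (fun x => x - y) id _ (rho m) (basis_vec i) x.
by apply => h v z; rewrite -addrA.
Qed.

Lemma drhoN i m (z : E) : drho i m (- z) = - drho i m z.
Proof.
have h : 'D_(basis_vec i) (rho m \o (fun x : E => - x)) z = 'D_(- basis_vec i) (rho m) (- z).
  apply: (@derive_comp_affine R E E (fun x => - x) (fun x => - x)) => c v x.
  by rewrite opprD scalerN.
have rE : rho m \o (fun x : E => - x) = rho m by apply/funext => x /=; rewrite rhoN.
rewrite rE -(scaleN1r (basis_vec i)) derive_scale_dir in h; last exact: test_fun_derivable (test_fun_rho0 m).
by rewrite /drho h mulN1r opprK.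
Qed.

Lemma mollifyE m (g : E -> R) x : dotp g (fun y => rho m (x - y)) = mollify m g x.
Proof. by apply: eq_Rintegral => y _; rewrite -opprB rhoN. Qed.

Lemma mollify_weak_deriv i m (g gi : E -> R) (x : E) : g \in L2 ->
  is_weak_deriv i g gi ->
  dotp g (fun y => drho i m (x - y)) = mollify m gi x.
Proof.
move=> gL /(_ _ (test_fun_rho m x)) h.
have dL := cube_kernel_translate_L2 x (cube_kernel_drho i m).
have -> : (fun y => drho i m (x - y)) = (fun y => -1 * drho i m (y - x)).
  by apply/funext => y; rewrite -opprB drhoN mulN1r.
rewrite dotpZr// mulN1r; apply: oppr_inj; rewrite opprK -[RHS]h.
by apply: eq_Rintegral => y _; rewrite derive_rho_translate.
Qed.

(* The weak equation is tested with [rho m (. - y)], multiplied by [g y] and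
   integrated in [y]: the derivatives then fall on [g], which thus need not be
   approximated by test functions. *)
Theorem weak_equation_H1 (F g : E -> R) (G dg : 'I_n -> E -> R) :
  F \in L2 -> g \in L2 -> (forall i, G i \in L2) -> (forall i, dg i \in L2) ->
  (forall i, is_weak_deriv i g (dg i)) ->
  (forall psi, test_fun setT psi ->
     dotp F psi + \sum_(i < n) dotp (G i) (fun x => 'D_(basis_vec i) psi x) = 0) ->
  dotp F g + \sum_(i < n) dotp (G i) (dg i) = 0.
Proof.
move=> FL gL GL dgL gdg H.
have Hm m : dotp F (mollify m g) + \sum_(i < n) dotp (G i) (mollify m (dg i)) = 0.
  have e1 : dotp F (mollify m g) = dotp g (mollify m F).
    have -> : mollify m g = fun x => dotp g (fun y => rho m (x - y)).
      by apply/funext => x; rewrite mollifyE.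
    exact: esym (kernel_fubini (cube_kernel_rho m) FL gL).
  have e2 i : dotp (G i) (mollify m (dg i)) =
      dotp g (fun y => dotp (G i) (fun x => drho i m (x - y))).
    have -> : mollify m (dg i) = fun x => dotp g (fun y => drho i m (x - y)).
      by apply/funext => x; rewrite (mollify_weak_deriv _ _ gL (gdg i)).
    exact: esym (kernel_fubini (cube_kernel_drho i m) (GL i) gL).
  have Hy y : mollify m F y + \sum_(i < n) dotp (G i) (fun x => drho i m (x - y)) = 0.
    have hd i : 'D_(basis_vec i) (fun x => rho m (x - y)) = (fun x => drho i m (x - y)).
      by apply/funext => x; rewrite derive_rho_translate.
    have -> : \sum_(i < n) dotp (G i) (fun x => drho i m (x - y)) =
        \sum_(i < n) dotp (G i) ('D_(basis_vec i) (fun x => rho m (x - y))).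
      by apply: eq_bigr => i _; exact (esym (f_equal (L2dot mu (G i)) (hd i))).
    exact: (H _ (test_fun_rho m y)).
  rewrite e1; under eq_bigr do rewrite e2.
  have iF := kernel_integrable_inner (cube_kernel_rho m) FL gL.
  have iG i := kernel_integrable_inner (cube_kernel_drho i m) (GL i) gL.
  have split_sum (s : seq 'I_n) :
      mu.-integrable setT (EFin \o (fun y => \sum_(i <- s)
        g y * dotp (G i) (fun x => drho i m (x - y)))) /\
      \int[mu]_y (\sum_(i <- s) g y * dotp (G i) (fun x => drho i m (x - y))) =
      \sum_(i <- s) dotp g (fun y => dotp (G i) (fun x => drho i m (x - y))).
    elim: s => [|i s [IH1 IH2]].
      rewrite big_nil; under eq_fun do rewrite big_nil; split; first exact: integrable0.
      by rewrite Rintegral_cst// mul0r.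
    rewrite big_cons -IH2; under eq_fun do rewrite big_cons; split.
      by apply: eq_integrable (integrableD measurableT (iG i) IH1).
    by rewrite RintegralD.
  have [iS <-] := split_sum (index_enum 'I_n).
  rewrite -RintegralD//; under eq_Rintegral => y _.
    rewrite -mulr_sumr -mulrDr (_ : _ + _ = 0) ?mulr0; first over.
    exact: Hy.
  by rewrite Rintegral_cst// mul0r.
have cF : dotp F (mollify m g) @[m --> \oo] --> dotp F g.
  apply: dotp_cvgr => //; last exact: mollify_cvg.
  by apply: nearW => m; have [] := mollify_contract m gL.
have cG i : dotp (G i) (mollify m (dg i)) @[m --> \oo] --> dotp (G i) (dg i).
  apply: dotp_cvgr => //; last exact: mollify_cvg.
  by apply: nearW => m; have [] := mollify_contract m (dgL i).
have cH : dotp F (mollify m g) + \sum_(i < n) dotp (G i) (mollify m (dg i)) @[m --> \oo]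
    --> dotp F g + \sum_(i < n) dotp (G i) (dg i).
  by apply: cvgD => //; apply: (cvg_big add_continuous).
rewrite (_ : (fun m => _) = fun=> 0) in cH; last by apply/funext => m; exact: Hm.
by rewrite -(cvg_lim (@Rhausdorff R) cH) lim_cst.
Qed.

(** The values of the mollifications of [g] are pairings with test functions, hence zero, while the
    mollifications converge to [g]. *)
Lemma test_fun_dense (g : E -> R) : g \in L2 ->
  (forall psi, test_fun setT psi -> dotp g psi = 0) -> nrm2 g = 0.
Proof.
move=> gL g0; have := mollify_cvg gL.
have -> : (fun m => nrm2 (mollify m g \- g)) = fun=> nrm2 g.
  apply/funext => m; rewrite -[RHS]nrm2N//.
  have -> : mollify m g = cst 0.
    by apply/funext => x; rewrite /mollify g0//; exact: test_fun_rho.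
  by have -> : cst 0 \- g = \- g by apply/funext => x; rewrite /= sub0r.
by move=> h; rewrite -(cvg_lim (@Rhausdorff R) h) lim_cst.
Qed.

Lemma is_weak_derivB i (f g f' g' : E -> R) : f \in L2 -> g \in L2 ->
  f' \in L2 -> g' \in L2 ->
  is_weak_deriv i f f' -> is_weak_deriv i g g' ->
  is_weak_deriv i (f \- g) (f' \- g').
Proof.
move=> fL gL fL' gL' ff gg phi tphi.
have pL := test_fun_L2 tphi; have dL := test_fun_L2 (test_fun_derive (basis_vec i) tphi).
have := dotpBl fL gL dL; rewrite {1}/L2dot => ->.
have := dotpBl fL' gL' pL; rewrite {1}/L2dot => ->.
by rewrite /L2dot ff// gg//; ring.
Qed.

Lemma weak_deriv_unique i (f g g' : E -> R) : f \in L2 -> g \in L2 -> g' \in L2 ->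
  is_weak_deriv i f g -> is_weak_deriv i f g' -> nrm2 (g \- g') = 0.
Proof.
move=> fL gL gL' fg fg'; apply: test_fun_dense; first exact: Lfun2B.
move=> psi tpsi; rewrite dotpBl//; last exact: test_fun_L2.
by apply: oppr_inj; rewrite oppr0 opprB addrC -[- dotp g psi]fg// -[dotp g' psi]opprK -fg'// subrr.
Qed.

Lemma weakDP i (f : E -> R) : H1 f -> weakD i f \in L2 /\ is_weak_deriv i f (weakD i f).
Proof.
move=> [fL /(_ i)[g gL fg]].
exact: (@xgetPex _ (cst 0) [set g | g \in L2 /\ is_weak_deriv i f g]
  (ex_intro _ g (conj gL fg))).
Qed.

End weak_derivatives.

(** * Curves in L^2 *)

Section L2_curves.
Context d {T : measurableType d} {R : realType}.
Variable mu : {measure set T -> \bar R}.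
Local Notation SL2 := (Lfun mu 2%:E).
Local Notation dotp := (L2dot mu).
Local Notation nrm2 := (L2nrm mu).
Implicit Types (w z : R -> T -> R) (s t e : R).

(* Curves are only considered on [[0, +oo[]; their values at negative times are
   junk. *)
Definition L2cont w := (forall t, 0 <= t -> w t \in SL2) /\
  forall s e, 0 <= s -> 0 < e -> exists2 r, 0 < r &
    forall t, 0 <= t -> `|t - s| < r -> nrm2 (w t \- w s) <= e.

(** The first-order expansion without division, so that [t = s] needs no exclusion; at [s = 0] it is
    one-sided. *)
Definition L2deriv w w' := forall s e, 0 <= s -> 0 < e -> exists2 r, 0 < r &
  forall t, 0 <= t -> `|t - s| < r ->
    nrm2 (fun x => w t x - w s x - (t - s) * w' s x) <= e * `|t - s|.

Lemma L2cont_bound w s : L2cont w -> 0 <= s -> exists M r,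
  [/\ 0 < M, 0 < r & forall t, 0 <= t -> `|t - s| < r -> nrm2 (w t) <= M].
Proof.
move=> [wL wc] s0; have [r r0 rw] := wc s 1 s0 ltr01.
exists (nrm2 (w s) + 1), r; split=> //; first by rewrite ltr_wpDl// nrm2_ge0.
move=> t t0 ts; have -> : w t = (w t \- w s) \+ w s by apply/funext => x /=; ring.
apply: (le_trans (nrm2D _ _)) => //; [exact: Lfun2B (wL _ t0) (wL _ s0)|exact: wL|].
by have := rw _ t0 ts; lra.
Qed.

Lemma dotp_L2cont w z s e : L2cont w -> L2cont z -> 0 <= s -> 0 < e ->
  exists2 r, 0 < r & forall t, 0 <= t -> `|t - s| < r ->
    `|dotp (w t) (z t) - dotp (w s) (z s)| <= e.
Proof.
move=> cw cz s0 e0; have [M [r1 [M0 r10 wM]]] := L2cont_bound cw s0.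
case: (cw) => wL wc; case: (cz) => zL zc.
pose N := nrm2 (z s) + 1; have N0 : 0 < N by rewrite ltr_wpDl// nrm2_ge0.
have e1 : 0 < e / 2 / M by rewrite !divr_gt0.
have e2 : 0 < e / 2 / N by rewrite !divr_gt0.
have [r2 r20 zr] := zc s _ s0 e1; have [r3 r30 wr] := wc s _ s0 e2.
exists (Num.min r1 (Num.min r2 r3)); first by rewrite !lt_min r10 r20.
move=> t t0; rewrite !lt_min => /and3P[ts1 ts2 ts3].
have wtL := wL _ t0; have wsL := wL _ s0; have ztL := zL _ t0; have zsL := zL _ s0.
have -> : dotp (w t) (z t) - dotp (w s) (z s) =
    dotp (w t) (z t \- z s) + dotp (w t \- w s) (z s).
  by rewrite dotpBr// dotpBl//; ring.
apply: (le_trans (ler_normD _ _)).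
have h1 : `|dotp (w t) (z t \- z s)| <= e / 2.
  apply: (le_trans (CauchySchwarz_dotp wtL (Lfun2B ztL zsL))).
  rewrite -[leRHS](@mulfVK _ M) ?gt_eqF// mulrC.
  by apply: ler_pM; rewrite ?nrm2_ge0//; [exact: zr|exact: wM].
have h2 : `|dotp (w t \- w s) (z s)| <= e / 2.
  apply: (le_trans (CauchySchwarz_dotp (Lfun2B wtL wsL) zsL)).
  rewrite -[leRHS](@mulfVK _ N) ?gt_eqF//.
  by apply: ler_pM; rewrite ?nrm2_ge0//; [exact: wr|rewrite lerDl].
by move: h1 h2; lra.
Qed.

Lemma L2cont_cst f : f \in SL2 -> L2cont (fun=> f).
Proof.
move=> fL; split=> // s e _ e0; exists 1 => // t _ _.
have -> : f \- f = cst 0 by apply/funext => x /=; rewrite subrr.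
by rewrite nrm2_cst0 ltW.
Qed.

Lemma L2deriv_cst f : L2deriv (fun=> f) (fun=> cst 0).
Proof.
move=> s e _ e0; exists 1 => // t _ _.
have -> : (fun x => f x - f x - (t - s) * cst 0 x) = cst 0.
  by apply/funext => x /=; rewrite subrr mulr0 subr0.
by rewrite nrm2_cst0 mulr_ge0// ltW.
Qed.

(** Leibniz rule, at positive times because [is_derive] is two-sided. The error splits into the
    first-order remainder of [w] against [z s], that of [z] against [w t], and [h] times a term
    small by continuity of [w]. *)
Lemma dotp_L2deriv w w' z z' s : L2cont w -> L2cont z -> L2cont w' -> L2cont z' ->
  L2deriv w w' -> L2deriv z z' -> 0 < s ->
  is_derive s 1 (fun t => dotp (w t) (z t)) (dotp (w' s) (z s) + dotp (w s) (z' s)).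
Proof.
move=> cw cz cw' cz' dw dz s_gt0; have s0 := ltW s_gt0.
have wsL := cw.1 _ s0; have zsL := cz.1 _ s0.
have wsL' := cw'.1 _ s0; have zsL' := cz'.1 _ s0.
set l := (X in is_derive _ _ _ X).
suff h : (fun h : R => h^-1 *: (((fun t => dotp (w t) (z t)) \o shift s) (h *: 1) -
    dotp (w s) (z s))) @ 0^' --> l.
  by split; [apply: cvgP h|exact: cvg_lim h].
apply/cvgrPdist_le => /= e e0.
have [M [r1 [M0 r10 wM]]] := L2cont_bound cw s0.
pose N := nrm2 (z s) + nrm2 (z' s) + 1.
have N0 : 0 < N by rewrite ltr_wpDl// addr_ge0// nrm2_ge0.
have e1 : 0 < e / 3 / M by rewrite !divr_gt0.
have e2 : 0 < e / 3 / N by rewrite !divr_gt0.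
have [r2 r20 zr] := dz s _ s0 e1; have [r3 r30 wr] := dw s _ s0 e2.
have [r4 r40 wc] := cw.2 s _ s0 e2.
have ht (r : R) : 0 < r -> \forall h \near (0 : R)^', `|h| < r.
  exact: dnbhs0_lt.
near=> h.
have h_neq0 : h != 0 by near: h; exact: nbhs_dnbhs_neq.
pose t := h + s.
have ts : t - s = h by rewrite /t; ring.
have t0 : 0 <= t.
  have : `|h| < s by near: h; exact: ht.
  by rewrite /t ltr_norml => /andP[]; lra.
have ts1 : `|t - s| < r1 by rewrite ts; near: h; exact: ht.
have ts2 : `|t - s| < r2 by rewrite ts; near: h; exact: ht.
have ts3 : `|t - s| < r3 by rewrite ts; near: h; exact: ht.
have ts4 : `|t - s| < r4 by rewrite ts; near: h; exact: ht.
have wtL := cw.1 _ t0; have ztL := cz.1 _ t0.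
rewrite /= /GRing.scale /= mulr1 -/t.
have nh : 0 < `|h| by rewrite normr_gt0.
rewrite -(ler_pM2l nh) -normrM mulrBr mulrA mulfV// mul1r.
pose Aw := fun x => w t x - w s x - (t - s) * w' s x.
pose Az := fun x => z t x - z s x - (t - s) * z' s x.
have AwL : Aw \in SL2 by apply: Lfun2B; [exact: Lfun2B|exact: Lfun2Z].
have AzL : Az \in SL2 by apply: Lfun2B; [exact: Lfun2B|exact: Lfun2Z].
have wE : dotp Aw (z s) = dotp (w t) (z s) - dotp (w s) (z s) - h * dotp (w' s) (z s).
  rewrite (_ : Aw = (w t \- w s) \- (fun x => h * w' s x)).
    by rewrite dotpBl ?dotpBl ?dotpZl//; [exact: Lfun2B|exact: Lfun2Z].
  by apply/funext => x; rewrite /Aw ts.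
have zE : dotp (w t) Az = dotp (w t) (z t) - dotp (w t) (z s) - h * dotp (w t) (z' s).
  rewrite (_ : Az = (z t \- z s) \- (fun x => h * z' s x)).
    by rewrite dotpBr ?dotpBr ?dotpZr//; [exact: Lfun2B|exact: Lfun2Z].
  by apply/funext => x; rewrite /Az ts.
have dE : dotp (w t \- w s) (z' s) = dotp (w t) (z' s) - dotp (w s) (z' s).
  by rewrite dotpBl.
have -> : h * l - (dotp (w t) (z t) - dotp (w s) (z s)) =
    - (dotp Aw (z s) + dotp (w t) Az + h * dotp (w t \- w s) (z' s)).
  by rewrite wE zE dE /l; ring.
rewrite normrN; apply: (le_trans (ler_normD _ _)).
apply: (le_trans (lerD (ler_normD _ _) (lexx _))).
have zsN : nrm2 (z s) <= N by rewrite /N; have := nrm2_ge0 mu (z' s); lra.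
have zsN' : nrm2 (z' s) <= N by rewrite /N; have := nrm2_ge0 mu (z s); lra.
have h1 : `|dotp Aw (z s)| <= `|h| * (e / 3).
  apply: (le_trans (CauchySchwarz_dotp AwL zsL)).
  rewrite -[in leRHS](@mulfVK _ N _ (e / 3)) ?gt_eqF// mulrA.
  apply: ler_pM; rewrite ?nrm2_ge0//.
  by have := wr _ t0 ts3; rewrite [X in _ <= X]mulrC [X in `|X| * _]ts.
have h2 : `|dotp (w t) Az| <= `|h| * (e / 3).
  apply: (le_trans (CauchySchwarz_dotp wtL AzL)); rewrite mulrC.
  rewrite -[in leRHS](@mulfVK _ M _ (e / 3)) ?gt_eqF// mulrA.
  apply: ler_pM; rewrite ?nrm2_ge0//; last exact: wM.
  by have := zr _ t0 ts2; rewrite [X in _ <= X]mulrC [X in `|X| * _]ts.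
have h3 : `|h * dotp (w t \- w s) (z' s)| <= `|h| * (e / 3).
  rewrite normrM ler_wpM2l//.
  apply: (le_trans (CauchySchwarz_dotp (Lfun2B wtL wsL) zsL')).
  rewrite -[leRHS](@mulfVK _ N) ?gt_eqF//.
  by apply: ler_pM; rewrite ?nrm2_ge0//; exact: wc.
have -> : `|h| * e = `|h| * (e / 3) + `|h| * (e / 3) + `|h| * (e / 3) by field.
by move: h1 h2 h3; lra.
Unshelve. all: by end_near. Qed.

End L2_curves.

Lemma near_dist {R : realType} (x r : R) : 0 < r -> \forall s \near x, `|s - x| < r.
Proof. by move=> r0; apply/nbhs_ballP; exists r => // s; rewrite /ball/= distrC. Qed.

Lemma mean_value_bound {R : realType} (G g : R -> R) (a b c y : R) : a <= b ->
  (forall x, a <= x <= b -> is_derive x 1 G (g x)) ->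
  (forall x, a <= x <= b -> `|g x - y| <= c) ->
  `|G b - G a - (b - a) * y| <= c * (b - a).
Proof.
rewrite le_eqVlt => /predU1P[->|ab] dG gy.
  by rewrite !subrr mul0r subr0 normr0 mulr0.
have [x||x /[!in_itv]/=/andP[ax xb] ->] := MVT (f := G) (df := g) ab.
- by rewrite in_itv/= => /andP[ax xb]; apply: dG; rewrite !ltW.
- apply: continuous_in_subspaceT => x /[!inE]/= /[!in_itv]/= xab.
  apply/differentiable_continuous/derivable1_diffP.
  by have := dG _ xab => ?; exact: ex_derive.
rewrite [_ * y]mulrC -mulrBl normrM [`|b - a|]gtr0_norm ?subr_gt0//.
by rewrite ler_pM2r ?subr_gt0// gy// !ltW.
Qed.

(** * Primitives of curves in L^2 *)

Section L2_primitive.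
Context d {T : measurableType d} {R : realType}.
Variable mu : {measure set T -> \bar R}.
Local Notation SL2 := (Lfun mu 2%:E).
Local Notation dotp := (L2dot mu).
Local Notation nrm2 := (L2nrm mu).
Implicit Types (w z : R -> T -> R) (s t e b : R).

(** Duality: an estimate of the pairings with every [Z], linear in the norm of [Z], becomes a norm
    bound on taking [Z] to be [f] itself. *)
Lemma nrm2_le_dotp f c : 0 <= c -> dotp f f <= c * nrm2 f -> nrm2 f <= c.
Proof.
move=> c0; rewrite -sqr_nrm2 expr2.
have [->//|f0] := eqVneq (nrm2 f) 0.
by rewrite ler_pM2r// lt_neqAle eq_sym f0 nrm2_ge0.
Qed.

Lemma L2cont_uniform w b e : L2cont mu w -> 0 < e -> exists2 r, 0 < r &
  forall s t, 0 <= s <= b -> 0 <= t <= b -> `|s - t| < r -> nrm2 (w s \- w t) <= e.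
Proof.
move=> [wL wc] e0.
pose P r s := 0 <= s <= b ->
  forall t, 0 <= t <= b -> `|s - t| < r -> nrm2 (w s \- w t) <= e.
have /compact_near_coveringP/(_ R (0^'+) P) cov : compact `[(0:R), b].
  exact: segment_compact.
suff h x : `[0, b]%classic x -> \forall x' \near x & i \near 0^'+, P i x'.
  have [r [r0 Pr]] : exists r, 0 < r /\ forall s, `[0, b]%classic s -> P r s.
    apply: (@filter_ex _ (0^'+)); apply: filterI; last exact: cov _ h.
    exact: nbhs_right_gt.
  by exists r => // s t sb tb; apply: (Pr s) => //=; rewrite /= in_itv.
rewrite /= in_itv/= => /andP[x0 xb].
have [r r0 wr] := wc x (e / 2) x0 (divr_gt0 e0 (ltr0Sn R 1)).
near=> s r' => /= /andP[s0 sb] t /andP[t0 tb] st.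
have sx : `|s - x| < r / 2 by near: s; apply: near_dist; rewrite ?divr_gt0.
have tx : `|t - x| < r.
  have -> : t - x = (s - x) - (s - t) by ring.
  apply: (le_lt_trans (ler_normB _ _)).
  have : r' < r / 2 by near: r'; apply: nbhs_right_lt; rewrite divr_gt0.
  by move: sx st; lra.
have -> : w s \- w t = (w s \- w x) \- (w t \- w x) by apply/funext => y /=; ring.
have sx' : `|s - x| < r by apply: (lt_trans sx); rewrite ltr_pdivrMr//; lra.
apply: (le_trans (nrm2B _ _)); [exact: Lfun2B (wL _ _) (wL _ _)..|].
by have := wr _ s0 sx'; have := wr _ t0 tx; lra.
Unshelve. all: by end_near. Qed.

Lemma continuous_dotp_curve w Z (x : R) : L2cont mu w -> Z \in SL2 ->
  {for x, continuous (fun s => dotp (w (Num.max 0 s)) Z)}.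
Proof.
move=> cw ZL; apply/cvgrPdist_le => /= e e0.
have x0 : 0 <= Num.max 0 x by rewrite le_max lexx.
have [r r0 wr] := dotp_L2cont cw (L2cont_cst ZL) x0 e0.
near=> s; rewrite distrC; apply: wr; first by rewrite le_max lexx.
apply: (@le_lt_trans _ _ `|s - x|); last by near: s; apply: near_dist; rewrite ?divr_gt0.
by rewrite /Num.max; case: ltP => ?; case: ltP => ?; rewrite ler_norml; apply/andP;
  split; have := ler_norm (s - x); have := ler_norm (x - s); rewrite (distrC x); lra.
Unshelve. all: by end_near. Qed.

(** The curve is frozen at its initial value for negative times. Asking for the derivative from [-1]
    on makes it two-sided at [0], so the mean value theorem applies on intervals starting there. *)
Definition dotp_primitive w Z (G : R -> R) :=
  forall x : R, -1 < x -> is_derive x 1 G (dotp (w (Num.max 0 x)) Z).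

Lemma ex_dotp_primitive w Z : L2cont mu w -> Z \in SL2 ->
  exists G, dotp_primitive w Z G.
Proof. by move=> cw ZL; apply: antiderivative => x _; exact: continuous_dotp_curve. Qed.

(** The scalar mean value theorem does the work of a vector-valued one. It is used with [y] the
    value of [w] at a subdivision point, for Riemann sums, and with [y = w s], for the derivative of
    the primitive. *)
Lemma dotp_primitive_bound w Z G s t y e : L2cont mu w -> Z \in SL2 ->
  dotp_primitive w Z G -> y \in SL2 -> 0 <= s -> 0 <= t ->
  (forall x, Num.min s t <= x <= Num.max s t -> nrm2 (w x \- y) <= e) ->
  `|G t - G s - (t - s) * dotp y Z| <= e * nrm2 Z * `|t - s|.
Proof.
move=> cw ZL dG yL s0 t0 wy.
have h a b : 0 <= a -> a <= b -> (forall x, a <= x <= b -> nrm2 (w x \- y) <= e) ->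
    `|G b - G a - (b - a) * dotp y Z| <= e * nrm2 Z * (b - a).
  move=> a0 ab wab.
  apply: (@mean_value_bound _ G (fun x => dotp (w (Num.max 0 x)) Z)) => // x xab.
    by apply: dG; move/andP : xab => []; lra.
  have x0 : 0 <= x by move/andP : xab => []; lra.
  rewrite max_r// -dotpBl//; last exact: cw.1.
  apply: (le_trans (CauchySchwarz_dotp _ _)) => //; first exact: Lfun2B (cw.1 _ x0) yL.
  by rewrite ler_wpM2r ?nrm2_ge0// wab.
have [st|ts] := leP s t.
  rewrite [X in _ <= _ * X]ger0_norm ?subr_ge0//; apply: h => // x xst.
  by apply: wy; rewrite min_l// max_r.
rewrite [X in _ <= _ * X]ltr0_norm ?subr_lt0// opprB.
have -> : G t - G s - (t - s) * dotp y Z = - (G s - G t - (s - t) * dotp y Z) by ring.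
rewrite normrN; apply: h => //; first exact: ltW.
by move=> x xst; apply: wy; rewrite min_r ?max_l// ltW.
Qed.

(** Left endpoints of a subdivision of [[0, t]] into [N + 1] equal steps. *)
Definition riemann_sum w t (N : nat) : T -> R :=
  fun x => \sum_(i < N.+1) t / N.+1%:R * w (t * i%:R / N.+1%:R) x.

Lemma riemann_sum_L2 w t N : L2cont mu w -> 0 <= t -> riemann_sum w t N \in SL2.
Proof.
move=> [wL _] t0; rewrite /riemann_sum; apply: Lfun2_sum => i.
by apply: Lfun2Z; apply: wL; rewrite divr_ge0// mulr_ge0.
Qed.

(** The rank [N0] is chosen before [Z] and [G], thanks to uniform continuity of [w] on [[0, t]].
    This uniformity is what later yields convergence in norm and not merely weakly. *)
Lemma riemann_sum_bound w t e : L2cont mu w -> 0 <= t -> 0 < e ->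
  exists N0, forall N Z G, (N0 <= N)%N -> Z \in SL2 -> dotp_primitive w Z G ->
    `|dotp (riemann_sum w t N) Z - (G t - G 0)| <= e * t * nrm2 Z.
Proof.
move=> cw t0 e0; have [r r0 wr] := L2cont_uniform t cw e0.
have [N0 N0r] : exists N0 : nat, t / r < N0%:R.
  by exists (Num.bound (t / r)); have := archi_boundP (divr_ge0 t0 (ltW r0)).
exists N0 => N Z G NN ZL dG.
have N10 : 0 < N.+1%:R :> R by rewrite ltr0n.
have tN : t / N.+1%:R < r.
  rewrite ltr_pdivrMr// mulrC -ltr_pdivrMr//; apply: (lt_le_trans N0r).
  by rewrite ler_nat ltnW.
have tN0 : 0 <= t / N.+1%:R by rewrite divr_ge0.
pose p (i : nat) := t * i%:R / N.+1%:R.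
have pS i : p i.+1 - p i = t / N.+1%:R by rewrite /p -natr1; field; rewrite gt_eqF.
have p0 i : 0 <= p i by rewrite divr_ge0// mulr_ge0.
have GE : G t - G 0 = \sum_(i < N.+1) (G (p i.+1) - G (p i)).
  rewrite -(big_mkord xpredT (fun i => G (p i.+1) - G (p i))) telescope_sumr//.
  by rewrite /p mulfK ?gt_eqF// mulr0 mul0r.
rewrite GE /riemann_sum dotp_suml//; last first.
  by move=> i; apply: Lfun2Z; exact: cw.1 _ (p0 i).
rewrite -sumrB; apply: (le_trans (ler_norm_sum _ _ _)).
have -> : e * t * nrm2 Z = \sum_(i < N.+1) (e * nrm2 Z * (t / N.+1%:R)).
  by rewrite sumr_const card_ord -mulr_natr; field; rewrite gt_eqF.
apply: ler_sum => i _; rewrite dotpZl//; last exact: cw.1 _ (p0 i).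
rewrite distrC -(pS i) -[X in _ <= _ * X]ger0_norm ?(pS i)// -(pS i).
have pSi : p i <= p i.+1 by rewrite -subr_ge0 pS.
apply: (dotp_primitive_bound cw) => //; first exact: (cw.1 _ (p0 i)).
move=> x; rewrite min_l// max_r// => /andP[px xp].
have pt : p i.+1 <= t.
  by rewrite /p ler_pdivrMr// ler_wpM2l// ler_nat.
apply: wr.
- by rewrite (le_trans (p0 i))//= (le_trans xp).
- by rewrite p0/= (le_trans pSi).
- by apply: le_lt_trans tN; rewrite -(pS i) ger0_norm ?subr_ge0// lerD2r.
Qed.

(** Two late Riemann sums, tested with their difference [Z], are both close to the same number
    [G t - G 0]; hence they form a Cauchy sequence. The formula passes to the limit. *)
Lemma ex_weak_primitive w t : L2cont mu w -> 0 <= t ->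
  exists2 f, f \in SL2 & forall Z G, Z \in SL2 -> dotp_primitive w Z G ->
    dotp f Z = G t - G 0.
Proof.
move=> cw t0; have SL N := riemann_sum_L2 N cw t0.
have [e e0|f fL Sf] := @L2_complete _ _ _ mu (riemann_sum w t) SL.
  have e1 : 0 < e / 2 / (t + 1) by rewrite !divr_gt0// ltr_wpDl.
  have [N0 SN] := riemann_sum_bound cw t0 e1.
  exists N0 => k m Nk Nm; apply: nrm2_le_dotp; first exact: ltW.
  set Z := _ \- _; have ZL : Z \in SL2 by exact: Lfun2B.
  have [G dG] := ex_dotp_primitive cw ZL.
  have -> : dotp Z Z = (dotp (riemann_sum w t k) Z - (G t - G 0)) -
      (dotp (riemann_sum w t m) Z - (G t - G 0)).
    by rewrite [in LHS]/Z dotpBl//; ring.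
  have kE := SN k Z G Nk ZL dG; have mE := SN m Z G Nm ZL dG.
  have te : e / 2 / (t + 1) * t <= e / 2.
    rewrite -[in leRHS](@mulfVK _ (t + 1) _ (e / 2)) ?gt_eqF ?ltr_wpDl//.
    by rewrite ler_wpM2l ?lerDl// ltW.
  have := ler_wpM2r (nrm2_ge0 mu Z) te.
  have := ler_norm (dotp (riemann_sum w t k) Z - (G t - G 0)).
  have := ler_norm (- (dotp (riemann_sum w t m) Z - (G t - G 0))).
  by rewrite normrN; move: kE mE; lra.
exists f => // Z G ZL dG; apply/eqP; rewrite -subr_eq0 -normr_le0.
apply/ler_addgt0Pl => e e0; rewrite addr0.
pose c := nrm2 Z + 1; have c0 : 0 < c by rewrite ltr_wpDl// nrm2_ge0.
pose c' := t + 1; have c'0 : 0 < c' by rewrite ltr_wpDl.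
have e1 : 0 < e / 2 / c / c' by rewrite !divr_gt0.
have [N0 SN] := riemann_sum_bound cw t0 e1.
have e2 : 0 < e / 2 / c by rewrite !divr_gt0.
have [N [NN Nf]] : exists N, (N0 <= N)%N /\ nrm2 (riemann_sum w t N \- f) <= e / 2 / c.
  apply: (@filter_ex _ \oo); apply: filterI; first by exists N0.
  move/cvgr0Pnorm_le : Sf => /(_ _ e2); apply: filterS => N.
  by rewrite ger0_norm ?nrm2_ge0.
have -> : dotp f Z - (G t - G 0) =
    (dotp (riemann_sum w t N) Z - (G t - G 0)) - dotp (riemann_sum w t N \- f) Z.
  by rewrite dotpBl//; ring.
apply: (le_trans (ler_normB _ _)).
have h1 : `|dotp (riemann_sum w t N) Z - (G t - G 0)| <= e / 2.
  apply: (le_trans (SN N Z G NN ZL dG)).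
  have {2}-> : e / 2 = e / 2 / c / c' * c' * c by field; rewrite !gt_eqF.
  apply: ler_pM; [by apply: mulr_ge0 => //; exact: ltW|exact: nrm2_ge0| |].
    by rewrite ler_pM2l// lerDl.
  by rewrite lerDl.
have h2 : `|dotp (riemann_sum w t N \- f) Z| <= e / 2.
  apply: (le_trans (CauchySchwarz_dotp (Lfun2B (SL N) fL) ZL)).
  have -> : e / 2 = e / 2 / c * c by field; rewrite !gt_eqF.
  by apply: ler_pM; rewrite ?nrm2_ge0// lerDl.
by move: h1 h2; lra.
Qed.

(** [W t] is the limit at time [t]. Differentiability in norm follows by testing the first-order
    remainder with itself. The initial value is zero only almost everywhere, hence the statement by
    its norm. *)
Theorem L2_primitive w : L2cont mu w -> exists W,
  [/\ forall t, 0 <= t -> W t \in SL2, L2deriv mu W w & nrm2 (W 0) = 0].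
Proof.
move=> cw.
have /choice[W W_P] : forall t, exists f, 0 <= t -> f \in SL2 /\
    forall Z G, Z \in SL2 -> dotp_primitive w Z G -> dotp f Z = G t - G 0.
  move=> t; have [t0|t0] := leP 0 t; last by exists (cst 0).
  by have [f fL fP] := ex_weak_primitive cw t0; exists f.
have WL t : 0 <= t -> W t \in SL2 by move=> /W_P[].
exists W; split=> //; last first.
  have [W0L W0] := W_P 0 (lexx _); have [G dG] := ex_dotp_primitive cw W0L.
  by apply/eqP; rewrite -sqrf_eq0 sqr_nrm2 (W0 _ G)// subrr.
move=> s e s0 e0; have [r r0 wr] := cw.2 s e s0 e0.
exists r => // t t0 ts; set Z := fun x => _.
have ZL : Z \in SL2.
  by apply: Lfun2B; [exact: Lfun2B (WL _ t0) (WL _ s0)|exact: Lfun2Z (cw.1 _ s0)].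
apply: nrm2_le_dotp; first by rewrite mulr_ge0// ltW.
have [G dG] := ex_dotp_primitive cw ZL.
have -> : dotp Z Z = G t - G s - (t - s) * dotp (w s) Z.
  rewrite [X in dotp X _](_ : Z = (W t \- W s) \- (fun x => (t - s) * w s x))//.
  rewrite dotpBl//; [|exact: Lfun2B (WL _ t0) (WL _ s0)|exact: Lfun2Z (cw.1 _ s0)].
  rewrite dotpBl; [|exact: WL..|by []].
  rewrite dotpZl ?(cw.1 _ s0)// ((W_P t t0).2 Z G)// ((W_P s s0).2 Z G)//; ring.
apply: (le_trans (ler_norm _)); rewrite mulrAC.
apply: (dotp_primitive_bound cw) => //; first exact: cw.1.
move=> x xst; apply: wr.
  by move/andP : xst => [+ _]; apply: le_trans; rewrite le_min s0.
apply: le_lt_trans ts; move: xst.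
by have [st|st] := leP s t => /andP[sx xt]; rewrite ler_norml; apply/andP; split;
  have := ler_norm (t - s); have := ler_norm (s - t); rewrite (distrC s); lra.
Qed.

Lemma L2deriv_cont w w' : (forall t, 0 <= t -> w t \in SL2) ->
  (forall t, 0 <= t -> w' t \in SL2) -> L2deriv mu w w' -> L2cont mu w.
Proof.
move=> wL w'L dw; split=> // s e s0 e0; have [r r0 wr] := dw s 1 s0 ltr01.
pose c := 1 + nrm2 (w' s); have c0 : 0 < c by rewrite ltr_pwDl// nrm2_ge0.
exists (Num.min r (e / c)); first by rewrite lt_min r0 divr_gt0.
move=> t t0; rewrite lt_min => /andP[tr te].
have w'Z : (fun x => (t - s) * w' s x) \in SL2 by exact: Lfun2Z (w'L _ s0).
have -> : w t \- w s =
    ((w t \- w s) \- (fun x => (t - s) * w' s x)) \+ (fun x => (t - s) * w' s x).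
  by apply/funext => x /=; ring.
have wB := Lfun2B (wL _ t0) (wL _ s0).
apply: (le_trans (nrm2D _ _)) => //; first exact: Lfun2B wB w'Z.
have := wr _ t0 tr; rewrite nrm2Z ?w'L// => h.
have : c * `|t - s| <= e by rewrite mulrC -ler_pdivlMr// ltW.
by move: h; rewrite /c mul1r mulrDl mul1r mulrC; move=> ? ?; rewrite mulrC; lra.
Qed.

End L2_primitive.

(** * The equation integrated in time *)

Lemma near_lt_e {R : realType} (I : Type) (F : set_system I)
    (N : I -> \bar R) (e : R) : 0 < e -> (N t @[t --> F] --> 0%E) ->
  \forall t \near F, (N t < e%:E)%E.
Proof.
move=> e0 cN; apply: (cN [set x | (x < e%:E)%E]); apply: open_nbhs_nbhs.
by split; [exact: open_ereal_lt_ereal|rewrite /= lte_fin].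
Qed.

Section solution_space.
Context {R : realType} {n : nat}.
Local Notation E := 'rV[R]_n.
Local Notation mu := (@lebesgue_rV R n).
Local Notation dotp := (L2dot mu).
Local Notation nrm2 := (L2nrm mu).
Implicit Types (u w : R -> E -> R) (f g : E -> R) (i : 'I_n).

Lemma L2normE f : f \in L2 -> L2norm f = (nrm2 f)%:E.
Proof. exact: Lnorm2E. Qed.

Lemma near_within_ball (P : R -> Prop) (s : R) :
  (\forall t \near within [set t | 0 <= t] (nbhs s), P t) ->
  exists2 r : R, 0 < r & forall t, 0 <= t -> `|t - s| < r -> P t.
Proof.
move=> /nbhs_ballP[r /= r0 rP]; exists r => // t t0 ts.
by apply: rP => //; rewrite /ball/= distrC.
Qed.

Lemma C0_L2_cont u : C0_L2 u -> L2cont mu u.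
Proof.
move=> [uL uc]; split=> // s e s0 e0.
have /near_within_ball[r r0 ru] := near_lt_e e0 (uc s s0).
exists r => // t t0 ts; have := ru _ t0 ts.
by rewrite L2normE ?lte_fin; [exact: ltW|exact: Lfun2B (uL _ t0) (uL _ s0)].
Qed.

Lemma L2_derivative_deriv u v : (forall t, 0 <= t -> u t \in L2) ->
  (forall t, 0 <= t -> v t \in L2) -> L2_derivative u v -> L2deriv mu u v.
Proof.
move=> uL vL dv s e s0 e0.
have : \forall t \near within [set t | 0 <= t] (nbhs s), t != s ->
    (L2norm (fun x => (u t x - u s x) / (t - s) - v s x)%R < e%:E)%E.
  have dvs : nbhs s [set t | t != s -> 0 <= t ->
    (L2norm (fun x => (u t x - u s x) / (t - s) - v s x)%R < e%:E)%E].
    exact: near_lt_e e0 (dv s s0).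
  by apply: filterS dvs => t h t0 ts; exact: h.
move=> /near_within_ball[r r0 ru]; exists r => // t t0 ts.
have [->|t_s] := eqVneq t s.
  have -> : (fun x => u s x - u s x - (s - s) * v s x) = cst 0.
    by apply/funext => x /=; rewrite !subrr mul0r subr0.
  by rewrite nrm2_cst0 mulr_ge0// ltW.
have := ru _ t0 ts t_s.
pose A x := (t - s)^-1 * (u t x - u s x) - v s x.
have AL : A \in L2.
  by apply: Lfun2B (vL _ s0); apply: Lfun2Z; exact: Lfun2B (uL _ t0) (uL _ s0).
have -> : (fun x => (u t x - u s x) / (t - s) - v s x) = A.
  by apply/funext => x; rewrite /A mulrC.
rewrite L2normE// lte_fin => Ae.
have -> : (fun x => u t x - u s x - (t - s) * v s x) = (fun x => (t - s) * A x).
  by apply/funext => x; rewrite /A; field; rewrite subr_eq0.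
by rewrite nrm2Z// mulrC ler_wpM2r// ltW.
Qed.

Lemma le_H1norm f (x : \bar R) : (0 <= x)%E ->
  (x ^+ 2 <= L2norm f ^+ 2 + \sum_(i < n) L2norm (weakD i f) ^+ 2)%E ->
  (x <= H1norm f)%E.
Proof.
move=> x0 xf; rewrite /H1norm poweR12_sqrt; last exact: le_trans (sqre_ge0 x) xf.
by rewrite -[x]gee0_abs// -sqrte_sqr lee_sqrt// (le_trans (sqre_ge0 x) xf).
Qed.

Lemma L2norm_ge0 f : (0 <= L2norm f)%E.
Proof. exact: Lnorm_ge0. Qed.

Lemma L2norm_le_H1norm f : (L2norm f <= H1norm f)%E.
Proof.
apply: le_H1norm; first exact: L2norm_ge0.
by rewrite leeDl// sume_ge0// => i _; exact: sqre_ge0.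
Qed.

Lemma weakD_le_H1norm i f : (L2norm (weakD i f) <= H1norm f)%E.
Proof.
apply: le_H1norm; first exact: L2norm_ge0.
rewrite (bigD1 i)//= addeCA leeDl// adde_ge0 ?sqre_ge0//.
by rewrite sume_ge0// => j _; exact: sqre_ge0.
Qed.

Lemma H1B f g : H1 f -> H1 g -> H1 (f \- g).
Proof.
move=> fH gH; split; first exact: Lfun2B fH.1 gH.1.
move=> i; have [fL df] := weakDP i fH; have [gL dg] := weakDP i gH.
exists (weakD i f \- weakD i g); first exact: Lfun2B.
exact: is_weak_derivB fH.1 gH.1 fL gL df dg.
Qed.

(** [weakD] is a chosen representative, so it is additive only up to a function of norm zero, by
    uniqueness of weak derivatives. *)
Lemma nrm2_weakDB i f g : H1 f -> H1 g ->
  nrm2 (weakD i f \- weakD i g) <= nrm2 (weakD i (f \- g)).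
Proof.
move=> fH gH; have [fL df] := weakDP i fH; have [gL dg] := weakDP i gH.
have [bL db] := weakDP i (H1B fH gH); have BL := Lfun2B fL gL.
have -> : weakD i f \- weakD i g =
    weakD i (f \- g) \+ ((weakD i f \- weakD i g) \- weakD i (f \- g)).
  by apply/funext => x /=; ring.
apply: (le_trans (nrm2D bL (Lfun2B BL bL))).
rewrite (weak_deriv_unique (Lfun2B fH.1 gH.1) BL bL _ db) ?addr0//.
exact: is_weak_derivB fH.1 gH.1 fL gL df dg.
Qed.

Lemma C0_H1_cont u : C0_H1 u ->
  L2cont mu u /\ forall i, L2cont mu (fun t => weakD i (u t)).
Proof.
move=> [uH uc]; have wL i t t0 := (weakDP i (uH t t0)).1.
have near_H1 (s e : R) : 0 <= s -> 0 < e -> exists2 r : R, 0 < r &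
    forall t, 0 <= t -> `|t - s| < r -> (H1norm (u t \- u s)%R < e%:E)%E.
  by move=> s0 e0; have /near_within_ball := near_lt_e e0 (uc s s0).
split=> [|i]; (split; first by [move=> t t0; exact: (uH t t0).1|exact: wL]).
  move=> s e s0 e0; have [r r0 ru] := near_H1 s e s0 e0.
  exists r => // t t0 ts; have := le_lt_trans (L2norm_le_H1norm _) (ru _ t0 ts).
  by rewrite L2normE ?lte_fin; [exact: ltW|exact: (H1B (uH _ t0) (uH _ s0)).1].
move=> s e s0 e0; have [r r0 ru] := near_H1 s e s0 e0.
exists r => // t t0 ts; have := le_lt_trans (weakD_le_H1norm i _) (ru _ t0 ts).
have HB := H1B (uH _ t0) (uH _ s0).
rewrite L2normE ?lte_fin; last exact: (weakDP i HB).1.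
by move/ltW; apply: le_trans; apply: nrm2_weakDB; exact: uH.
Qed.

Lemma derive_time (phi : R * E -> R) t x :
  dt phi (t, x) = 'D_1 (fun s : R => phi (s, x)) t.
Proof.
rewrite /dt /derive; set F := (X in X @ _); set G := (X in _ = lim (X @ _)).
rewrite (_ : F = G)//; apply/funext => h; rewrite /F /G /=.
have -> : h *: ((1, 0) : R * E) + (t, x) = (h *: 1 + t, h *: (0 : E) + x) by [].
by rewrite scaler0 add0r.
Qed.

Lemma derive_space i (phi : R * E -> R) t x :
  dx i phi (t, x) = 'D_(basis_vec i) (fun y : E => phi (t, y)) x.
Proof.
rewrite /dx /derive; set F := (X in X @ _); set G := (X in _ = lim (X @ _)).
rewrite (_ : F = G)//; apply/funext => h; rewrite /F /G /=.
have -> : h *: ((0, basis_vec i) : R * E) + (t, x) = (h *: (0 : R) + t, h *: basis_vec i + x) by [].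
by rewrite scaler0 add0r.
Qed.

End solution_space.

Lemma is_derive_continuous {R : realType} (f : R -> R) (x df : R) :
  is_derive x 1 f df -> {for x, continuous f}.
Proof.
by move=> dfx; apply/differentiable_continuous/derivable1_diffP; exact: ex_derive.
Qed.

Lemma continuous_dist {R : realType} (f : R -> R) (x e : R) :
  {for x, continuous f} -> 0 < e ->
  exists2 r : R, 0 < r & forall t, `|t - x| < r -> `|f t - f x| <= e.
Proof.
move=> /cvgrPdist_le fx e0; have /nbhs_ballP[r /= r0 rf] := fx e e0.
by exists r => // t tx; rewrite distrC; apply: rf; rewrite /ball/= distrC.
Qed.

(** The conservation laws are proved at positive times, where derivatives are two-sided; right
    continuity extends them to the initial time. *)
Lemma cst_right0 {R : realType} (h : R -> R) :
  (forall a b, 0 < a -> a < b -> h a = h b) -> h t @[t --> 0^'+] --> h 0 ->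
  forall t, 0 <= t -> h t = h 0.
Proof.
move=> hE h0 t; rewrite le_eqVlt => /predU1P[<-//|t0].
have ht : h s @[s --> 0^'+] --> h t.
  apply: cvg_near_cst; near=> s; apply: hE; near: s.
    exact: nbhs_right_gt.
  exact: nbhs_right_lt.
exact: (cvg_unique (@Rhausdorff R) ht h0).
Unshelve. all: by end_near. Qed.

Lemma open_derive0 {R : realType} (f : R -> R) (U : set R) (v : R) : open U ->
  (forall t, U t -> f t = 0) -> forall t, U t -> 'D_v f t = 0.
Proof.
move=> oU f0 t Ut; rewrite -(derive_cst (0 : R^o) t v); apply: near_eq_derive.
by move: (open_nbhs_nbhs (conj oU Ut)); apply: filterS => s /f0.
Qed.

(** * Recovering a constant from its local averages in time *)

Section time_averages.
Context {R : realType}.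
Variable P : R -> R.
Hypothesis P' : forall x : R, is_derive x 1 P (bumpf x).
Hypothesis P0 : forall x : R, x <= -1 -> P x = 0.
Hypothesis P1 : forall x : R, 1 <= x -> P x = P 1.
Implicit Types (c Q : R -> R) (r s t x y : R).

Lemma step1_gt0 : 0 < P 1.
Proof.
have lt11 : -1 < 1 :> R by lra.
have [|x /[!in_itv]/=/andP[x1 x2]] := MVT (f := P) (df := bumpf) lt11 _.
  by apply: continuous_in_subspaceT => x _; exact: is_derive_continuous (P' x).
rewrite (P0 (lexx _)) subr0 => ->.
by rewrite mulr_gt0 ?subr_gt0// bump_gt0// ltr_norml x1.
Qed.

Lemma is_derive_step r s t : 0 < r ->
  is_derive t 1 (fun t => P ((t - s) / r)) (bumpf ((t - s) / r) / r).
Proof.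
move=> r0; apply: is_derive1_comp; apply: is_derive_eq.
by rewrite /GRing.scale/= /cst; ring.
Qed.

Lemma Ck_step_affine r s k : Ck k (fun t => P ((t - s) / r)).
Proof.
apply: (Ck_comp_affine (l := fun t => (t - s) / r) (l' := fun t => t / r)).
- by move=> t; apply: cvgMl; apply: cvgB; [exact: cvg_id|exact: cvg_cst].
- by move=> h v x; rewrite /GRing.scale/=; ring.
- exact: (Ck_step P' k).
Qed.

(* Cauchy's mean value theorem for [Q] and the step [P ((t - s) / r)], whose
   derivative is positive on [(s - r, s + r)]. *)
Lemma bump_average c Q r s x y : 0 < r -> x <= s - r -> s + r <= y ->
  (forall t, x <= t -> is_derive t 1 Q (bumpf ((t - s) / r) / r * c t)) ->
  exists2 xi, `|xi - s| < r & Q y - Q x = P 1 * c xi.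
Proof.
move=> r0 xs sy dQ.
(* The bump vanishes at distance at least [r] from [s], so [Q] only changes between [s - r] and
   [s + r]. *)
have outside a b : x <= a -> a <= b -> (forall t, a < t < b -> r <= `|t - s|) -> Q a = Q b.
  move=> xa ab far; apply: derive0_eq => // [t /[dup] tab /andP[at_ _]|].
    have -> : 0 = bumpf ((t - s) / r) / r * c t :> R.
      rewrite bump_eq0 ?mul0r// normrM normfV [`|r|]gtr0_norm// ler_pdivlMr// mul1r.
      exact: far.
    by apply: dQ; lra.
  apply: continuous_in_subspaceT => t /[!inE]/= /[!in_itv]/= /andP[at_ _].
  by apply: is_derive_continuous; apply: dQ; lra.
have -> : Q x = Q (s - r).
  by apply: outside => // t /andP[_ ts]; rewrite ler0_norm; lra.
have <- : Q (s + r) = Q y.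
  by apply: outside => //; [lra|move=> t /andP[st _]; rewrite ger0_norm; lra].
(* [h] takes the same value at [s - r] and [s + r], as the step rises from [0] to [P 1] between
   them. Its derivative therefore vanishes in between, and there the bump is positive. *)
pose D := Q (s + r) - Q (s - r).
pose h t := D * P ((t - s) / r) - P 1 * Q t.
have dh t : x <= t -> is_derive t 1 h (bumpf ((t - s) / r) / r * (D - P 1 * c t)).
  move=> xt; have dP := @is_derive_step r s t r0; have dQt := dQ t xt.
  by apply: is_derive_eq; rewrite /GRing.scale/= /cst; ring.
have srs : s - r < s + r by lra.
have [t||t /[!in_itv]/=/andP[t1 t2]] := MVT (f := h)
  (df := fun t => bumpf ((t - s) / r) / r * (D - P 1 * c t)) srs.
- by rewrite in_itv/= => /andP[? _]; apply: dh; lra.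
- apply: continuous_in_subspaceT => t /[!inE]/= /[!in_itv]/= /andP[? _].
  have xt : x <= t by lra.
  exact: is_derive_continuous (dh t xt).
have -> : h (s + r) - h (s - r) = 0.
  have e1 : (s + r - s) / r = 1 by field; rewrite gt_eqF.
  have e2 : (s - r - s) / r = -1 by field; rewrite gt_eqF.
  by rewrite /h e1 e2 (P0 (lexx _)) /D; ring.
have ts : `|t - s| < r by rewrite ltr_norml; lra.
have : 0 < bumpf ((t - s) / r) / r.
  by rewrite divr_gt0// bump_gt0// normrM normfV (gtr0_norm r0) ltr_pdivrMr// mul1r.
move: (bumpf _ / _) => B B0 /esym/eqP; rewrite !mulf_eq0 gt_eqF//=.
have -> : (s + r - (s - r) == 0) = false by apply: gt_eqF; lra.
by rewrite orbF subr_eq0 => /eqP Dc; exists t.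
Qed.

(* Tests against a smoothed indicator function of [[a, b]], of slopes [r]. *)
Lemma time_average_cst c : continuous c ->
  (forall (eta : R -> R) (a b : R), 0 < a -> a < b -> (forall k, Ck k eta) ->
     (forall t, eta t != 0 -> a <= t <= b) ->
     [/\ eta a = 0, eta b = 0, 'D_1 eta a = 0 & 'D_1 eta b = 0] ->
     forall Q, (forall t, 0 < t -> is_derive t 1 Q ('D_1 eta t * c t)) -> Q a = Q b) ->
  forall a b : R, 0 < a -> a < b -> c a = c b.
Proof.
move=> cc H a b a0 ab; apply/eqP; rewrite -subr_eq0 -normr_le0.
apply/ler_addgt0Pl => e e0; rewrite addr0.
have e20 : 0 < e / 2 by rewrite divr_gt0.
have [r [r0 ra rca rcb]] : exists r, [/\ 0 < r, r < a,
    forall t, `|t - a| < r -> `|c t - c a| <= e / 2 &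
    forall t, `|t - b| < r -> `|c t - c b| <= e / 2].
  have [ra ra0 rca] := continuous_dist (cc a) e20.
  have [rb rb0 rcb] := continuous_dist (cc b) e20.
  exists (Num.min (a / 2) (Num.min ra rb)); split.
  - by rewrite !lt_min divr_gt0// ra0.
  - by rewrite gt_min; apply/orP; left; lra.
  - by move=> t; rewrite !lt_min => /and3P[_ ta _]; exact: rca.
  - by move=> t; rewrite !lt_min => /and3P[_ _ tb]; exact: rcb.
(* The derivative of [eta] is a bump at [a] minus a bump at [b]. The equality [Q a = Q b] of the
   hypothesis, a way to say that [eta' c] has integral zero, then equates the averages of [c] near
   [a] and near [b]; [r < a] keeps the support at positive times. *)
pose eta t := P ((t - a) / r) - P ((t - b) / r).
have deta t : is_derive t 1 eta (bumpf ((t - a) / r) / r - bumpf ((t - b) / r) / r).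
  have := @is_derive_step r a t r0; have := @is_derive_step r b t r0 => ? ?.
  exact: is_deriveB.
have Deta t : 'D_1 eta t = bumpf ((t - a) / r) / r - bumpf ((t - b) / r) / r.
  by have := deta t => ?; rewrite derive_val.
have cut s : continuous (fun t => bumpf ((t - s) / r) / r * c t).
  move=> t; apply: cvgM; last exact: cc.
  apply: cvgMl; apply: (@continuous_comp _ _ _ (fun t => (t - s) / r) bumpf).
    by apply: cvgMl; apply: cvgB; [exact: cvg_id|exact: cvg_cst].
  exact: continuous_bump.
have [Qa dQa] := @antiderivative _ _ 0 (fun x _ => cut a x).
have [Qb dQb] := @antiderivative _ _ 0 (fun x _ => cut b x).
have [xa xar Ea] : exists2 xi, `|xi - a| < r & Qa (b + r) - Qa (a - r) = P 1 * c xi.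
  by apply: (@bump_average c) => // [|t ta]; [lra|apply: dQa; lra].
have [xb xbr Eb] : exists2 xi, `|xi - b| < r & Qb (b + r) - Qb (a - r) = P 1 * c xi.
  by apply: (@bump_average c) => // [|t ta]; [lra|apply: dQb; lra].
have small s t : t <= s - r -> (t - s) / r <= -1.
  by move=> ts; rewrite ler_pdivrMr//; lra.
have large s t : s + r <= t -> 1 <= (t - s) / r.
  by move=> ts; rewrite ler_pdivlMr//; lra.
have bumps s t : t <= s - r -> bumpf ((t - s) / r) = 0.
  by move=> /small ts; rewrite bump_eq0// ler0_norm; lra.
have bumpl s t : s + r <= t -> bumpf ((t - s) / r) = 0.
  by move=> /large ts; rewrite bump_eq0// ger0_norm; lra.
have Q_eq : Qa (a - r) - Qb (a - r) = Qa (b + r) - Qb (b + r).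
  apply: (H eta (a - r) (b + r) _ _ _ _ _ (fun t => Qa t - Qb t)).
  - by lra.
  - by lra.
  - move=> k; apply: CkD; first exact: Ck_step_affine.
    have -> : (fun t => - P ((t - b) / r)) = (fun t => -1 * P ((t - b) / r)).
      by apply/funext => t; rewrite mulN1r.
    by apply: CkM; [exact: Ck_cst|exact: Ck_step_affine].
  - move=> t; apply: contraNT; rewrite negb_and -!ltNge => /orP[ta|bt].
      by rewrite /eta !P0 ?subrr//; apply: small; lra.
    by rewrite /eta [P ((t - a) / r)]P1 1?[P ((t - b) / r)]P1 ?subrr//; apply: large; lra.
  - split.
    + by rewrite /eta !P0 ?subrr//; apply: small; lra.
    + by rewrite /eta [P ((_ - a) / r)]P1 1?[P ((_ - b) / r)]P1 ?subrr//; apply: large; lra.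
    + by rewrite Deta !bumps ?mul0r ?subrr//; lra.
    + by rewrite Deta !bumpl ?mul0r ?subrr//; lra.
  - move=> t t0; rewrite Deta mulrBl; have := dQa t t0; have := dQb t t0 => ? ?.
    exact: is_deriveB.
have cE : c xa = c xb.
  apply: (mulfI (lt0r_neq0 step1_gt0)); rewrite -Ea -Eb; move: Q_eq; lra.
have -> : c a - c b = (c xb - c b) - (c xa - c a) by rewrite cE; ring.
apply: (le_trans (ler_normB _ _)).
by have := rca _ xar; have := rcb _ xbr; lra.
Qed.

End time_averages.

Lemma smooth_derivable {R : realType} (eta : R -> R) (s : R) : (forall k, Ck k eta) ->
  is_derive s 1 eta ('D_1 eta s) /\
  is_derive s 1 (fun s => 'D_1 eta s) ('D_1 (fun s => 'D_1 eta s) s).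
Proof.
move=> Ceta; split; apply: DeriveDef => //; first exact: Ck_derivable (Ceta 1%N).
exact: Ck_derivable (Ck_derive (1 : R) (Ceta 2%N)).
Qed.

(** * The equation at a fixed time, against test functions in space *)

Section wave_in_time.
Context {R : realType} {n : nat}.
Local Notation E := 'rV[R]_n.
Local Notation mu := (@lebesgue_rV R n).
Local Notation dotp := (L2dot mu).
Local Notation nrm2 := (L2nrm mu).
Variables (V : E -> R) (M : R).
Hypothesis Vc : continuous V.
Hypothesis VM : forall x, `|V x| <= M.
Implicit Types (f g psi : E -> R) (i : 'I_n) (eta : R -> R) (a b s t : R).

Lemma Lfun2_potential f : f \in L2 -> (fun x => V x * f x) \in L2.
Proof.
move=> fL; have MfL := Lfun2Z M fL; apply: (le_Lfun2 _ MfL).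
  exact: measurable_funM (continuous_rV_measurable Vc) (Lfun2_measurable fL).
by move=> x /=; rewrite !normrM ler_wpM2r// (le_trans (VM x) (ler_norm _)).
Qed.

Definition spatial_op psi : E -> R := fun x =>
  V x * psi x - \sum_(i < n) 'D_(basis_vec i) (fun y => 'D_(basis_vec i) psi y) x.

Lemma spatial_op_L2 psi : test_fun setT psi -> spatial_op psi \in L2.
Proof.
move=> tpsi; apply: Lfun2B; first exact/Lfun2_potential/test_fun_L2.
apply: Lfun2_sum => i; apply: test_fun_L2.
by do 2! apply: test_fun_derive.
Qed.

Lemma wave_op_prod eta psi t x : (forall k, Ck k eta) -> test_fun setT psi ->
  wave_op V (fun z : R * E => eta z.1 * psi z.2) (t, x) =
  'D_1 (fun s => 'D_1 eta s) t * psi x + eta t * spatial_op psi x.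
Proof.
move=> Ceta tpsi; rewrite /wave_op /spatial_op /=.
have dtE (f : R -> R) (s : R) : derivable f s 1 -> 'D_1 (fun s : R => f s * psi x) s = 'D_1 f s * psi x.
  by move=> /(deriveMr (psi x)); rewrite mulrC.
have -> : dt (dt (fun z : R * E => eta z.1 * psi z.2)) (t, x) =
    'D_1 (fun s => 'D_1 eta s) t * psi x.
  rewrite derive_time -dtE; last by case: (smooth_derivable t Ceta) => _ [].
  congr ('D_1 _ t); apply/funext => s.
  by rewrite derive_time dtE//; case: (smooth_derivable s Ceta) => [[]].
have dxE i f y (a : R) : derivable f y (basis_vec i) ->
    'D_(basis_vec i) (fun y => a * f y) y = a * 'D_(basis_vec i) f y.
  exact: deriveMl.
have -> : \sum_(i < n) dx i (dx i (fun z : R * E => eta z.1 * psi z.2)) (t, x) =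
    eta t * \sum_(i < n) 'D_(basis_vec i) (fun y => 'D_(basis_vec i) psi y) x.
  rewrite mulr_sumr; apply: eq_bigr => i _; rewrite derive_space -dxE; last first.
    exact: test_fun_derivable (test_fun_derive (basis_vec i) tpsi).
  congr ('D_(basis_vec i) _ x); apply/funext => y.
  rewrite derive_space -dxE//; exact: test_fun_derivable tpsi.
by ring.
Qed.

Variables (u ut W : R -> E -> R).
Hypothesis cu : L2cont mu u.
Hypothesis cut : L2cont mu ut.
Hypothesis cW : L2cont mu W.
Hypothesis du : L2deriv mu u ut.
Hypothesis dW : L2deriv mu W u.
Hypothesis u_sol : distr_solution V u.

Lemma is_derive_dotp_test w w' f (s : R) : L2cont mu w -> L2cont mu w' ->
  L2deriv mu w w' -> f \in L2 -> 0 < s ->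
  is_derive s 1 (fun t => dotp (w t) f) (dotp (w' s) f).
Proof.
move=> cw cw' dw fL s0.
have := dotp_L2deriv cw (L2cont_cst fL) cw' (L2cont_cst (Lfun2_cst0 _)) dw (L2deriv_cst mu f) s0.
suff -> : dotp (w s) (cst 0) = 0 by rewrite addr0.
rewrite /L2dot; under eq_Rintegral do rewrite /= mulr0.
by rewrite Rintegral_cst// mul0r.
Qed.

(** The complement of [[a, b]] is open and [eta] vanishes on it, hence so does its second
    derivative, and the integral over positive times reduces to [[a, b]]. *)
Lemma distr_solution_time eta psi a b : 0 < a -> a < b -> (forall k, Ck k eta) ->
  (forall t, eta t != 0 -> a <= t <= b) -> test_fun setT psi ->
  \int[lebesgue_measure]_(t in `[a, b])
    ('D_1 (fun s => 'D_1 eta s) t * dotp (u t) psi + eta t * dotp (u t) (spatial_op psi)) = 0.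
Proof.
move=> a0 ab Ceta eta0 tpsi.
rewrite -[RHS](u_sol (test_fun_time Ceta a0 eta0 tpsi)).
rewrite Rintegral_mkcond [RHS]Rintegral_mkcond.
apply: eq_Rintegral => t _; rewrite !patchE.
have pL := test_fun_L2 tpsi; have sL := spatial_op_L2 tpsi.
have out (U : set R) : open U -> U `<=` [set t | ~~ (a <= t <= b)] -> U t ->
    'D_1 (fun s => 'D_1 eta s) t = 0 /\ eta t = 0.
  move=> oU Uab Ut; have e0 s : U s -> eta s = 0.
    by move=> /Uab/=; apply: contraNeq; exact: eta0.
  split; last exact: e0.
  have d0 := open_derive0 (1 : R) oU e0.
  exact: open_derive0 (1 : R) oU d0 t Ut.
have inner : 0 < t -> \int[mu]_x (u t x * wave_op V (fun z => eta z.1 * psi z.2) (t, x)) =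
    'D_1 (fun s => 'D_1 eta s) t * dotp (u t) psi + eta t * dotp (u t) (spatial_op psi).
  move=> t0; have uL := cu.1 t (ltW t0).
  have -> : (fun x => u t x * wave_op V (fun z => eta z.1 * psi z.2) (t, x)) =
      (fun x => u t x * ((fun x => 'D_1 (fun s => 'D_1 eta s) t * psi x) \+
        (fun x => eta t * spatial_op psi x)) x).
    by apply/funext => x; rewrite wave_op_prod.
  rewrite -/(dotp _ _) dotpDr ?dotpZr//; exact: Lfun2Z.
case: ifPn => [/[!inE]/=/[!in_itv]/= /andP[at_ tb]|/negP tab].
  have t0 : 0 < t by exact: lt_le_trans at_.
  by rewrite mem_set /= ?in_itv/= ?t0// inner.
case: ifPn => // /[!inE]/=/[!in_itv]/= /andP[t0 _]; rewrite inner//.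
have [ta|ta] := ltP t a.
  have [||->->] := out [set t | t < a] (@open_lt _ _) => [s /= sa||]; rewrite ?mul0r ?addr0//.
  by rewrite negb_and -ltNge sa.
have bt : b < t.
  rewrite ltNge; apply/negP => tb; apply: tab; rewrite inE/= in_itv/= ta.
  by [].
have [||->->] := out [set t | b < t] (@open_gt _ _) => [s /= sa||]; rewrite ?mul0r ?addr0//.
by rewrite negb_and -!ltNge sa orbT.
Qed.

(** The left side of the integrated equation, frozen at negative times to be continuous on the whole
    line. *)
Let conserved psi (t : R) : R :=
  dotp (ut (Num.max 0 t)) psi + dotp (W (Num.max 0 t)) (spatial_op psi).

Lemma continuous_conserved psi : test_fun setT psi -> continuous (conserved psi).
Proof.
move=> tpsi t; apply: cvgD; apply: continuous_dotp_curve => //.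
  exact: test_fun_L2.
exact: spatial_op_L2.
Qed.

(** [ut] has no derivative in L^2, so constancy is read from averages by [time_average_cst]. The
    function [F] carries out the integrations by parts in time: its derivative is the integrand [h]
    of [distr_solution_time]. As [eta] and [eta'] vanish at both ends, only [Q a - Q b] remains of
    the increment of [F]. *)
Lemma conserved_cst psi a b : test_fun setT psi -> 0 < a -> a < b ->
  conserved psi a = conserved psi b.
Proof.
move=> tpsi; have pL := test_fun_L2 tpsi; have sL := spatial_op_L2 tpsi.
have [P [P' P0 P1]] := @smooth_step R.
apply: (time_average_cst P' P0 P1 (continuous_conserved tpsi)) => {a b}.
move=> eta a b a0 ab Ceta eta0 [ea eb da db] Q dQ.
pose h t := 'D_1 (fun s => 'D_1 eta s) t * dotp (u t) psi + eta t * dotp (u t) (spatial_op psi).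
pose F t := 'D_1 eta t * dotp (u t) psi + eta t * dotp (W t) (spatial_op psi) - Q t.
have dF t : 0 < t -> is_derive t 1 F (h t).
  move=> t0; have d1 := is_derive_dotp_test cu cut du pL t0.
  have d2 := is_derive_dotp_test cW cu dW sL t0.
  have d3 := dQ t t0.
  have [d4 d5] := smooth_derivable t Ceta.
  apply: is_derive_eq; rewrite /h /conserved /GRing.scale/= max_r ?ltW//; ring.
have ch t : 0 < t -> {for t, continuous h}.
  move=> t0; apply: cvgD; apply: cvgM.
  - exact: (Ck_continuous (Ck_derive (1 : R) (Ck_derive (1 : R) (Ceta 2%N)))).
  - exact: is_derive_continuous (is_derive_dotp_test cu cut du pL t0).
  - exact: (Ck_continuous (Ceta 0%N)).
  - exact: is_derive_continuous (is_derive_dotp_test cu cut du sL t0).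
have : \int[lebesgue_measure]_(t in `[a, b]) h t = F b - F a.
  rewrite /Rintegral (@continuous_FTC2 _ _ F)//.
  - apply: continuous_in_subspaceT => t /[!inE]/= /[!in_itv]/= /andP[at_ _].
    by apply: ch; exact: lt_le_trans at_.
  - split.
    + move=> t; rewrite in_itv/= => /andP[at_ _].
      by have := dF t (lt_trans a0 at_) => ?; exact: ex_derive.
    + by apply: cvg_at_right_filter; exact: is_derive_continuous (dF a a0).
    + by apply: cvg_at_left_filter; exact: is_derive_continuous (dF b (lt_trans a0 ab)).
  - move=> t; rewrite in_itv/= => /andP[at_ _].
    by have := dF t (lt_trans a0 at_) => ?; rewrite derive1E derive_val.
rewrite distr_solution_time// /F ea eb da db; lra.
Qed.

Theorem weak_equation_time psi t : test_fun setT psi -> 0 <= t -> nrm2 (W 0) = 0 ->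
  dotp (ut t) psi + dotp (W t) (spatial_op psi) = dotp (ut 0) psi.
Proof.
move=> tpsi t0 W0; have sL := spatial_op_L2 tpsi.
have cE s : 0 <= s ->
    dotp (ut s) psi + dotp (W s) (spatial_op psi) = conserved psi s.
  by move=> s0; rewrite /conserved max_r.
have -> : dotp (ut 0) psi = conserved psi 0.
  rewrite -cE// (_ : dotp (W 0) _ = 0) ?addr0//; apply/eqP; rewrite -normr_le0.
  by apply: (le_trans (CauchySchwarz_dotp (cW.1 _ (lexx _)) sL)); rewrite W0 mul0r.
rewrite cE//; apply: cst_right0 => // [a b|]; first exact: conserved_cst.
by apply: cvg_at_right_filter; exact: continuous_conserved.
Qed.

End wave_in_time.

(** * Energy *)

Section L2_multiplication.
Context {R : realType} {n : nat}.
Local Notation E := 'rV[R]_n.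
Local Notation mu := (@lebesgue_rV R n).
Local Notation dotp := (L2dot mu).
Local Notation nrm2 := (L2nrm mu).
Variables (V : E -> R) (M : R).
Hypothesis Vc : continuous V.
Hypothesis VM : forall x, `|V x| <= M.
Implicit Types (f g : E -> R) (w z : R -> E -> R).

Lemma le_nrm2 f g : f \in L2 -> g \in L2 -> (forall x, `|f x| <= `|g x|) ->
  nrm2 f <= nrm2 g.
Proof.
move=> fL gL fg; apply: ler_wsqrtr; apply: le_Rintegral => //.
- exact: (Lfun2_integrableM fL fL).
- exact: (Lfun2_integrableM gL gL).
by move=> x _; rewrite -!expr2 -(real_normK (num_real (f x))) -(real_normK (num_real (g x)))
  lerXn2r ?nnegrE.
Qed.

Lemma nrm2_potential f : f \in L2 -> nrm2 (fun x => V x * f x) <= `|M| * nrm2 f.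
Proof.
move=> fL; rewrite -nrm2Z//; apply: le_nrm2; [exact: Lfun2_potential VM _ fL|exact: Lfun2Z|].
by move=> x; rewrite !normrM ler_wpM2r// (le_trans (VM x) (ler_norm _)).
Qed.

Lemma nrm2_potential_le f c : f \in L2 -> nrm2 f <= c / (`|M| + 1) ->
  nrm2 (fun x => V x * f x) <= c.
Proof.
move=> fL; have M1 : 0 < `|M| + 1 by rewrite ltr_wpDl.
rewrite ler_pdivlMr// => fc; apply: le_trans fc; apply: (le_trans (nrm2_potential fL)).
by rewrite mulrC ler_wpM2l ?nrm2_ge0// lerDl.
Qed.

Lemma L2cont_potential w : L2cont mu w -> L2cont mu (fun t x => V x * w t x).
Proof.
move=> [wL wc]; split=> [t t0|s e s0 e0]; first exact: (Lfun2_potential Vc VM (wL _ t0)).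
have M1 : 0 < `|M| + 1 by rewrite ltr_wpDl.
have [r r0 wr] := wc s _ s0 (divr_gt0 e0 M1).
exists r => // t t0 ts.
have -> : (fun x => V x * w t x) \- (fun x => V x * w s x) =
    fun x => V x * (w t \- w s) x by apply/funext => x /=; ring.
by apply: nrm2_potential_le; [exact: Lfun2B (wL _ t0) (wL _ s0)|exact: wr].
Qed.

Lemma L2deriv_potential w w' : (forall t, 0 <= t -> w t \in L2) ->
  (forall t, 0 <= t -> w' t \in L2) -> L2deriv mu w w' ->
  L2deriv mu (fun t x => V x * w t x) (fun t x => V x * w' t x).
Proof.
move=> wL w'L dw s e s0 e0; have M1 : 0 < `|M| + 1 by rewrite ltr_wpDl.
have [r r0 wr] := dw s _ s0 (divr_gt0 e0 M1).
exists r => // t t0 ts.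
have -> : (fun x => V x * w t x - V x * w s x - (t - s) * (V x * w' s x)) =
    fun x => V x * ((w t \- w s) \- (fun x => (t - s) * w' s x)) x.
  by apply/funext => x /=; ring.
apply: nrm2_potential_le.
  exact: Lfun2B (Lfun2B (wL _ t0) (wL _ s0)) (Lfun2Z _ (w'L _ s0)).
by have := wr _ t0 ts; rewrite mulrAC.
Qed.

End L2_multiplication.

Section right_limits.
Context d {T : measurableType d} {R : realType}.
Variable mu : {measure set T -> \bar R}.
Local Notation dotp := (L2dot mu).
Implicit Types (w z : R -> T -> R).

Lemma cvg_dotp_right0 w z : L2cont mu w -> L2cont mu z ->
  dotp (w t) (z t) @[t --> 0^'+] --> dotp (w 0) (z 0).
Proof.
move=> cw cz; apply/cvgrPdist_le => e e0.
have [r r0 rc] := dotp_L2cont cw cz (lexx 0) e0.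
near=> t; have t0 : 0 < t by near: t; exact: nbhs_right_gt.
rewrite distrC; apply: rc; first exact: ltW.
by rewrite subr0 gtr0_norm//; near: t; exact: nbhs_right_lt.
Unshelve. all: by end_near. Qed.

Lemma dotp_nrm2_eq0l f g : f \in Lfun mu 2%:E -> g \in Lfun mu 2%:E ->
  L2nrm mu f = 0 -> dotp f g = 0.
Proof.
move=> fL gL f0; apply/eqP; rewrite -normr_le0.
by apply: (le_trans (CauchySchwarz_dotp fL gL)); rewrite f0 mul0r.
Qed.

End right_limits.

Section energy.
Context {R : realType} {n : nat}.
Local Notation E := 'rV[R]_n.
Local Notation mu := (@lebesgue_rV R n).
Local Notation dotp := (L2dot mu).
Local Notation nrm2 := (L2nrm mu).
Implicit Types (f g psi : E -> R) (i : 'I_n) (a b s t : R).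

(** For a fixed test function the defect [h] of the relation between [W] and [dW] has as derivative
    the same defect for [w] and [dw], which is zero, and it vanishes at the initial time. *)
Lemma is_weak_deriv_primitive i (w dw W dW : R -> E -> R) :
  L2cont mu w -> L2cont mu dw -> L2cont mu W -> L2cont mu dW ->
  L2deriv mu W w -> L2deriv mu dW dw -> nrm2 (W 0) = 0 -> nrm2 (dW 0) = 0 ->
  (forall t, 0 <= t -> is_weak_deriv i (w t) (dw t)) ->
  forall t, 0 <= t -> is_weak_deriv i (W t) (dW t).
Proof.
move=> cw cdw cW cdW Ww dWdw W0 dW0 wdw t t0 phi tphi.
have pL := test_fun_L2 tphi.
have dL := test_fun_L2 (test_fun_derive (basis_vec i) tphi).
pose h t := dotp (W t) (fun x => 'D_(basis_vec i) phi x) + dotp (dW t) phi.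
suff : h t = h 0.
  rewrite /h !(dotp_nrm2_eq0l _ _ W0) ?(dotp_nrm2_eq0l _ _ dW0)//; last 2 first.
  - exact: cdW.1.
  - exact: cW.1.
  by rewrite addr0 => /eqP; rewrite addr_eq0 => /eqP.
apply: cst_right0 => // [a b a0 ab|]; last first.
  by apply: cvgD; [exact: cvg_dotp_right0 cW (L2cont_cst dL)|
                   exact: cvg_dotp_right0 cdW (L2cont_cst pL)].
have dh s : 0 < s -> is_derive s 1 h 0.
  move=> s0; have d1 := is_derive_dotp_test cW cw Ww dL s0.
  have d2 := is_derive_dotp_test cdW cdw dWdw pL s0.
  apply: is_derive_eq.
  have := wdw s (ltW s0) phi tphi; rewrite -/(dotp _ _) -/(dotp (dw s) phi) => ->.
  by rewrite addNr.
apply: derive0_eq; first exact: ltW.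
  by move=> s /andP[a_s _]; apply: dh; exact: lt_trans a_s.
apply: continuous_in_subspaceT => s /[!inE]/= /[!in_itv]/= /andP[a_s _].
exact: is_derive_continuous (dh s (lt_le_trans a0 a_s)).
Qed.

Variables (V : E -> R) (M : R).
Hypothesis Vc : continuous V.
Hypothesis VM : forall x, `|V x| <= M.

Variables (u ut W : R -> E -> R) (du G : 'I_n -> R -> E -> R).
Hypothesis cu : L2cont mu u.
Hypothesis cut : L2cont mu ut.
Hypothesis cW : L2cont mu W.
Hypothesis uut : L2deriv mu u ut.
Hypothesis Wu : L2deriv mu W u.
Hypothesis W0 : nrm2 (W 0) = 0.
Hypothesis cdu : forall i, L2cont mu (du i).
Hypothesis cG : forall i, L2cont mu (G i).
Hypothesis Gdu : forall i, L2deriv mu (G i) (du i).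
Hypothesis G0 : forall i, nrm2 (G i 0) = 0.
Hypothesis u_du : forall i t, 0 <= t -> is_weak_deriv i (u t) (du i t).
Hypothesis u_sol : distr_solution V u.

(** [weak_equation_H1] with [g = u t], which is allowed because [u t] lies in H^1. Its hypothesis is
    [weak_equation_time] after one of the two derivatives on [psi] has been moved to [W], producing
    [G i]. *)
Lemma weak_equation_solution t : 0 <= t ->
  dotp (ut t) (u t) + dotp (fun x => V x * W t x) (u t) - dotp (ut 0) (u t) +
  \sum_(i < n) dotp (G i t) (du i t) = 0.
Proof.
move=> t0; have utL := cut.1 _ t0; have ut0L := cut.1 _ (lexx 0).
have WL := cW.1 _ t0; have VWL := Lfun2_potential Vc VM WL.
have uL := cu.1 _ t0; have GL i := (cG i).1 _ t0; have duL i := (cdu i).1 _ t0.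
pose F := (ut t \+ (fun x => V x * W t x)) \- ut 0.
have utVWL := Lfun2D utL VWL; have FL : F \in L2 by exact: Lfun2B.
have FE g : g \in L2 ->
    dotp F g = dotp (ut t) g + dotp (fun x => V x * W t x) g - dotp (ut 0) g.
  by move=> gL; rewrite dotpBl ?dotpDl.
rewrite -FE//; apply: weak_equation_H1 => // [i|psi tpsi]; first exact: u_du.
have pL := test_fun_L2 tpsi.
have dL i := test_fun_L2 (test_fun_derive (basis_vec i) tpsi).
have ddL i := test_fun_L2 (test_fun_derive (basis_vec i) (test_fun_derive (basis_vec i) tpsi)).
rewrite FE// -(weak_equation_time Vc VM cu cut cW uut Wu u_sol tpsi t0 W0).
have -> : dotp (W t) (spatial_op V psi) = dotp (fun x => V x * W t x) psi +
    \sum_(i < n) dotp (G i t) (fun x => 'D_(basis_vec i) psi x).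
  pose S x := \sum_(i < n) 'D_(basis_vec i) (fun y => 'D_(basis_vec i) psi y) x.
  have SL : S \in L2 by exact: Lfun2_sum.
  have -> : spatial_op V psi = (fun x => V x * psi x) \- S by [].
  rewrite dotpBr//; last exact: (Lfun2_potential Vc VM pL).
  have -> : dotp (W t) (fun x => V x * psi x) = dotp (fun x => V x * W t x) psi.
    by apply: eq_Rintegral => x _; ring.
  rewrite [dotp (W t) S]dotpC /S dotp_suml// -sumrN; congr (_ + _); apply: eq_bigr => i _.
  have := is_weak_deriv_primitive cu (cdu i) cW (cG i) Wu (Gdu i) W0 (G0 i)
    (u_du i) t0 (test_fun_derive (basis_vec i) tpsi).
  by rewrite dotpC /L2dot => ->; rewrite opprK.
by ring.
Qed.

(** Multiplication by [V] being symmetric, the derivative of the energy is twice the left side of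
    [weak_equation_solution]. At time zero only the norm of [u] survives, since [W] and all [G i]
    start from zero. *)
Lemma energy_conservation t : 0 <= t ->
  dotp (u t) (u t) + \sum_(i < n) dotp (G i t) (G i t) +
    (dotp (fun x => V x * W t x) (W t) - 2 * dotp (ut 0) (W t)) = dotp (u 0) (u 0).
Proof.
have ut0L := cut.1 _ (lexx 0).
have cVW := L2cont_potential Vc VM cW; have cVu := L2cont_potential Vc VM cu.
have dVW := L2deriv_potential Vc VM cW.1 cu.1 Wu.
move=> t0; pose e s := dotp (u s) (u s) + \sum_(i < n) dotp (G i s) (G i s) +
    (dotp (fun x => V x * W s x) (W s) - 2 * dotp (ut 0) (W s)).
rewrite -/(e t); have -> : dotp (u 0) (u 0) = e 0.
  have W0L := cW.1 _ (lexx 0).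
  rewrite /e [X in _ + X + _]big1; last first.
    by move=> i _; have G0L := (cG i).1 _ (lexx 0); rewrite -sqr_nrm2 G0 expr0n.
  rewrite [dotp _ (W 0)]dotpC [dotp (ut 0) _]dotpC !(dotp_nrm2_eq0l _ _ W0)//.
    by ring.
  exact: (Lfun2_potential Vc VM W0L).
apply: cst_right0 => // [a b a0 ab|]; last first.
  apply: cvgD; [apply: cvgD|apply: cvgB].
  - exact: cvg_dotp_right0.
  - by apply: (cvg_big add_continuous) => i _; exact: cvg_dotp_right0.
  - exact: (cvg_dotp_right0 cVW cW).
  - apply: cvgMr; exact: (cvg_dotp_right0 (L2cont_cst ut0L) cW).
have de s : 0 < s -> is_derive s 1 e 0.
  move=> s0; have d1 := dotp_L2deriv cu cu cut cut uut uut s0.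
  have d2 i := dotp_L2deriv (cG i) (cG i) (cdu i) (cdu i) (Gdu i) (Gdu i) s0.
  have d3 := dotp_L2deriv cVW cW cVu cu dVW Wu s0.
  have d4 := is_derive_dotp_test cW cu Wu ut0L s0.
  have d2' := is_derive_sum d2.
  have -> : e = (fun t => dotp (u t) (u t)) +
      (\sum_(i < n) (fun t => dotp (G i t) (G i t))) +
      ((fun t => dotp (fun x => V x * W t x) (W t)) - 2 *: (fun t => dotp (W t) (ut 0))).
    by apply/funext => r; rewrite /e !fctE fct_sumE [dotp (ut 0) _]dotpC.
  have d := is_deriveD (is_deriveD d1 d2') (is_deriveB d3 (is_deriveZ 2 d4)).
  apply: (is_derive_eq d).
  have := weak_equation_solution (ltW s0).
  rewrite [dotp (u s) (ut s)]dotpC (_ : dotp (fun x => V x * u s x) (W s) =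
    dotp (fun x => V x * W s x) (u s)); last by apply: eq_Rintegral => x _; ring.
  rewrite [dotp (ut 0) _]dotpC.
  have -> : \sum_(i < n) (dotp (du i s) (G i s) + dotp (G i s) (du i s)) =
      2 * \sum_(i < n) dotp (G i s) (du i s).
    by rewrite mulr_sumr; apply: eq_bigr => i _; rewrite [dotp (du i s) _]dotpC; ring.
  by rewrite /GRing.scale/=; lra.
apply: derive0_eq; first exact: ltW.
  by move=> s /andP[a_s _]; apply: de; exact: lt_trans a_s.
apply: continuous_in_subspaceT => s /[!inE]/= /[!in_itv]/= /andP[a_s _].
exact: is_derive_continuous (de s (lt_le_trans a0 a_s)).
Qed.

End energy.

(** * The weighted bound on the source term *)

Section weighted_bound.
Context {R : realType} {n : nat}.
Local Notation E := 'rV[R]_n.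
Local Notation mu := (@lebesgue_rV R n).
Local Notation dotp := (L2dot mu).
Variables (V : E -> R) (M : R) (Omega : set E).
Hypothesis Vc : continuous V.
Hypothesis VM : forall x, `|V x| <= M.
Hypothesis V_ge0 : forall x, 0 <= V x.
Hypothesis V_gt0 : forall x, Omega x -> 0 < V x.
Hypothesis Omega_open : open Omega.

(** Completing the square: [(f - V w)^2 / V >= 0] on [Omega]. Elsewhere [f] is zero almost
    everywhere and [- V w^2 <= 0]. *)
Lemma J0_bound (f w : E -> R) : f \in L2 -> w \in L2 -> ess_supp f `<=` Omega ->
  (J0sq Omega V f < +oo)%E ->
  2 * dotp f w - dotp (fun x => V x * w x) w <= fine (J0sq Omega V f).
Proof.
move=> fL wL fOmega J0y; have VwL := Lfun2_potential Vc VM wL.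
have mO := open_rV_measurable Omega_open.
have mf := Lfun2_measurable fL; have mV := continuous_rV_measurable Vc.
(* Replacing [f] by its restriction lets the comparison hold at every point; the two agree almost
   everywhere by [ess_supp_negligible]. *)
pose fO x := f x * \1_Omega x.
have mfO : measurable_fun setT fO by apply: measurable_funM => //; exact: measurable_indic.
have fOL : fO \in L2.
  apply: (le_Lfun2 mfO fL) => x; rewrite /fO normrM ler_piMr//.
  by rewrite ger0_norm// indicE; case: (_ \in _).
have f_fO : f = fO %[ae mu].
  have [A [mA A0 fA]] := ess_supp_negligible f; exists A; split=> //.
  move=> x /= fx; apply: fA; split=> /=.
    move=> /fOmega Ox; apply: fx => _; rewrite /fO indicE mem_set ?mulr1//.
  apply/eqP => fx0; apply: fx => _; by rewrite /fO fx0 mul0r.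
rewrite (eq_ae_dotp fL fOL wL f_fO).
pose q x := (`|f x| ^+ 2 / V x) * \1_Omega x.
have mq : measurable_fun setT q.
  apply: measurable_funM; last exact: measurable_indic.
  apply: measurable_funM; first by apply: measurable_funX; exact: measurableT_comp.
  have -> : (fun x => (V x)^-1) = (fun x => V x `^ (-1)).
    by apply/funext => x; rewrite powR_inv1.
  exact: (measurableT_comp (measurable_powR (-1))) mV.
have q_ge0 x : 0 <= q x by rewrite mulr_ge0// divr_ge0.
have qE : (\int[mu]_x (q x)%:E = J0sq Omega V f)%E.
  rewrite /J0sq [RHS]integral_mkcond; apply: eq_integral => x _.
  by rewrite /q patchE indicE; case: ifPn => xO; rewrite ?xO ?mulr1 ?(negbTE xO) ?mulr0.
have iq : mu.-integrable setT (EFin \o q).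
  apply/integrableP; split; first exact/measurable_EFinP.
  by under eq_integral => x _ do rewrite /= ger0_norm//; rewrite qE.
have -> : fine (J0sq Omega V f) = \int[mu]_x q x by rewrite /Rintegral qE.
have -> : 2 * dotp fO w - dotp (fun x => V x * w x) w =
    dotp ((fun x => 2 * fO x) \- (fun x => V x * w x)) w.
  by rewrite dotpBl ?dotpZl//; exact: Lfun2Z.
apply: le_Rintegral => //.
  by apply: Lfun2_integrableM => //; apply: Lfun2B => //; exact: Lfun2Z.
move=> x _; rewrite /q /fO/= indicE; case: (boolP (x \in Omega)) => /= xO.
  have Vx : 0 < V x by apply: V_gt0; rewrite -inE.
  rewrite !mulr1 real_normK ?num_real//.
  have : 0 <= (f x - V x * w x) ^+ 2 / V x by rewrite divr_ge0// sqr_ge0.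
  have -> : (f x - V x * w x) ^+ 2 / V x =
      f x ^+ 2 / V x - (2 * f x - V x * w x) * w x by field; rewrite gt_eqF.
  by rewrite subr_ge0.
by rewrite !mulr0 sub0r mulNr -mulrA oppr_le0 mulr_ge0// -expr2 sqr_ge0.
Qed.

End weighted_bound.

(** * The uniform bound on the solution *)

Unset Implicit Arguments.
Set Strict Implicit.
Set Printing Implicit Defensive.

Theorem theorem1p2 (R : realType) (n : nat) (n_ge1 : (1 <= n)%N)
    (Omega : set 'rV[R]_n) (V : 'rV[R]_n -> R)
    (Omega_open : open Omega)
    (V_bounded : bounded_fun V) (V_continuous : continuous V)
    (V_gt0 : forall x, Omega x -> 0 < V x) (V_ge0 : forall x, 0 <= V x) :
  exists2 C : R, 0 < C &
    forall (u0 u1 : 'rV[R]_n -> R) (u : R -> 'rV[R]_n -> R),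
      H1 u0 -> u1 \in L2 -> ess_supp u1 `<=` Omega ->
      (J0sq Omega V u1 < +oo)%E ->
      weak_solution V u0 u1 u ->
      forall t : R, 0 <= t ->
        (L2norm (u t) <= C%:E * (L2norm u0 + J0 Omega V u1))%E.
Proof.
exists 1 => // u0 u1 u [u0L _] u1L u1Omega J0y [uH [ut [utL uut ut0]] u00 u_sol] t t0.
have [M VM] : exists M, forall x, `|V x| <= M.
  have [M [_ VM]] := V_bounded.
  by exists (M + 1) => x; apply: (VM (M + 1)) => //; rewrite ltrDl.
set mu := @lebesgue_rV R n.
have [cu cdu] := C0_H1_cont uH; have cut := C0_L2_cont utL.
have duut := L2_derivative_deriv cu.1 cut.1 uut.
have u_du i s : 0 <= s -> is_weak_deriv i (u s) (weakD i (u s)).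
  by move=> s0; have [] := weakDP i (uH.1 s s0).
have [W [WL dW W0]] := L2_primitive cu.
have cW := L2deriv_cont WL cu.1 dW.
(* These are primitives of the weak derivatives of [u], not weak derivatives chosen for [W]: the
   energy needs their derivative in time. *)
have /choice[G G_P] i : exists G, [/\ forall s, 0 <= s -> G s \in L2,
    L2deriv mu G (fun s => weakD i (u s)) & L2nrm mu (G 0) = 0].
  exact: L2_primitive (cdu i).
have cG i : L2cont mu (G i).
  by have [GL dG _] := G_P i; exact: L2deriv_cont GL (cdu i).1 dG.
have ut0L := cut.1 _ (lexx 0); have uL := cu.1 _ t0.
have := energy_conservation V_continuous VM cu cut cW duut dW W0 cdu cG _ _ u_du u_sol t0.
move=> /(_ (fun i => let: And3 _ dG _ := G_P i in dG)).
move=> /(_ (fun i => let: And3 _ _ G0 := G_P i in G0)).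
rewrite (eq_ae_dotp ut0L u1L (WL _ t0) ut0).
have u0L0 := cu.1 _ (lexx 0).
have -> : L2dot mu (u 0) (u 0) = L2nrm mu u0 ^+ 2.
  rewrite sqr_nrm2 (eq_ae_dotp u0L0 u0L u0L0 u00) dotpC.
  exact: (eq_ae_dotp u0L0 u0L u0L u00).
move=> energy.
have := J0_bound V_continuous VM V_ge0 V_gt0 Omega_open u1L (WL _ t0) u1Omega J0y.
have G_ge0 : 0 <= \sum_(i < n) L2dot mu (G i t) (G i t).
  by apply: sumr_ge0 => i _; exact: dotp_ge0.
have J_ge0 : (0 <= J0sq Omega V u1)%E.
  by apply: integral_ge0 => x _; rewrite lee_fin divr_ge0.
have J_fin : J0sq Omega V u1 \is a fin_num by rewrite ge0_fin_numE.
rewrite !L2normE// mul1e /J0 poweR12_sqrt// -{2}(fineK J_fin) /= -EFinD lee_fin => bound.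
(* Energy and weighted bound control the square of the norm by a sum of two squares; the nonnegative
   cross term of the squared sum is dropped. *)
rewrite -ler_sqr ?nnegrE ?addr_ge0 ?sqrtr_ge0//.
rewrite sqrrD (sqr_sqrtr (fine_ge0 J_ge0)) [leLHS]sqr_nrm2.
have : 0 <= L2nrm mu u0 * Num.sqrt (fine (J0sq Omega V u1)) *+ 2.
  by rewrite mulrn_wge0// mulr_ge0// sqrtr_ge0.
lra.
Qed.
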